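(* Let $S\subset\mathbb R^d$ be the closure of a bounded domain whose boundary is locally the graph of a Lipschitz function, and let $p\ge0$ be an integer. Then there exist $\epsilon>0$, a finite set $I\subset[2,3]$, real coefficients $(\psi_s)_{s\in I}$, and a smooth function $\phi:\mathcal V^\epsilon(S)\setminus S\to\mathbb R^d$ such that, with $\Phi_s(x)=x+s\phi(x)$, the following conditions hold: 1. for every polynomial $f$ of degree at most $p+d$, $\sum_{s\in I}\psi_sf(s)=f(0)$; 2. for all $x\in\mathcal V^\epsilon(S)\setminus S$, $\|\phi(x)\|\simeq\delta(x)$ and $\|\mathrm D^{1+r}\phi(x)\|\preceq\delta(x)^{-r}$ for $0\le r\le p$; 3. for all $s\in[2,3]$, $\Phi_s$ maps $\mathcal V^\epsilon(S)\setminus S$ into $S$, $\|\mathrm D\Phi_s(x)^{-1}\|\preceq1$, and $\Phi_s$ determines a diffeomorphism from $\mathcal V^\epsilon(S)\setminus S$ onto an interior neighborhood of $\partial S$.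
   Context: $\delta(x)$ is the distance from $x$ to $S$; $\mathcal V^\epsilon(S)=\bigcup_{x\in S}\mathbb B(x,\epsilon)$ is the $\epsilon$-neighborhood of $S$ ($\mathbb B(x,\epsilon)$ the open ball). $a\preceq b$ means $a\le Cb$ with a constant $C$ independent of $x$ and $s$, and $a\simeq b$ means $a\preceq b$ and $b\preceq a$. An interior neighborhood of $\partial S$ is a set of the form $U\cap\mathrm{int}(S)$ with $U$ an open neighborhood of $\partial S$. *)

(* Defs.v *)
From HB Require Import structures.
From mathcomp Require Import all_boot all_order all_algebra.
From mathcomp Require Import finmap.
From mathcomp Require Import all_classical all_reals all_analysis.
Import Order.TTheory GRing.Theory Num.Theory.
Import numFieldNormedType.Exports.
Set Implicit Arguments.
Unset Strict Implicit.
Unset Printing Implicit Defensive.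
Local Open Scope classical_set_scope.
Local Open Scope ring_scope.

(* R^d is 'rV[R]_d.  Its canonical norm in the library is the sup norm; it
   induces the usual topology and is used only for qualitative notions (open,
   closure, connected, bounded, Lipschitz, differentiable).  All metric
   quantities below (distance, balls, norms of derivatives) are Euclidean. *)

Definition dot (R : realType) (d : nat) (u v : 'rV[R]_d) : R :=
  \sum_i u ord0 i * v ord0 i.

Definition enorm (R : realType) (d : nat) (u : 'rV[R]_d) : R :=
  Num.sqrt (dot u u).

Definition dist_to (R : realType) (d : nat) (S : set 'rV[R]_d)
  (x : 'rV[R]_d) : R := inf [set enorm (x - y) | y in S].

Definition eball (R : realType) (d : nat) (x : 'rV[R]_d) (e : R) :
  set 'rV[R]_d := [set y | enorm (y - x) < e].

Definition nbd (R : realType) (d : nat) (e : R) (S : set 'rV[R]_d) :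
  set 'rV[R]_d := \bigcup_(x in S) eball x e.

Definition boundary (T : topologicalType) (A : set T) : set T :=
  closure A `\` interior A.

Definition domain (R : realType) (d : nat) (Om : set 'rV[R]_d) : Prop :=
  [/\ open Om, connected Om & Om !=set0].

Definition hyperplane (R : realType) (d : nat) (e : 'rV[R]_d) :
  set 'rV[R]_d := [set v | dot v e = 0].

(* Orthogonal projection onto [hyperplane e], for a unit vector e. *)
Definition hproj (R : realType) (d : nat) (e y : 'rV[R]_d) : 'rV[R]_d :=
  y - dot y e *: e.

(* Near each boundary point there are Cartesian coordinates (y', t), where t is
   the coordinate along a unit vector e and y' is the component in the
   hyperplane orthogonal to e, in which the boundary is the graph t = g(y') of a
   Lipschitz function g on that hyperplane and, as usual for Lipschitz domains,
   Om is the region t > g(y').  The values of g off the hyperplane are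
   irrelevant. *)
Definition lipschitz_boundary (R : realType) (d : nat) (Om : set 'rV[R]_d) :
    Prop :=
  forall x, boundary Om x ->
  exists (e : 'rV[R]_d) (g : 'rV[R]_d -> R) (k : R),
    [/\ enorm e = 1,
        k.-lipschitz_(hyperplane e) g &
        \forall y \near x,
          (boundary Om y <-> dot y e = g (hproj e y)) /\
          (Om y <-> g (hproj e y) < dot y e)].

Section Derivatives.
Context (R : realType) (d : nat).
Implicit Types (f : 'rV[R]_d -> 'rV[R]_d) (U : set 'rV[R]_d).

(* The k-th derivative D^k f(x) as a map of its k directions:
   iterD [:: v_1; ...; v_k] f x = D^k f(x)(v_1, ..., v_k). *)
Definition iterD (vs : seq 'rV[R]_d) f : 'rV[R]_d -> 'rV[R]_d :=
  foldr (fun v h => fun x => 'D_v h x) f vs.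

Definition smooth_on U f : Prop :=
  forall (vs : seq 'rV[R]_d) x, U x -> differentiable (iterD vs f) x.

(* Operator norms are extended-real suprema, so that a finite upper bound on
   them also asserts boundedness. *)
Definition derivative_norm (k : nat) f (x : 'rV[R]_d) : \bar R :=
  ereal_sup [set (enorm (iterD vs f x))%:E |
              vs in [set vs : k.-tuple 'rV[R]_d |
                      forall i, enorm (tnth vs i) <= 1]].

(* Matrices act on row vectors from the right, as for [jacobian]. *)
Definition opnorm (A : 'M[R]_d) : \bar R :=
  ereal_sup [set (enorm (v *m A))%:E | v in [set v | enorm v <= 1]].

Definition diffeomorphism U (V : set 'rV[R]_d) f : Prop :=
  [/\ set_bij U V f, smooth_on U f &
      exists h : 'rV[R]_d -> 'rV[R]_d,
        (forall x, U x -> h (f x) = x) /\ smooth_on V h].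

End Derivatives.

Definition interior_nbd (R : realType) (d : nat) (S V : set 'rV[R]_d) : Prop :=
  exists U : set 'rV[R]_d,
    [/\ open U, boundary S `<=` U & V = U `&` interior S].

(* Main.v *)
(* In a neighbourhood of the boundary, S contains a cone with vertex at each of
   its points; a partition of unity glues the axes of these cones into a smooth
   field eta such that z + s eta(z) is well inside S for small s > 0.  Summing
   over dyadic scales 2^-k and grid points z of S the functions 2^k b((x - z) 2^k),
   where b is a smooth bump adapted to the cone at z, gives a smooth function
   Q ~ 1/delta outside S, and rho = 1/Q satisfies rho ~ delta,
   |D^k rho| <= C delta^(1-k) and D_eta rho <= - c2 < 0.  The last property holds
   because every bump increases along eta.

   Take phi = K rho eta with K large.  For s >= 2 the step s K rho overshoots the
   boundary by a multiple of delta, so Phi_s(x) is interior to S.  For fixed y, let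
   x(t) be the solution of x + t eta(x) = y; then Phi_s(x) = y means x = x(t) with
   t = s K rho(x(t)), and as rho(x(t)) increases in t fast enough this equation has
   at most one solution, which exists when y is near the boundary, inside S.
   Differentiating, D_eta rho <= - c2 bounds the inverse of D Phi_s.  The weights
   psi are those of Lagrange interpolation at p + d + 1 nodes of [2, 3]. *)

Require Import Defs.
From HB Require Import structures.
From mathcomp Require Import all_boot all_order all_algebra.
From mathcomp Require Import finmap.
From mathcomp Require Import all_classical all_reals all_analysis.
From mathcomp Require Import perm ring lra zify.
Import Order.TTheory GRing.Theory Num.Theory.
Import numFieldNormedType.Exports.
Set Implicit Arguments.
Unset Strict Implicit.
Unset Printing Implicit Defensive.
Local Open Scope classical_set_scope.
Local Open Scope ring_scope.


(** Standard smooth substitutes for the distance control the size of the derivatives but not their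
    sign, and here D_eta rho must stay below a negative constant. A bump of compact support cannot
    be monotone along eta. Each bump therefore lives on an infinite cone around eta(z), in whose
    direction it increases, and Q is used only outside S. Within the reach of the cone condition, S
    contains a slightly wider cone at z, so the complement of S meets the support only near the
    vertex: S itself does the truncation. Three nested apertures, with coefficients |e|^2 minus c^2,
    3/4 c^2 and c^2/2, leave room for this and for the variation of eta.

    The sign also decides the invertibility of D Phi_s, which is the identity plus the rank-one map
    v -> s K (D_v rho) eta plus a term of order rho. The rank-one part is not small, but the factor
    1 + s K D_eta rho is at most -3, so no cancellation can occur. As phi is a multiple of eta,
    bijectivity reduces to a scalar equation, which an intermediate value argument solves without a
    quantitative inverse function theorem. *)

Section Euclid.
Context (R : realType) (d : nat).
Local Notation V := 'rV[R]_d.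
Implicit Types (u v w x y z : V) (a b : R).

Lemma dotC u v : dot u v = dot v u.
Proof. by apply: eq_bigr => i _; rewrite mulrC. Qed.

Lemma dotDl u v w : dot (u + v) w = dot u w + dot v w.
Proof. by rewrite /dot -big_split; apply: eq_bigr => i _; rewrite mxE mulrDl. Qed.

Lemma dotZl a u v : dot (a *: u) v = a * dot u v.
Proof. by rewrite /dot mulr_sumr; apply: eq_bigr => i _; rewrite mxE mulrA. Qed.

Lemma dotNl u v : dot (- u) v = - dot u v.
Proof. by rewrite -scaleN1r dotZl mulN1r. Qed.

Lemma dotBl u v w : dot (u - v) w = dot u w - dot v w.
Proof. by rewrite dotDl dotNl. Qed.

Lemma dotDr u v w : dot u (v + w) = dot u v + dot u w.
Proof. by rewrite !(dotC u) dotDl. Qed.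

Lemma dotZr a u v : dot u (a *: v) = a * dot u v.
Proof. by rewrite !(dotC u) dotZl. Qed.

Lemma dotNr u v : dot u (- v) = - dot u v.
Proof. by rewrite !(dotC u) dotNl. Qed.

Lemma dotBr u v w : dot u (v - w) = dot u v - dot u w.
Proof. by rewrite dotDr dotNr. Qed.

Definition dotE := (dotDl, dotDr, dotNl, dotNr, dotZl, dotZr).

Lemma dot_ge0 u : 0 <= dot u u.
Proof. by apply: sumr_ge0 => i _; rewrite -expr2 sqr_ge0. Qed.

Lemma enorm_ge0 u : 0 <= enorm u.
Proof. exact: sqrtr_ge0. Qed.

Lemma enorm_sqr u : enorm u ^+ 2 = dot u u.
Proof. by rewrite sqr_sqrtr ?dot_ge0. Qed.

Lemma enorm0 : enorm (0 : V) = 0.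
Proof.
by rewrite /enorm /dot big1 ?sqrtr0// => i _; rewrite mxE mul0r.
Qed.

Lemma enormZ a u : enorm (a *: u) = `|a| * enorm u.
Proof.
by rewrite /enorm dotZl dotZr mulrA -expr2 sqrtrM ?sqr_ge0// sqrtr_sqr.
Qed.

Lemma enormN u : enorm (- u) = enorm u.
Proof. by rewrite -scaleN1r enormZ normrN1 mul1r. Qed.

Lemma enormB u v : enorm (u - v) = enorm (v - u).
Proof. by rewrite -opprB enormN. Qed.

Lemma coord_le_enorm u i : `|u ord0 i| <= enorm u.
Proof.
rewrite -(ler_pXn2r (n := 2)) ?nnegrE ?enorm_ge0//.
rewrite enorm_sqr /dot real_normK ?num_real// (bigD1 i)//= expr2 lerDl.
by apply: sumr_ge0 => j _; rewrite -expr2 sqr_ge0.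
Qed.

Lemma enorm_eq0 u : enorm u = 0 -> u = 0.
Proof.
move=> u0; apply/rowP => i; rewrite mxE; apply/eqP; rewrite -normr_le0 -u0.
exact: coord_le_enorm.
Qed.

Lemma cauchy_schwarz u v : `|dot u v| <= enorm u * enorm v.
Proof.
rewrite -(ler_pXn2r (n := 2)) ?nnegrE ?mulr_ge0 ?enorm_ge0//.
rewrite exprMn !enorm_sqr real_normK ?num_real//.
have := dot_ge0 (dot v v *: u - dot u v *: v).
rewrite !dotE (dotC v u); have := dot_ge0 v; rewrite le_eqVlt => /orP[/eqP v0|v0].
  have /eqP : enorm v ^+ 2 = 0 by rewrite enorm_sqr.
  rewrite expf_eq0/= => /eqP/enorm_eq0 ->.
  by rewrite -(scale0r (0 : V)) !dotZr !mul0r expr0n/= mulr0.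
set p := dot v v in v0 *; set q := dot u v; set m := dot u u => h.
have : 0 <= p * (m * p - q ^+ 2) by lra.
by rewrite pmulr_rge0// subr_ge0.
Qed.

Lemma dot_le_enorm u v : dot u v <= enorm u * enorm v.
Proof. exact: le_trans (ler_norm _) (cauchy_schwarz _ _). Qed.

Lemma enormD u v : enorm (u + v) <= enorm u + enorm v.
Proof.
rewrite -(ler_pXn2r (n := 2)) ?nnegrE ?addr_ge0 ?enorm_ge0//.
rewrite enorm_sqr !dotE (dotC v u) sqrrD !enorm_sqr.
have := dot_le_enorm u v; rewrite mulr2n; lra.
Qed.

Lemma enorm_distD y x z : enorm (x - z) <= enorm (x - y) + enorm (y - z).
Proof. by have := enormD (x - y) (y - z); rewrite addrA subrK. Qed.

Lemma enorm_subD u v : enorm (u - v) <= enorm u + enorm v.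
Proof. by rewrite -(enormN v) enormD. Qed.

Lemma lerB_enorm u v : enorm u - enorm v <= enorm (u - v).
Proof. by rewrite lerBlDr -{1}(subrK v u) enormD. Qed.

Lemma enorm_sum (I : Type) (r : seq I) (P : pred I) (F : I -> V) :
  enorm (\sum_(i <- r | P i) F i) <= \sum_(i <- r | P i) enorm (F i).
Proof.
elim/big_ind2 : _ => //; first by rewrite enorm0.
by move=> ? ? ? ? h1 h2; rewrite (le_trans (enormD _ _))// lerD.
Qed.

Lemma enorm_delta i : enorm (delta_mx 0 i : V) = 1.
Proof.
rewrite /enorm /dot (bigD1 i)//= mxE !eqxx mulr1 big1 ?addr0 ?sqrtr1//.
by move=> j /negPf ji; rewrite mxE ji andbF mul0r.
Qed.

Lemma dot_delta u i : dot u (delta_mx 0 i : V) = u ord0 i.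
Proof.
rewrite /dot (bigD1 i)//= mxE !eqxx mulr1 big1 ?addr0//.
by move=> j /negPf ji; rewrite mxE ji andbF mulr0.
Qed.

Lemma row_delta u : u = \sum_i u ord0 i *: (delta_mx 0 i : V).
Proof. exact: row_sum_delta. Qed.

Lemma enorm_le_sum u : enorm u <= \sum_i `|u ord0 i|.
Proof.
rewrite {1}[u]row_delta; apply: (le_trans (enorm_sum _ _ _)).
by apply: ler_sum => i _; rewrite enormZ enorm_delta mulr1.
Qed.

Lemma coord_le_norm u i : `|u ord0 i| <= `|u|.
Proof. by rewrite [leRHS]/Num.Def.normr/= mx_normrE; exact: (le_bigmax _ _ (ord0, i)). Qed.

Lemma norm_le_enorm u : `|u| <= enorm u.
Proof.
rewrite [leLHS]/Num.Def.normr/= mx_normrE (bigmax_le _ (enorm_ge0 u))//=.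
by move=> [i j] _; rewrite (ord1 i); exact: coord_le_enorm.
Qed.

Lemma enorm_le_norm u : enorm u <= d%:R * `|u|.
Proof.
rewrite (le_trans (enorm_le_sum _))// -[in d%:R](card_ord d) mulr_natl -sumr_const.
by apply: ler_sum => i _; exact: coord_le_norm.
Qed.

Lemma enorm_nbhsP x (A : set V) :
  nbhs x A <-> exists2 r, 0 < r & forall y, enorm (y - x) < r -> A y.
Proof.
rewrite -nbhs_ballE; split=> [[r/= r0 h]|[r r0 h]].
  exists r => // y yx; apply: h; rewrite -ball_normE /=.
  by rewrite distrC (le_lt_trans (norm_le_enorm _)).
exists (r / d.+1%:R) => /=; first by rewrite divr_gt0.
move=> y; rewrite -ball_normE/= => yx; apply: h.
rewrite (le_lt_trans (enorm_le_norm _))//.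
move: yx; rewrite distrC ltr_pdivlMr// mulrC; apply: le_lt_trans.
by rewrite ler_wpM2r ?ler_nat.
Qed.

Lemma nearW_rV (P : V -> Prop) x : (forall y, P y) -> \forall y \near x, P y.
Proof. by move=> h; apply/enorm_nbhsP; exists 1. Qed.

Lemma enorm_openP (A : set V) :
  open A <-> forall x, A x ->
    exists2 r, 0 < r & forall y, enorm (y - x) < r -> A y.
Proof.
rewrite openE; split=> h x /h; first by move/enorm_nbhsP.
by move=> xr; apply/enorm_nbhsP.
Qed.

Lemma closed_outP (S : set V) x : closed S -> ~ S x ->
  exists2 r, 0 < r & forall y, S y -> r <= enorm (y - x).
Proof.
rewrite -openC => /enorm_openP h /h[r r0 hr]; exists r => // y Sy.
by rewrite leNgt; apply/negP => /hr.
Qed.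

Lemma enorm_continuous (f : V -> R) x (C : R) (h : R):
  0 < h ->
  (forall y, enorm (y - x) < h -> `|f y - f x| <= C * enorm (y - x)) ->
  {for x, continuous f}.
Proof.
move=> h0 fC; apply/(@cvgrPdist_lt R R V (nbhs x) (nbhs_filter x)) => e e0.
apply/enorm_nbhsP.
pose K := `|C| + 1; have K0 : 0 < K by rewrite ltr_wpDl.
exists (Num.min h (e / K)); first by rewrite lt_min h0 divr_gt0.
move=> y; rewrite lt_min => /andP[yh]; rewrite ltr_pdivlMr// => ye.
rewrite distrC (le_lt_trans (fC _ yh))// (le_lt_trans _ ye)// mulrC.
by rewrite ler_wpM2l ?enorm_ge0// (le_trans (ler_norm C))// lerDl.
Qed.

End Euclid.

(** * Distance to a closed set and its collar *)

Section Distance.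
Context (R : realType) (d : nat) (S : set 'rV[R]_d).
Hypothesis S0 : S !=set0.
Hypothesis Sc : closed S.
Implicit Types (x y : 'rV[R]_d).

Let hasinf x : has_inf [set enorm (x - y) | y in S].
Proof.
split; first by case: S0 => y Sy; exists (enorm (x - y)), y.
by exists 0 => _ [y _ <-]; exact: enorm_ge0.
Qed.

Lemma dist_to_le x y : S y -> dist_to S x <= enorm (x - y).
Proof. by move=> Sy; apply: ge_inf; [exact: (hasinf x).2 | exists y]. Qed.

Lemma dist_to_ge x a : (forall y, S y -> a <= enorm (x - y)) -> a <= dist_to S x.
Proof.
move=> h; apply: lb_le_inf; first exact: (hasinf x).1.
by move=> _ [y Sy <-]; exact: h.
Qed.

Lemma dist_to_adh x e : dist_to S x < e -> exists2 y, S y & enorm (x - y) < e.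
Proof. by move/(inf_lt (hasinf x).1) => [_ [y Sy <-]] ?; exists y. Qed.

Lemma dist_to_gt0 x : ~ S x -> 0 < dist_to S x.
Proof.
move=> /(closed_outP Sc)[r r0 h]; apply: (lt_le_trans r0).
by apply: dist_to_ge => y /h; rewrite enormB.
Qed.

Lemma dist_to_adh2 x : ~ S x -> exists2 y, S y & enorm (x - y) < 2 * dist_to S x.
Proof. by move=> /dist_to_gt0 h; apply: dist_to_adh; lra. Qed.

Lemma dist_to_lip x y : dist_to S x <= dist_to S y + enorm (x - y).
Proof.
rewrite -lerBlDr; apply: dist_to_ge => z Sz; rewrite lerBlDr addrC.
exact: le_trans (dist_to_le x Sz) (enorm_distD _ _ _).
Qed.

Lemma nbdE e x : nbd e S x <-> dist_to S x < e.
Proof.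
split=> [[y Sy]|/dist_to_adh[y Sy h]]; first exact/le_lt_trans/dist_to_le.
by exists y.
Qed.

Lemma collar_open e : open [set x | ~ S x /\ dist_to S x < e].
Proof.
apply/enorm_openP => x [Sx dx]; have [r r0 hr] := closed_outP Sc Sx.
exists (Num.min r (e - dist_to S x)); first by rewrite lt_min r0 subr_gt0.
move=> y; rewrite lt_min => /andP[yr ye]; split.
  by move=> /hr; rewrite leNgt yr.
by have := dist_to_lip y x; lra.
Qed.

End Distance.

(** * Differentiability and directional derivatives on row vectors *)

Section Differentiability.
Context (R : realType).

Section Generic.
Context (V W : normedModType R).
Implicit Types (f g : V -> W) (x : V).

Lemma differentiable_eps f x (L : {linear V -> W}) : continuous L ->
  (forall e, 0 < e -> \forall h \near (0 : V),
     `|f (h + x) - f x - L h| <= e * `|h|) ->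
  differentiable f x /\ 'd f x = L :> (V -> W).
Proof.
move=> Lc Lf.
have fE : f \o shift x = cst (f x) + L +o_ 0 id.
  apply/eqaddoP => e e0; move: (Lf e e0); apply: filterS => h /=.
  by rewrite /= !fctE opprD addrA.
have dE := diff_unique Lc fE; split => //.
by apply/diff_locallyP; rewrite dE.
Qed.

Lemma differentiableP_eps f x : differentiable f x ->
  forall e, 0 < e -> \forall h \near (0 : V),
     `|f (h + x) - f x - 'd f x h| <= e * `|h|.
Proof.
move=> /diff_locallyP[_ /eqaddoP h] e e0; move: (h e e0).
by apply: filterS => y /=; rewrite /= !fctE opprD addrA.
Qed.

Lemma near_eq_differentiable f g x : (\forall y \near x, f y = g y) ->
  differentiable f x -> differentiable g x.
Proof.
move=> fg df; have gx := nbhs_singleton fg.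
have dfc : continuous ('d f x) by exact: diff_continuous.
suff [] : differentiable g x /\ 'd g x = 'd f x :> (V -> W) by [].
apply: differentiable_eps => // e e0; have := differentiableP_eps df e0.
have : \forall h \near (0 : V), f (h + x) = g (h + x).
  by move: fg; rewrite (near_shift 0) /=; apply: filterS => y; rewrite /= subr0.
by apply: filterS2 => h -> ; rewrite gx.
Qed.

End Generic.

Section RowVectors.
Context (d : nat).
Local Notation V := 'rV[R]_d.

Lemma differentiable_rV (W : normedModType R) (f : W -> V) x :
  (forall j, differentiable (fun y => f y ord0 j) x) -> differentiable f x.
Proof.
move=> df; rewrite (_ : f = \sum_j (fun y => f y ord0 j *: (delta_mx 0 j : V))).
  apply: (@differentiable_sum R W V d (fun j y => f y ord0 j *: (delta_mx 0 j : V))).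
  by move=> j; exact: differentiableZl.
by apply/funext => y; rewrite fct_sumE; exact: row_delta.
Qed.

Lemma differentiable_coordf (W : normedModType R) (f : W -> V) x j :
  differentiable f x -> differentiable (fun y => f y ord0 j) x.
Proof.
move=> df; apply: (@differentiable_comp _ _ _ _ f (fun N : V => N ord0 j)) => //.
exact: differentiable_coord.
Qed.

Lemma derive_coordf (W : normedModType R) (f : W -> V) x v j :
  differentiable f x -> ('D_v f x) ord0 j = 'D_v (fun y => f y ord0 j) x.
Proof. by move=> df; rewrite derive_mx ?mxE//; exact: diff_derivable. Qed.

Lemma derive_delta (W : normedModType R) (f : V -> W) x v : differentiable f x ->
  'D_v f x = \sum_j v ord0 j *: 'D_(delta_mx 0 j) f x.
Proof.
move=> df; rewrite deriveE// {1}(row_delta v) linear_sum.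
by apply: eq_bigr => j _; rewrite linearZ /= deriveE.
Qed.

Lemma derive_comp_scalar (G : R -> R) (f : V -> R) x v a :
  differentiable f x -> is_derive (f x) 1 G a ->
  differentiable (G \o f) x /\ 'D_v (G \o f) x = a * 'D_v f x.
Proof.
move=> df [Gd Ga]; have dG : differentiable G (f x) by apply/derivable1_diffP.
have dc := differentiable_comp df dG; split => //.
rewrite [LHS]deriveE// diff_comp//= -Ga [X in X * _]deriveE// deriveE//.
set u := 'd f x v.
have -> : u = u *: (1 : R) by rewrite -[RHS]/(u * 1) mulr1.
by rewrite linearZ /= mulrC -[u *: 1]/(u * 1) mulr1.
Qed.

Lemma derive_comp_row (h : V -> V) (f : V -> R) x v :
  differentiable h x -> differentiable f (h x) ->
  differentiable (f \o h) x /\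
  'D_v (f \o h) x = \sum_j ('D_v h x) ord0 j * 'D_(delta_mx 0 j) f (h x).
Proof.
move=> dh df; have dc := differentiable_comp dh df; split=> //.
by rewrite deriveE// diff_comp//= -!deriveE// derive_delta.
Qed.

End RowVectors.
End Differentiability.

(** * Functions with weighted bounds on their derivatives *)

Section WeightedClass.
Context (R : realType) (d : nat).
Local Notation V := 'rV[R]_d.
Local Notation "'e_ j" := (delta_mx 0 j : V) (at level 8, j at level 2).

(* [cls U w n g f]: all partial derivatives of order [k <= n] of the functions
   [f i] on [U i] are O(g i * w i ^+ k), uniformly in [i]. *)
Fixpoint cls (I : Type) (U : I -> set V) (w : I -> V -> R) (n : nat)
    (g f : I -> V -> R) : Prop :=
  (exists2 C, 0 <= C & forall i x, U i x -> `|f i x| <= C * g i x) /\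
  (if n is n'.+1 then
    (forall i x, U i x -> differentiable (f i) x) /\
    (forall j, cls U w n' (fun i x => g i x * w i x) (fun i => 'D_'e_j (f i)))
  else True).

(** Membership is local and keeps its constants: at each point of the new family one member of the
    old family has to agree nearby, with equal gauge and weight at the point. Reindexing,
    restriction and gluing of families go through this. *)
Lemma cls_local (I I' : Type) (U : I -> set V) (U' : I' -> set V)
    (w : I -> V -> R) (w' : I' -> V -> R) n (g f : I -> V -> R)
    (g' f' : I' -> V -> R) :
  (forall i' x, U' i' x -> exists i, [/\ U i x, \forall y \near x, f i y = f' i' y,
     g i x = g' i' x & w i x = w' i' x]) ->
  cls U w n g f -> cls U' w' n g' f'.
Proof.
elim: n g f g' f' => [|n IH] g f g' f' h [[C C0 hC] d1].
  split=> //; exists C => // i' x /h[i [Ux /nbhs_singleton ff' <- _]].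
  by rewrite -ff' hC.
split; first exists C => // i' x /h[i [Ux /nbhs_singleton ff' <- _]].
  by rewrite -ff' hC.
case: d1 => d1 D1; split.
  move=> i' x /h[i [Ux ff' _ _]]; exact: near_eq_differentiable ff' (d1 _ _ Ux).
move=> j; apply: IH (D1 j) => i' x /h[i [Ux ff' gg' ww']]; exists i; split => //.
- move/nbhs_interior : ff'; apply: filterS => y yf.
  exact: near_eq_derive yf.
- by rewrite gg' ww'.
Qed.

Section Calculus.
Context (I : Type) (U : I -> set V) (w : I -> V -> R).
Hypothesis Uo : forall i, open (U i).
Hypothesis w0 : forall i x, U i x -> 0 <= w i x.
Implicit Types (f g : I -> V -> R).

Lemma cls_bound n g f : cls U w n g f ->
  exists2 C, 0 <= C & forall i x, U i x -> `|f i x| <= C * g i x.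
Proof. by case: n => [|n] []. Qed.

Lemma cls_diff n g f i x : cls U w n.+1 g f -> U i x -> differentiable (f i) x.
Proof. by case=> _ [h _]; exact: h. Qed.

Lemma cls_derive n g f j : cls U w n.+1 g f ->
  cls U w n (fun i x => g i x * w i x) (fun i => 'D_'e_j (f i)).
Proof. by case=> _ [_ h]; exact: h. Qed.

Lemma cls_ext n g f f' : (forall i x, U i x -> f i x = f' i x) ->
  cls U w n g f -> cls U w n g f'.
Proof.
move=> ff'; apply: cls_local => i x Ux; exists i; split => //.
by have := open_nbhs_nbhs (conj (@Uo i) Ux); apply: filterS => y /ff'.
Qed.

Lemma cls_pred n g f : cls U w n.+1 g f -> cls U w n g f.
Proof.
elim: n g f => [|n IH] g f [b [df Df]]; first by split.
by split=> //; split=> // j; exact/IH/Df.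
Qed.

Lemma cls_D n g f1 f2 : cls U w n g f1 -> cls U w n g f2 ->
  cls U w n g (fun i x => f1 i x + f2 i x).
Proof.
elim: n g f1 f2 => [|n IH] g f1 f2 [[C1 C10 h1] d1] [[C2 C20 h2] d2].
  split=> //; exists (C1 + C2); first exact: addr_ge0.
  by move=> i x Ux; rewrite mulrDl (le_trans (ler_normD _ _))// lerD// ?h1 ?h2.
split.
  exists (C1 + C2); first exact: addr_ge0.
  by move=> i x Ux; rewrite mulrDl (le_trans (ler_normD _ _))// lerD// ?h1 ?h2.
case: d1 d2 => [d1 D1] [d2 D2]; split.
  by move=> i x Ux; apply: differentiableD; [exact: d1|exact: d2].
move=> j; apply: cls_ext (IH _ _ _ (D1 j) (D2 j)) => i x Ux.
by rewrite [RHS]deriveD//; apply: diff_derivable; [exact: d1|exact: d2].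
Qed.

End Calculus.

Lemma cls_weight (I : Type) (U : I -> set V) (w w' : I -> V -> R) n
    (g g' f : I -> V -> R) :
  (forall m, (m <= n)%N -> exists2 C, 0 <= C & forall i x, U i x ->
     g i x * w i x ^+ m <= C * (g' i x * w' i x ^+ m)) ->
  cls U w n g f -> cls U w' n g' f.
Proof.
elim: n g g' f => [|n IH] g g' f gg' [[C C0 Cf] h].
  split=> //; have [C' C'0 h'] := gg' 0%N isT; exists (C * C'); first exact: mulr_ge0.
  move=> i x Ux; have := h' i x Ux; rewrite !expr0 !mulr1 => h1.
  by rewrite (le_trans (Cf _ _ Ux))// -mulrA ler_wpM2l.
split.
  have [C' C'0 h'] := gg' 0%N isT; exists (C * C'); first exact: mulr_ge0.
  move=> i x Ux; have := h' i x Ux; rewrite !expr0 !mulr1 => h1.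
  by rewrite (le_trans (Cf _ _ Ux))// -mulrA ler_wpM2l.
case: h => df Df; split=> // j; apply: IH (Df j) => m mn.
have [C' C'0 h'] := gg' m.+1 mn; exists C' => // i x Ux.
by have := h' i x Ux; rewrite !exprS !mulrA.
Qed.

Section Calculus2.
Context (I : Type) (U : I -> set V) (w : I -> V -> R).
Hypothesis Uo : forall i, open (U i).
Hypothesis w0 : forall i x, U i x -> 0 <= w i x.
Implicit Types (f g : I -> V -> R).

Lemma cls_amp n g g' f :
  (exists2 C, 0 <= C & forall i x, U i x -> g i x <= C * g' i x) ->
  cls U w n g f -> cls U w n g' f.
Proof.
move=> [C C0 Cg]; apply: cls_weight => m _; exists C => // i x Ux.
by rewrite mulrA ler_wpM2r ?exprn_ge0 ?w0 ?Cg.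
Qed.

Lemma cls_M n g1 g2 f1 f2 : cls U w n g1 f1 -> cls U w n g2 f2 ->
  cls U w n (fun i x => g1 i x * g2 i x) (fun i x => f1 i x * f2 i x).
Proof.
elim: n g1 g2 f1 f2 => [|n IH] g1 g2 f1 f2 c1 c2.
  case: c1 c2 => [[C1 C10 h1] _] [[C2 C20 h2] _].
  split=> //; exists (C1 * C2); first exact: mulr_ge0.
  by move=> i x Ux; rewrite normrM mulrACA ler_pM ?h1 ?h2.
have [[C1 C10 h1] [d1 D1]] := c1; have [[C2 C20 h2] [d2 D2]] := c2.
split.
  exists (C1 * C2); first exact: mulr_ge0.
  by move=> i x Ux; rewrite normrM mulrACA ler_pM ?h1 ?h2.
split; first by move=> i x Ux; apply: differentiableM; [exact: d1|exact: d2].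
move=> j; have e1 := IH _ _ _ _ (cls_pred c1) (D2 j).
have e2 := IH _ _ _ _ (cls_pred c2) (D1 j).
have ae h : cls U w n (fun i x => g2 i x * (g1 i x * w i x)) h ->
    cls U w n (fun i x => g1 i x * (g2 i x * w i x)) h.
  apply: cls_amp; exists 1 => // i x _; rewrite mul1r.
  by rewrite le_eqVlt mulrCA eqxx.
apply: cls_amp; last first.
  apply: cls_ext (cls_D Uo e1 (ae _ e2)) => // i x Ux.
  rewrite [RHS]deriveM; [|by apply: diff_derivable; exact: d1|by apply: diff_derivable; exact: d2].
  by [].
by exists 1 => // i x _; rewrite mul1r mulrA.
Qed.

Lemma cls_cst n g (c : I -> R) :
  (exists2 C, 0 <= C & forall i x, U i x -> `|c i| <= C * g i x) ->
  cls U w n g (fun i _ => c i).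
Proof.
elim: n g c => [|n IH] g c [C C0 h]; first by split=> //; exists C.
split; first by exists C.
split=> [i x _|j]; first exact: differentiable_cst.
apply: cls_ext (IH _ (fun=> 0) _) => //.
  by move=> i x _; rewrite [RHS]derive_cst.
exists C => // i x Ux; rewrite normr0 mulrA mulr_ge0 ?w0//.
by rewrite (le_trans (normr_ge0 (c i)))// h.
Qed.

Lemma cls_Z n g f (c : R) : cls U w n g f -> cls U w n g (fun i x => c * f i x).
Proof.
move=> cf; have c1 : cls U w n (fun _ _ => 1) (fun _ _ => c).
  by apply: (@cls_cst n _ (fun=> c)); exists `|c| => // i x Ux; rewrite mulr1.
by apply: cls_amp (cls_M c1 cf); exists 1 => // i x Ux.
Qed.

Lemma cls_B n g f1 f2 : cls U w n g f1 -> cls U w n g f2 ->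
  cls U w n g (fun i x => f1 i x - f2 i x).
Proof.
move=> c1 c2; apply: cls_ext (cls_D Uo c1 (cls_Z (-1) c2)) => // i x _.
by rewrite mulN1r.
Qed.

Lemma cls_affine n g (c : I -> V) (b : I -> R) :
  (exists2 C, 0 <= C & forall i x, U i x -> `|dot x (c i) + b i| <= C * g i x) ->
  (exists2 C, 0 <= C & forall i x, U i x -> enorm (c i) <= C * (g i x * w i x)) ->
  cls U w n g (fun i x => dot x (c i) + b i).
Proof.
case: n => [h _|n [C C0 h] [C' C'0 h']]; first by split.
split; first by exists C.
have E i : (fun x => dot x (c i) + b i) =
    (\sum_k (fun x : V => x ord0 k *: c i ord0 k)) + cst (b i).
  by apply/funext => x; rewrite -[RHS]/(_ x + b i) fct_sumE.
have df i x : differentiable (fun x => dot x (c i) + b i) x.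
  rewrite E; apply: differentiableD; last exact: differentiable_cst.
  apply: (@differentiable_sum R V R d (fun k x => x ord0 k *: c i ord0 k)) => k.
  by apply: (@differentiableZl R V R); exact: differentiable_coord.
split=> [i x _|j]; first exact: df.
apply: (@cls_ext _ _ _ _ _ _ (fun i _ => c i ord0 j)) => //.
  move=> i x _; apply/esym; rewrite /derive.
  apply: cvg_lim => //; apply: cvg_near_cst; near=> t.
  rewrite /= dotDl dotZl (dotC _ (c i)) dot_delta -[LHS]/(_ * _).
  rewrite [X in _ * X](_ : _ = t * c i ord0 j); last by ring.
  by rewrite mulKf//; near: t; exact: nbhs_dnbhs_neq.
apply: cls_cst; exists C' => // i x Ux.
by rewrite (le_trans (coord_le_enorm _ _))// h'.
Unshelve. all: by end_near. Qed.

(** The values of [f] stay in one compact interval, on which each [G k] is bounded. The whole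
    sequence of derivatives is carried because the chain rule passes from [G k] to [G k.+1]. *)
Lemma cls_comp n (G : nat -> R -> R) f :
  (forall k (t : R), is_derive t (1 : R) (G k) (G k.+1 t)) ->
  cls U w n (fun _ _ => 1) f -> forall k, cls U w n (fun _ _ => 1) (fun i x => G k (f i x)).
Proof.
move=> dG cf.
have bd k : exists2 C, 0 <= C & forall i x, U i x -> `|G k (f i x)| <= C * 1.
  have [B B0 fB] := cls_bound cf.
  have cG : {within `[-B, B], continuous (G k)}.
    apply: continuous_subspaceT => t; apply: differentiable_continuous.
    by apply/derivable1_diffP; case: (dG k t).
  have BB : - B <= B by lra.
  have [c1 _ h1] := EVT_max BB cG; have [c2 _ h2] := EVT_min BB cG.
  exists (`|G k c1| + `|G k c2|); first by rewrite addr_ge0.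
  move=> i x Ux; have fI : f i x \in `[-B, B].
    by rewrite in_itv/= -ler_norml (le_trans (fB _ _ Ux))// mulr1.
  have := h1 _ fI; have := h2 _ fI; rewrite mulr1 ler_norml.
  have := ler_norm (G k c1); have := ler_norm (- G k c2); rewrite normrN.
  have := normr_ge0 (G k c1); have := normr_ge0 (G k c2).
  by move=> *; apply/andP; split; lra.
elim: n cf bd => [|n IH] cf bd k; first by split; first exact: bd.
split; first exact: bd.
split=> [i x Ux|j].
  by have [] := derive_comp_scalar 0 (cls_diff cf Ux) (dG k (f i x)).
apply: (@cls_ext _ _ _ Uo _ _ (fun i x => G k.+1 (f i x) * 'D_'e_j (f i) x)).
  move=> i x Ux /=.
  by have [_ ->] := derive_comp_scalar 'e_j (cls_diff cf Ux) (dG k (f i x)).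
apply: cls_amp (cls_M (IH (cls_pred cf) bd k.+1) (cls_derive j cf)).
by exists 1 => // i x Ux; rewrite !mul1r.
Qed.

(** The derivative - f^-2 Df of the inverse has size g' g' (g w). Boundedness of g g' brings this
    back to g' w, which closes the induction. *)
Lemma cls_inv n g g' f : (forall i x, U i x -> f i x != 0) ->
  (exists2 C, 0 <= C & forall i x, U i x -> `|(f i x)^-1| <= C * g' i x) ->
  (exists2 C, 0 <= C & forall i x, U i x -> g i x * g' i x <= C) ->
  cls U w n g f -> cls U w n g' (fun i x => (f i x)^-1).
Proof.
move=> f0 [C C0 hC] [C' C'0 hC'].
have g'0 i x : U i x -> 0 <= g' i x.
  move=> Ux; have h : 0 < C * g' i x.
    by rewrite (lt_le_trans _ (hC _ _ Ux))// normr_gt0 invr_eq0 f0.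
  rewrite leNgt; apply/negP => g'0; move: h.
  by rewrite ltNge mulr_ge0_le0// ltW.
elim: n => [|n IH] cf; first by split=> //; exists C.
split; first by exists C.
have df i x : U i x -> differentiable (f i) x by move=> Ux; exact: cls_diff cf Ux.
split=> [i x Ux|j]; first by apply: differentiableV; [exact: df|exact: f0].
have c1 := IH (cls_pred cf).
have := cls_Z (-1) (cls_M (cls_M c1 c1) (cls_derive j cf)) => c2.
apply: (@cls_ext _ _ _ Uo _ _ (fun i x => -1 * ((f i x)^-1 * (f i x)^-1 * 'D_'e_j (f i) x))).
  move=> i x Ux; rewrite [RHS]deriveV ?f0//; last exact/diff_derivable/df.
  by rewrite -[RHS]/(_ * _) expr2 invfM mulN1r -mulNr.
apply: cls_amp c2; exists C' => // i x Ux.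
rewrite [leLHS](_ : _ = (g i x * g' i x) * (g' i x * w i x)); last by ring.
by rewrite ler_wpM2r ?mulr_ge0 ?g'0 ?w0 ?hC'.
Qed.

End Calculus2.
End WeightedClass.

Section Sums.
Context (R : realType) (d : nat).
Local Notation V := 'rV[R]_d.

Lemma derive_bigsum (J : Type) (s : seq J) (f : J -> V -> R) x v :
  (forall j, differentiable (f j) x) ->
  differentiable (fun y => \sum_(j <- s) f j y) x /\
  'D_v (fun y => \sum_(j <- s) f j y) x = \sum_(j <- s) 'D_v (f j) x.
Proof.
move=> df; elim: s => [|j s [IH1 IH2]].
  rewrite big_nil (_ : (fun _ => _) = cst 0); last first.
    by apply/funext => y; rewrite big_nil.
  by split; [exact: differentiable_cst|rewrite derive_cst].
rewrite (_ : (fun _ => _) = (f j) \+ (fun y => \sum_(j <- s) f j y)); last first.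
  by apply/funext => y; rewrite big_cons.
split; first exact: differentiableD.
by rewrite deriveD ?IH2 ?big_cons//; exact: diff_derivable.
Qed.

Lemma cls_bigsum (I J : Type) (U : I -> set V) (w : I -> V -> R) (s : seq J) n
    (g : I -> V -> R) (f : J -> I -> V -> R) : (forall i, open (U i)) ->
  (forall i x, U i x -> 0 <= w i x) -> (forall i x, U i x -> 0 <= g i x) ->
  (forall j, cls U w n g (f j)) ->
  cls U w n g (fun i x => \sum_(j <- s) f j i x).
Proof.
move=> Uo w0 g0 cf; elim: s => [|j s IH].
  apply: (@cls_ext _ _ _ _ _ Uo _ _ (fun _ _ => 0)).
    by move=> i x _; rewrite big_nil.
  apply: (@cls_cst _ _ _ _ _ Uo w0 _ _ (fun=> 0)).
  by exists 1 => // i x Ux; rewrite normr0 mul1r g0.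
apply: cls_ext (cls_D Uo (cf j) IH) => // i x Ux.
by rewrite big_cons.
Qed.

(** The gauge of the sum is the sum of the gauges, not the number of terms times a bound. Sums may
    thus be arbitrarily long as long as the gauges add up; taking pairs as indices makes the
    constant uniform in the summand. *)
Lemma cls_sum (I J : Type) (U : I -> set V) (w : I -> V -> R) (A : I -> seq J) n
    (g f : I -> J -> V -> R) : (forall i, open (U i)) ->
  (forall i x, U i x -> 0 <= w i x) ->
  cls (fun p : I * J => U p.1) (fun p => w p.1) n
      (fun p => g p.1 p.2) (fun p => f p.1 p.2) ->
  cls U w n (fun i x => \sum_(j <- A i) g i j x) (fun i x => \sum_(j <- A i) f i j x).
Proof.
move=> Uo w0; elim: n g f => [|n IH] g f [[C C0 hC] h].
  split=> //; exists C => // i x Ux; rewrite mulr_sumr.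
  rewrite (le_trans (ler_norm_sum _ _ _))// ler_sum// => j _; exact: (hC (i, j)).
split.
  exists C => // i x Ux; rewrite mulr_sumr.
  rewrite (le_trans (ler_norm_sum _ _ _))// ler_sum// => j _; exact: (hC (i, j)).
case: h => df Df; split=> [i x Ux|k].
  by have [] := @derive_bigsum J (A i) (f i) x 0 (fun j => df (i, j) x Ux).
apply: (@cls_ext _ _ _ _ _ Uo _ _ (fun i x => \sum_(j <- A i) 'D_(delta_mx 0 k) (f i j) x)).
  move=> i x Ux.
  by have [_ ->] := @derive_bigsum J (A i) (f i) x (delta_mx 0 k) (fun j => df (i, j) x Ux).
have := IH (fun i j x => g i j x * w i x) (fun i j => 'D_(delta_mx 0 k) (f i j)) (Df k).
by apply: cls_amp => //; exists 1 => // i x Ux; rewrite mul1r mulr_suml.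
Qed.

End Sums.

(** * From partial derivatives to iterated derivatives in arbitrary directions *)

Section IteratedDerivatives.
Context (R : realType) (d : nat).
Local Notation V := 'rV[R]_d.
Context (U : set V) (w : V -> R) (f : V -> V) (g : V -> R).
Hypothesis Uo : open U.
Hypothesis w0 : forall x, U x -> 0 <= w x.
Hypothesis g0 : forall x, U x -> 0 <= g x.
Hypothesis cf : forall n, cls (fun _ : 'I_d => U) (fun _ => w) n (fun _ => g)
  (fun j x => f x ord0 j).

Let D (B : R) (r : nat) : set (seq V * 'I_d) :=
  [set p | size p.1 = r /\ forall v, v \in p.1 -> enorm v <= B].

(** The open set of an index is empty unless its direction list has length r and entries of norm at
    most B, so one constant serves all admissible lists. A new direction is expanded in coordinates,
    and the free order [n] pays for the additional partial derivative. *)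
Lemma cls_iterD B r n : 0 <= B ->
  cls (fun p : seq V * 'I_d => [set x | U x /\ @D B r p]) (fun _ => w) n
    (fun _ x => g x * w x ^+ r) (fun p x => Defs.iterD p.1 f x ord0 p.2).
Proof.
move=> B0; have Dopen q p : open [set x | U x /\ @D B q p].
  have [Dp|Dp] := pselect (@D B q p).
    by rewrite (_ : [set x | _] = U)//; apply/seteqP; split=> x //= [].
  by rewrite (_ : [set x | _] = set0) ?open0//; apply/seteqP; split=> x //= [].
have w0' q (p : seq V * 'I_d) x : [set x | U x /\ @D B q p] x -> 0 <= w x by case=> /w0.
elim: r n => [|r IH] n.
  apply: cls_local (cf n) => -[vs j] x /= [Ux [/= /size0nil -> _]] /=.
  by exists j; split; rewrite ?expr0 ?mulr1//; exact: nearW_rV.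
have IHd vs j x : U x -> @D B r.+1 (vs, j) -> differentiable (Defs.iterD (behead vs) f) x.
  move=> Ux [/= sv hv]; apply: differentiable_rV => k.
  have /= := cls_diff (i := (behead vs, k)) (IH 1%N); apply; split=> //; split=> /=.
    by rewrite size_behead sv.
  by move=> v /mem_behead/hv.
pose c (k : 'I_d) (q : seq V * 'I_d) := head 0 q.1 ord0 k.
apply: (@cls_ext _ _ _ _ _ (Dopen _) _ _ (fun q x => \sum_(k <- index_enum 'I_d)
    c k q * 'D_(delta_mx 0 k) (fun y => Defs.iterD (behead q.1) f y ord0 q.2) x)).
  move=> [vs j] x /= [Ux Dv].
  have := IHd _ _ _ Ux Dv; case: vs Dv => [[]//|v vs] Dv /= df.
  rewrite derive_coordf// derive_delta//.
  exact: differentiable_coordf.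
apply: cls_bigsum => //; first exact: w0'.
  by move=> q x [Ux _]; rewrite mulr_ge0 ?exprn_ge0 ?w0 ?g0.
move=> k.
apply: (@cls_amp _ _ _ _ _ (w0' _) _ (fun q x => 1 * (g x * w x ^+ r * w x))).
  by exists 1 => // q x _; rewrite !mul1r exprSr mulrA.
apply: cls_M => //; first exact: w0'.
  apply: (@cls_cst _ _ _ _ _ (Dopen _) (w0' _) _ _ (c k)).
  exists B => // -[[|v vs] j] x /= [Ux [// sv hv]].
  by rewrite /c/= mulr1 (le_trans (coord_le_enorm _ _))// hv// mem_head.
have := cls_derive k (IH n.+1).
apply: cls_local => -[vs j] x /= [Ux [/= sv hv]].
exists (behead vs, j); split => //; last exact: nearW_rV.
split=> //; split; first by rewrite size_behead sv.
by move=> v /mem_behead/hv.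
Qed.

Lemma cls_smooth_on : smooth_on U f.
Proof.
move=> vs x Ux; apply: differentiable_rV => j.
have := @cls_iterD (\sum_(v <- vs) enorm v) (size vs) 1.
move=> /(_ _)/(cls_diff (i := (vs, j))); apply.
  by apply: sumr_ge0 => v _; exact: enorm_ge0.
split=> //; split=> //= v vvs; rewrite (perm_big _ (perm_to_rem vvs))/= big_cons.
by rewrite lerDl; apply: sumr_ge0 => u _; exact: enorm_ge0.
Qed.

Lemma cls_derivative_norm r : exists C, forall x, U x ->
  (derivative_norm r f x <= (C * (g x * w x ^+ r))%:E)%E.
Proof.
have [C C0 hC] := cls_bound (cls_iterD r 0 ler01).
exists (d%:R * C) => x Ux; apply: ge_ereal_sup => _ [vs hvs <-].
rewrite lee_fin (le_trans (enorm_le_sum _))// -mulrA -[in d%:R](card_ord d) mulr_natl.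
rewrite -sumr_const; apply: ler_sum => j _; apply: (hC (tval vs, j)); split => //.
split; first by rewrite /= size_tuple.
by move=> v /= /tnthP[i ->]; exact: hvs.
Qed.

End IteratedDerivatives.

(** * Smooth bumps *)

Section Flat.
Context (R : realType).
Implicit Types (P : {poly R}) (u y : R).

(** This class is closed under derivation: P becomes X^2 (P - P'), where X^2 is the u^-2 produced by
    differentiating 1/u. *)
Definition flat P u : R := if 0 < u then P.[u^-1] * expR (- u^-1) else 0.

Fixpoint bump_poly k : {poly R} :=
  if k is k'.+1 then 'X^2 * (bump_poly k' - (bump_poly k')^`()) else 1.

(* The successive derivatives of u |-> exp (- 1 / u) extended by 0. *)
Definition bumpf k u := flat (bump_poly k) u.

Lemma flat_pos P u : 0 < u -> flat P u = P.[u^-1] * expR (- u^-1).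
Proof. by rewrite /flat => ->. Qed.

Lemma flat_npos P u : u <= 0 -> flat P u = 0.
Proof. by rewrite /flat ltNge => ->. Qed.

Lemma poly_growth P : exists (C : R) (n : nat), 0 <= C /\
  forall y, 1 <= y -> `|P.[y]| <= C * y ^+ n.
Proof.
elim/poly_ind: P => [|P c [C [n [C0 h]]]].
  by exists 0, 0%N; split=> // y _; rewrite horner0 normr0 mul0r.
exists (C + `|c|), n.+1; split=> [|y y1]; first exact: addr_ge0.
have y0 : 0 <= y by lra.
rewrite hornerMXaddC (le_trans (ler_normD _ _))// mulrDl lerD//.
  by rewrite normrM (ger0_norm y0) exprSr mulrA ler_wpM2r// h.
by rewrite ler_peMr// exprn_ege1.
Qed.

Lemma expR_ge_pow n y : 0 <= y -> (y / n.+1%:R) ^+ n.+1 <= expR y.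
Proof.
move=> y0; have -> : expR y = expR (y / n.+1%:R) ^+ n.+1.
  by rewrite -expRM_natl mulrC divfK ?pnatr_eq0.
rewrite lerXn2r ?nnegrE ?expR_ge0 ?divr_ge0//.
by rewrite (le_trans _ (expR_ge1Dx _))// lerDr.
Qed.

(** The exponential beats every power of 1/h. Order 2 is what makes the difference quotient at 0
    tend to 0 in [is_derive_flat]. *)
Lemma flat_small P : exists2 C : R, 0 <= C &
  forall h, 0 < h -> h <= 1 -> `|flat P h| <= C * h ^+ 2.
Proof.
have [C [n [C0 hC]]] := poly_growth P.
exists (C * n.+2%:R ^+ n.+2) => [|h h0 h1]; first by rewrite mulr_ge0// exprn_ge0.
rewrite flat_pos// normrM (ger0_norm (expR_ge0 _)).
set y := h^-1; have y1 : 1 <= y by rewrite invf_ge1.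
have y0 : 0 < y by lra.
have -> : h = y^-1 by rewrite invrK.
clearbody y.
apply: (@le_trans _ _ (C * y ^+ n * expR (- y))).
  by rewrite ler_wpM2r ?expR_ge0// hC.
rewrite expRN -[leLHS]mulrA -[leRHS]mulrA ler_wpM2l//.
have := @expR_ge_pow n.+1 y (ltW y0); rewrite expr_div_n ler_pdivrMr ?exprn_gt0//.
move=> e1; rewrite exprVn ler_pdivrMr ?expR_gt0//. rewrite mulrAC ler_pdivlMr ?exprn_gt0//.
by rewrite -exprD addn2 mulrC.
Qed.

Lemma is_derive_flat P u :
  is_derive u (1 : R) (flat P) (flat ('X^2 * (P - P^`())) u).
Proof.
have [u0|u0|->] := ltrgt0P u.
- rewrite flat_pos//.
  have i1 : is_derive u (1 : R) (fun y : R => y^-1) (- u ^- 2).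
    have u1 : (id u : R) != 0 by rewrite gt_eqF.
    apply: is_derive_eq (is_deriveV u1 (is_derive_id u 1)) _.
    by rewrite -[LHS]/(_ * 1) mulr1.
  have i2 := is_derive1_comp (is_derive_poly P u^-1) i1.
  have i3 := @is_derive1_comp R expR (fun y => - y^-1) u _ _
    (is_derive_expR (- u^-1)) (is_deriveN i1).
  have i4 := is_deriveM i2 i3.
  apply: near_eq_is_derive; last first.
    apply: is_derive_eq i4 _; rewrite -[LHS]/(_ * _ + _ * _) /=.
    rewrite hornerM hornerXn hornerD hornerN.
    by rewrite exprVn; ring.
  near=> y; rewrite flat_pos//.
  by near: y; exact: lt_nbhsr.
- rewrite flat_npos ?ltW//.
  apply: near_eq_is_derive (is_derive_cst (0 : R) u (1 : R)).
  near=> y; rewrite flat_npos//.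
  by rewrite ltW//; near: y; exact: lt_nbhsl.
rewrite flat_npos//.
have [C C0 hC] := flat_small P.
have c0 : h^-1 *: ((flat P \o shift 0) (h *: 1) - flat P 0) @[h --> (0 : R)^'] --> (0 : R).
  apply/cvgrPdist_le => e e0; near=> h.
  rewrite sub0r normrN /= addr0 (flat_npos P (lexx 0)) subr0.
  rewrite -[h *: 1]/(h * 1) mulr1 -[X in `|X|]/(_ * _) normrM normfV.
  have h0 : h != 0 by near: h; exact: nbhs_dnbhs_neq.
  have [h1|h1] := ltP 0 h; last by rewrite flat_npos// normr0 mulr0 ltW.
  rewrite (gtr0_norm h1) ler_pdivrMl//.
  have hh : h <= Num.min 1 (e / (C + 1)).
    rewrite -[X in X <= _](gtr0_norm h1); near: h; apply: dnbhs0_le.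
    by rewrite lt_min ltr01 divr_gt0// ltr_wpDl.
  move: hh; rewrite le_min => /andP[h2 h3].
  rewrite (le_trans (hC _ h1 h2))// expr2 mulrCA ler_pM2l//.
  move: h3; rewrite ler_pdivlMr ?ltr_wpDl// mulrDr mulr1 mulrC => h3; lra.
by split; [apply/cvg_ex; exists 0|exact: cvg_lim].
Unshelve. all: by end_near. Qed.

Lemma is_derive_bumpf k u : is_derive u (1 : R) (bumpf k) (bumpf k.+1 u).
Proof. exact: is_derive_flat. Qed.

Lemma bumpf0E u : 0 < u -> bumpf 0 u = expR (- u^-1).
Proof. by move=> u0; rewrite /bumpf flat_pos// hornerC mul1r. Qed.

Lemma bumpf1E u : 0 < u -> bumpf 1 u = u^-2 * expR (- u^-1).
Proof.
move=> u0; rewrite /bumpf flat_pos//= derivC subr0 mulr1 hornerXn exprVn //.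
Qed.

Lemma bumpf0_ge0 u : 0 <= bumpf 0 u.
Proof.
have [u0|u0] := ltP 0 u; first by rewrite bumpf0E ?expR_ge0.
by rewrite /bumpf flat_npos.
Qed.

Lemma bumpf1_ge0 u : 0 <= bumpf 1 u.
Proof.
have [u0|u0] := ltP 0 u; last by rewrite /bumpf flat_npos.
by rewrite bumpf1E// mulr_ge0 ?expR_ge0// invr_ge0 exprn_ge0// ltW.
Qed.

Lemma bumpf_npos k u : u <= 0 -> bumpf k u = 0.
Proof. exact: flat_npos. Qed.

Lemma bumpf0_gt0 u : 0 < u -> 0 < bumpf 0 u.
Proof. by move=> u0; rewrite bumpf0E// expR_gt0. Qed.

Lemma bumpf0_le u v : u <= v -> bumpf 0 u <= bumpf 0 v.
Proof.
move=> uv; have [u0|u0] := ltP 0 u; last by rewrite (bumpf_npos _ u0) bumpf0_ge0.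
have v0 : 0 < v by lra.
by rewrite !bumpf0E// ler_expR lerN2 lef_pV2.
Qed.

End Flat.

Section Join.
Context (R : realType) (d : nat).
Local Notation V := 'rV[R]_d.

Definition join_fam (I1 I2 T : Type) (f1 : I1 -> T) (f2 : I2 -> T) (i : I1 + I2) : T :=
  match i with inl i => f1 i | inr i => f2 i end.

(** Together with [cls_local] this glues two formulas: each point selects the family that agrees
    with the glued function nearby. It serves to extend bumps by 0. *)
Lemma cls_join (I1 I2 : Type) (U1 : I1 -> set V) (U2 : I2 -> set V)
    (w1 : I1 -> V -> R) (w2 : I2 -> V -> R) n g1 g2 f1 f2 :
  (forall i x, U1 i x -> 0 <= w1 i x /\ 0 <= g1 i x) ->
  (forall i x, U2 i x -> 0 <= w2 i x /\ 0 <= g2 i x) ->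
  cls U1 w1 n g1 f1 -> cls U2 w2 n g2 f2 ->
  cls (join_fam U1 U2) (join_fam w1 w2) n (join_fam g1 g2) (join_fam f1 f2).
Proof.
move=> p1 p2; elim: n g1 g2 f1 f2 p1 p2 => [|n IH] g1 g2 f1 f2 p1 p2
  [[C1 C10 h1] d1] [[C2 C20 h2] d2].
  split=> //; exists (C1 + C2); first exact: addr_ge0.
  by move=> [] i x /= Ux; rewrite mulrDl; [
    rewrite (le_trans (h1 _ _ Ux))// lerDl mulr_ge0// (p1 _ _ Ux).2 |
    rewrite (le_trans (h2 _ _ Ux))// lerDr mulr_ge0// (p2 _ _ Ux).2].
split.
  exists (C1 + C2); first exact: addr_ge0.
  by move=> [] i x /= Ux; rewrite mulrDl; [
    rewrite (le_trans (h1 _ _ Ux))// lerDl mulr_ge0// (p1 _ _ Ux).2 |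
    rewrite (le_trans (h2 _ _ Ux))// lerDr mulr_ge0// (p2 _ _ Ux).2].
case: d1 d2 => [d1 D1] [d2 D2]; split.
  by move=> [] i x /= Ux; [exact: d1|exact: d2].
move=> j; have c := IH _ _ _ _ _ _ (D1 j) (D2 j).
apply: cls_local (c _ _).
- by move=> [] i x /= Ux; [exists (inl i)|exists (inr i)]; split => //; exact: nearW_rV.
- by move=> i x Ux; have [w0 g0] := p1 _ _ Ux; rewrite mulr_ge0.
- by move=> i x Ux; have [w0 g0] := p2 _ _ Ux; rewrite mulr_ge0.
Qed.

End Join.

(** * The regularized distance *)

Section Counting.
Context (R : realType).

Lemma count_interval (a b : R) N : 0 <= b - a + 1 ->
  \sum_(m < N) ((a < m%:R) && (m%:R < b))%:R <= b - a + 1.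
Proof.
move=> ab.
(* A count that ignores the upper end b; it is used at the last index below b. *)
have h M : \sum_(m < M) ((a < m%:R) && (m%:R < b))%:R <= Num.max 0 (M%:R - a) :> R.
  elim: M => [|M IH]; first by rewrite big_ord0 le_max lexx.
  rewrite big_ord_recr/= -natr1; case: (ltP a M%:R) => /= aM.
    have -> : Num.max 0 (M%:R + 1 - a) = M%:R - a + 1.
      by rewrite max_r; [ring|lra].
    rewrite lerD//; first by rewrite (le_trans IH)// max_r//; lra.
    by case: (M%:R < b) => /=.
  rewrite addr0 (le_trans IH)// ge_max !le_max lexx/=.
  by apply/orP; right; lra.
elim: N => [|N IH]; first by rewrite big_ord0.
rewrite big_ord_recr/=; case: (ltP N%:R b) => Nb; last by rewrite andbF addr0.
have [aN|aN] := ltP a N%:R; last by rewrite addr0.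
apply: (@le_trans _ _ (Num.max 0 (N%:R - a) + 1)).
  by rewrite /= lerD ?h.
by rewrite max_r; lra.
Qed.

Lemma geometric_cut (X : R) K : 0 <= X ->
  \sum_(k < K) (if 2 ^+ k <= X then 2 ^+ k else 0) <= 2 * X.
Proof.
move=> X0; have h M : \sum_(k < M) (if 2 ^+ k <= X then 2 ^+ k else 0) <= 2 ^+ M :> R.
  elim: M => [|M IH]; first by rewrite big_ord0.
  rewrite big_ord_recr/= exprS mulr2n mulrDl mul1r lerD//.
  by case: ifP => // _; rewrite exprn_ge0.
elim: K => [|K IH]; first by rewrite big_ord0 mulr_ge0.
rewrite big_ord_recr/=; case: ifPn => KX; last by rewrite addr0.
by have := h K; lra.
Qed.

Lemma grid_count d N (t : 'I_d -> R) (X : R) : 0 <= X ->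
  \sum_(j : {ffun 'I_d -> 'I_N}) (\big[andb/true]_i (`|t i - (j i)%:R| < X))%:R
    <= (2 * X + 1) ^+ d :> R.
Proof.
move=> X0; pose P : R := \prod_(i < d) \sum_(m < N) (`|t i - m%:R|%R < X)%R%:R.
apply: (@le_trans _ R P); rewrite /P.
  rewrite bigA_distr_bigA/=; apply: ler_sum => j _.
  elim/big_rec2 : _ => [|i b p _ hp] //; case: (_ < X) => /=.
    by rewrite mul1r.
  by rewrite mul0r.
rewrite -[in leRHS](card_ord d) -prodr_const; apply: ler_prod => i _.
rewrite sumr_ge0//=.
have -> : 2 * X + 1 = (t i + X) - (t i - X) + 1 by ring.
have ab : 0 <= (t i + X)%R - (t i - X)%R + 1 :> R by lra.
apply: le_trans (count_interval N ab).
apply: ler_sum => m _; rewrite ler_nat; case: ltP => // h.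
suff -> : (t i - X < m%:R) && (m%:R < t i + X) by [].
by move: h; rewrite ltr_norml => /andP[h1 h2]; apply/andP; split; lra.
Qed.

End Counting.

Section Cone.
Context (R : realType) (d : nat).
Local Notation V := 'rV[R]_d.

Section Algebra.
Variables (c H T : R) (u e : V) (a b : R).
Hypotheses (c0 : 0 < c) (H0 : 0 < H) (ce : c <= enorm e) (eH : enorm e <= H).
Hypotheses (T0 : 0 < T).
Let be := dot e e - c ^+ 2 / 2.

Lemma cone_beta_gt0 : 0 < be.
Proof.
have : c ^+ 2 <= dot e e by rewrite -enorm_sqr lerXn2r ?nnegrE ?enorm_ge0// ltW.
have : 0 < c ^+ 2 by rewrite exprn_gt0.
rewrite /be; lra.
Qed.

Lemma cone_beta_le : be <= H ^+ 2.
Proof.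
have : dot e e <= H ^+ 2 by rewrite -enorm_sqr lerXn2r ?nnegrE ?enorm_ge0// ltW.
have : 0 < c ^+ 2 by rewrite exprn_gt0.
rewrite /be; lra.
Qed.

(** By Cauchy-Schwarz, (be u.e)^2 is at most a^2 be |e|^2, and be |e|^2 = (|e|^2 - c^2/4)^2 -
    (c^2/4)^2. The slope of the gap along e is proportional to a |e|^2 - be u.e, hence to at least a
    c^2/4, a margin that survives replacing e by a nearby vector. *)
Lemma cone_dot : 0 <= a -> be * dot u u <= a ^+ 2 ->
  be * dot u e <= a * (dot e e - c ^+ 2 / 4).
Proof.
move=> a0 h; have b0 := cone_beta_gt0; have c2 : 0 < c ^+ 2 by rewrite exprn_gt0.
have r0 : 0 <= a * (dot e e - c ^+ 2 / 4) by rewrite mulr_ge0//; move: b0; rewrite /be; lra.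
have [n|p] := ltP (be * dot u e) 0; first by lra.
rewrite -(ler_pXn2r (n := 2)) ?nnegrE// !exprMn.
have cs : dot u e ^+ 2 <= dot u u * dot e e.
  rewrite -!enorm_sqr -exprMn -[leLHS]real_normK ?num_real//.
  by rewrite lerXn2r ?nnegrE ?mulr_ge0 ?enorm_ge0// cauchy_schwarz.
have ee : 0 <= dot e e by exact: dot_ge0.
apply: (@le_trans _ _ (a ^+ 2 * (be * dot e e))).
  apply: (@le_trans _ _ (be ^+ 2 * (dot u u * dot e e))); first by rewrite ler_wpM2l// sqr_ge0.
  have -> : be ^+ 2 * (dot u u * dot e e) = (be * dot u u) * (be * dot e e) by ring.
  by rewrite ler_wpM2r// mulr_ge0// ltW.
rewrite ler_wpM2l ?sqr_ge0// /be.
have -> : (dot e e - c ^+ 2 / 4) ^+ 2 = (dot e e - c ^+ 2 / 2) * dot e e + (c ^+ 2 / 4) ^+ 2 by field.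
by rewrite lerDl sqr_ge0.
Qed.

Lemma cone_norm : 0 <= a -> be * dot u u <= a ^+ 2 -> be * enorm u <= H * a.
Proof.
move=> a0 h; have b0 := cone_beta_gt0.
rewrite -(ler_pXn2r (n := 2)) ?nnegrE ?mulr_ge0 ?enorm_ge0 ?(ltW b0) ?(ltW H0)//.
rewrite !exprMn enorm_sqr expr2 -mulrA.
apply: (@le_trans _ _ (be * a ^+ 2)); first by rewrite ler_pM2l.
by rewrite ler_wpM2r ?sqr_ge0// cone_beta_le.
Qed.

(* The first hypothesis says that [u] is outside the cone around [e], which holds
   for points outside S.  The slightly narrower cone shifted back by [T] therefore
   meets the complement of S only near its vertex. *)
Lemma cone_support (M := 16 * H * T / c ^+ 2 + 4 * T / c) :
  (0 < dot u e -> dot u e ^+ 2 <= (dot e e - 3 / 4 * c ^+ 2) * dot u u) ->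
  0 < dot u e + T -> be * dot u u <= (dot u e + T) ^+ 2 -> enorm u <= M.
Proof.
move=> out a0 h; rewrite leNgt; apply/negP => Mu.
have c2 : 0 < c ^+ 2 by rewrite exprn_gt0.
have u0 := enorm_ge0 u.
have h1 : c ^+ 2 / 4 * enorm u ^+ 2 <= 2 * H * T * enorm u + T ^+ 2.
  have [p0|p0] := ltP 0 (dot u e).
    have := out p0 => h2.
    have h3 : dot u e <= H * enorm u.
      by rewrite (le_trans (dot_le_enorm _ _))// mulrC ler_wpM2r.
    have h4 : dot u e * T <= H * enorm u * T by rewrite ler_pM2r.
    move: h; rewrite /be enorm_sqr sqrrD; lra.
  have : (dot u e + T) ^+ 2 <= T ^+ 2 by rewrite lerXn2r ?nnegrE ?(ltW a0) ?(ltW T0)//; lra.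
  move=> h2; have h3 : c ^+ 2 / 4 * dot u u <= be * dot u u.
    rewrite ler_wpM2r ?dot_ge0//.
    have : c ^+ 2 <= dot e e by rewrite -enorm_sqr lerXn2r ?nnegrE ?enorm_ge0// ltW.
    rewrite /be; lra.
  rewrite enorm_sqr; have : 0 <= 2 * H * T * enorm u by rewrite !mulr_ge0 // ltW.
  lra.
(* The first term of [M] puts 2 H T |u| below c^2/8 |u|^2, the second puts T^2 below c^2/16 |u|^2;
   together they stay below c^2/4 |u|^2, against [h1]. *)
have i1 : 16 * H * T / c ^+ 2 < enorm u.
  by rewrite (le_lt_trans _ Mu)// /M lerDl divr_ge0 ?mulr_ge0 ?ltW.
have i2 : 4 * T / c < enorm u.
  by rewrite (le_lt_trans _ Mu)// /M lerDr divr_ge0 ?mulr_ge0 ?ltW.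
move: i1 i2; rewrite !ltr_pdivrMr// => i1 i2.
have u1 : 0 < enorm u by rewrite (le_lt_trans _ Mu)// addr_ge0// divr_ge0 ?mulr_ge0 ?ltW.
have j1 : 16 * H * T * enorm u < enorm u * c ^+ 2 * enorm u by rewrite ltr_pM2r.
have j2 : (4 * T) ^+ 2 < (enorm u * c) ^+ 2.
  by rewrite ltrXn2r// ?nnegrE ?mulr_ge0 ?ltW.
move: h1 j1 j2; rewrite !exprMn !expr2 => h1 j1 j2.
have : 0 < T * T by rewrite mulr_gt0.
lra.
Qed.

End Algebra.
End Cone.

Lemma is_derive_quad (R : realType) (V : normedModType R) (f : V -> R) x v (A B : R) :
  (forall h, f (h *: v + x) = f x + h * A + h ^+ 2 * B) -> is_derive x v f A.
Proof.
move=> fE.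
have c0 : h^-1 *: ((f \o shift x) (h *: v) - f x) @[h --> (0 : R)^'] --> A.
  apply/cvgrPdist_le => e e0; near=> h.
  have h0 : h != 0 by near: h; exact: nbhs_dnbhs_neq.
  rewrite /= fE -[h^-1 *: _]/(h^-1 * _).
  rewrite (_ : A - _ = - (h * B)); last by field.
  rewrite normrN normrM.
  have hh : `|h| <= e / (`|B| + 1).
    by near: h; apply: dnbhs0_le; rewrite divr_gt0// ltr_wpDl.
  move: hh; rewrite ler_pdivlMr ?ltr_wpDl// => hh.
  by rewrite (le_trans _ hh)// ler_wpM2l// lerDl.
by split; [apply/cvg_ex; exists A|exact: cvg_lim].
Unshelve. all: by end_near. Qed.

Lemma pow2_gt (R : realType) (X : R) : exists k, X < 2 ^+ k.
Proof.
exists (Num.bound `|X|); rewrite (le_lt_trans (ler_norm X))//.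
rewrite (lt_le_trans (archi_boundP (normr_ge0 X)))//.
by rewrite -natrX ler_nat ltnW// ltn_expl.
Qed.

(** With this s the hypothesis reads |w|^2 < s^2 M, so |w - s e|^2 < s^2 (|e|^2 - M) = 3/4 c^2 s^2.
    It converts a cone given by an inequality into the union of balls that [tv_cone] speaks of. *)
Lemma cone_nearest (R : realType) (d : nat) (c : R) (w e : 'rV[R]_d)
  (M := dot e e - 3 / 4 * c ^+ 2) (s := dot w e / M) :
  0 < c -> 0 < M -> 0 < s -> M * dot w w < dot w e ^+ 2 ->
  enorm (w - s *: e) <= c * s.
Proof.
move=> c0 M0 s0 h; have cs0 : 0 <= c * s by apply: mulr_ge0; exact: ltW.
rewrite -(ler_pXn2r (n := 2)) ?nnegrE ?cs0 ?enorm_ge0//.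
rewrite enorm_sqr !dotE (dotC e w) exprMn.
have -> : dot w w = dot w w * M / M by rewrite mulfK ?gt_eqF.
have h1 : M * dot w w / M <= dot w e ^+ 2 / M by rewrite ler_pdivrMr// divfK ?gt_eqF// ltW.
rewrite (mulrC (dot w w)).
have h2 : dot w e ^+ 2 / M = s ^+ 2 * M by rewrite /s; field; rewrite gt_eqF.
have h3 : s * dot w e = s ^+ 2 * M by rewrite /s; field; rewrite gt_eqF.
have h4 : dot w e * s = s ^+ 2 * M by rewrite mulrC.
have h5 : s ^+ 2 * (dot e e - c ^+ 2) <= s ^+ 2 * M.
  rewrite ler_wpM2l ?sqr_ge0// /M; have : 0 < c ^+ 2 by rewrite exprn_gt0.
  lra.
move: h1; rewrite h2 => h1; move: h1 h3 h4 h5.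
move: (M * dot w w / M) => X; clear; clearbody s; clearbody M; lra.
Qed.

Section Transversal.
Context (R : realType) (d : nat).
Local Notation V := 'rV[R]_d.

(** A uniform interior cone condition with smoothly varying axis: the cone at z is the union of the
    balls of radius c s around z + s eta z. It is asked only at points z within r of the complement,
    of which x is the witness; there the axis also stays away from 0. *)
Record transversal_field (S : set V) (eta : V -> V) (c r H L : R) : Prop := Transversal {
  tv_c : 0 < c; tv_r : 0 < r; tv_H : 0 < H; tv_L : 0 < L;
  tv_bound : forall x, enorm (eta x) <= H;
  tv_lip : forall x y, enorm (eta x - eta y) <= L * enorm (x - y);
  tv_low : forall z x, S z -> ~ S x -> enorm (z - x) < r -> c <= enorm (eta z);
  tv_cone : forall z x s y, S z -> ~ S x -> enorm (z - x) < r -> 0 <= s -> s < r ->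
    enorm (y - z - s *: eta z) <= c * s -> S y;
  tv_smooth : forall n, cls (fun _ : 'I_d => [set: V]) (fun _ _ => 1) n
    (fun _ _ => 1) (fun j x => eta x ord0 j) }.

Section RegularizedDistance.
Context (S : set V) (eta : V -> V) (c r H L B0 : R).
Hypothesis tv : transversal_field S eta c r H L.
Hypothesis Sc : closed S.
Hypothesis S0 : S !=set0.
Hypothesis SB : forall z, S z -> enorm z <= B0.

Let c0 : 0 < c := tv_c tv.
Let r0 : 0 < r := tv_r tv.
Let H0 : 0 < H := tv_H tv.
Let L0 : 0 < L := tv_L tv.
Let c20 : 0 < c ^+ 2. Proof. by rewrite exprn_gt0. Qed.

(** Lengths in units of 2^-k. A step [D] along eta from a point of S frees a ball of radius d inside
    S, enough to round to the grid. [M1] bounds the distance from x to that grid point: 4 for a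
    nearly closest point of S, [D * H] for the step, d for the rounding. [T] makes height and gap at
    least 1 within [M1], and [M2] is the support radius given by [cone_support]. *)
Let D := d%:R / c.
Let M1 := 4 + D * H + d%:R.
Let T := 2 * M1 * H + 1.
Let M2 := 16 * H * T / c ^+ 2 + 4 * T / c.

Let D0 : 0 <= D. Proof. by rewrite divr_ge0// ltW. Qed.
Let M10 : 4 <= M1.
Proof. by rewrite /M1 -addrA lerDl addr_ge0// mulr_ge0 ?D0 ?ltW. Qed.
Let T0 : 0 < T.
Proof.
rewrite /T; have : 0 <= M1 * H by rewrite mulr_ge0 ?(ltW H0)//; have := M10; lra.
lra.
Qed.
Let M20 : 0 < M2.
Proof. by rewrite addr_gt0// divr_gt0 ?mulr_gt0. Qed.

Variable k0 : nat.
(** The coarsest scale is small: [k2] keeps the cone parameter of [out_of_cone] below r, [k3] keeps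
    the points chosen near x within r of it, [k4] keeps the step towards the grid below r, and [k5]
    makes the oscillation of eta on a support small against c^2. *)
Hypothesis k2 : 8 * M2 * H < r * c ^+ 2 * 2 ^+ k0.
Hypothesis k3 : M1 < r * 2 ^+ k0.
Hypothesis k4 : D < r * 2 ^+ k0.
Hypothesis k5 : 32 * H * L * M2 < c ^+ 2 * 2 ^+ k0.

Definition valid_center (p : nat * V) : Prop :=
  [/\ (k0 <= p.1)%N, S p.2 & exists2 x, ~ S x & enorm (p.2 - x) < r].

Local Notation m p := ((2 : R) ^+ p.1).
Definition scaled (p : nat * V) x : V := m p *: (x - p.2).
(** Written as an affine function of x to suit [cls_affine]; the geometric form is
    [cone_heightE]. *)
Definition cone_height (p : nat * V) x : R :=
  dot x (m p *: eta p.2) + (T - dot p.2 (m p *: eta p.2)).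
Definition cone_gap (p : nat * V) x : R :=
  cone_height p x ^+ 2 -
  (dot (eta p.2) (eta p.2) - c ^+ 2 / 2) * dot (scaled p x) (scaled p x).
(* With vertex shifted from the grid point by O(2 ^- k) against eta, this bump is
   nondecreasing along eta and, outside S, is supported at distance O(2 ^- k) of
   the grid point. *)
Definition cone_bump p x : R := bumpf 0 (cone_height p x) * bumpf 0 (cone_gap p x).

Let m0 (p : nat * V) : 0 < m p. Proof. by rewrite exprn_gt0. Qed.
Let mk0 p : valid_center p -> 2 ^+ k0 <= m p.
Proof. by case=> kp _ _; rewrite ler_weXn2l// ler1n. Qed.

Lemma cone_heightE p x : cone_height p x = dot (scaled p x) (eta p.2) + T.
Proof. by rewrite /cone_height /scaled !dotE; ring. Qed.

Lemma enorm_scaled p x : enorm (scaled p x) = m p * enorm (x - p.2).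
Proof. by rewrite enormZ gtr0_norm. Qed.

Lemma valid_low p : valid_center p -> c <= enorm (eta p.2).
Proof. by case=> _ Sp [x Sx px]; exact: tv_low tv _ _ Sp Sx px. Qed.

Lemma scaled_dist p x X : enorm (scaled p x) < X -> enorm (x - p.2) < X / m p.
Proof. by rewrite enorm_scaled ltr_pdivlMr// mulrC. Qed.

(** Otherwise [cone_nearest] places x in a ball of the cone at the centre, and [tv_cone] puts x in
    S. The bound on [scaled p x] keeps the cone parameter below r. *)
Lemma out_of_cone p x : valid_center p -> ~ S x -> enorm (scaled p x) < 2 * M2 ->
  0 < dot (scaled p x) (eta p.2) ->
  dot (scaled p x) (eta p.2) ^+ 2 <=
  (dot (eta p.2) (eta p.2) - 3 / 4 * c ^+ 2) * dot (scaled p x) (scaled p x).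
Proof.
move=> vp Sx; have [_ Sz _] := vp; rewrite enorm_scaled => ux.
rewrite /scaled; set w := x - p.2; set e := eta p.2; rewrite !(dotZl, dotZr).
rewrite pmulr_rgt0// => p0; rewrite exprMn.
rewrite [leRHS](_ : _ = m p ^+ 2 * ((dot e e - 3 / 4 * c ^+ 2) * dot w w)); last by ring.
rewrite ler_pM2l ?exprn_gt0//.
have mk := mk0 vp; have c2 : 0 < c ^+ 2 := c20.
have ee : c ^+ 2 <= dot e e.
  have := valid_low vp; rewrite -/e => ce.
  by rewrite -enorm_sqr lerXn2r ?nnegrE ?enorm_ge0 ?(ltW c0).
pose M := dot e e - 3 / 4 * c ^+ 2; rewrite -/M.
have Mc : c ^+ 2 / 4 <= M by rewrite /M; lra.
have M0 : 0 < M by move: (M) Mc => ? ?; lra.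
rewrite leNgt; apply/negP => h.
have sr : dot w e / M < r.
  rewrite ltr_pdivrMr//.
  apply: (@lt_le_trans _ _ (r * (c ^+ 2 / 4))); last by rewrite ler_pM2l.
  apply: (@le_lt_trans _ _ (enorm w * H)).
    by rewrite (le_trans (dot_le_enorm _ _))// ler_wpM2l ?enorm_ge0// (tv_bound tv).
  have h1 : m p * enorm w * H < 2 * M2 * H by rewrite (ltr_pM2r H0).
  have h2 : r * c ^+ 2 * 2 ^+ k0 <= r * c ^+ 2 * m p.
    by rewrite ler_wpM2l// mulr_ge0// ltW.
  rewrite -(ltr_pM2l (m0 p)); move: k2 h1 h2.
  move: (2 ^+ k0) (m p) M2 (enorm w) => A A' M' w'; lra.
have [_ _ [x' Sx' zx']] := vp.
apply: Sx; have s0 : 0 < dot w e / M by rewrite divr_gt0.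
apply: (tv_cone tv Sz Sx' zx' (ltW s0) sr); rewrite -/w -/e.
exact: cone_nearest.
Qed.

Lemma cone_bump_neq0 p x : cone_bump p x != 0 -> 0 < cone_height p x /\ 0 < cone_gap p x.
Proof.
rewrite /cone_bump => h; split; rewrite ltNge; apply: contra h => h.
  by rewrite (bumpf_npos 0 h) mul0r.
by rewrite (bumpf_npos 0 h) mulr0.
Qed.

Lemma cone_bump_support p x : valid_center p -> ~ S x ->
  enorm (scaled p x) < 2 * M2 -> cone_bump p x != 0 -> enorm (scaled p x) <= M2.
Proof.
move=> vp Sx ux /cone_bump_neq0[]; rewrite /cone_gap cone_heightE => a0 q0.
apply: (cone_support c0 H0 (valid_low vp) (tv_bound tv _) T0 _ a0).
  exact: out_of_cone.
by rewrite ltW// -subr_gt0.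
Qed.

Let near_dom p : set V := [set x | valid_center p /\ enorm (scaled p x) < 2 * M2].

Let enorm_scaled_lip p x y : enorm (scaled p y) <= enorm (scaled p x) + m p * enorm (y - x).
Proof.
rewrite !enorm_scaled -mulrDr ler_wpM2l ?(ltW (m0 p))// [leRHS]addrC.
exact: enorm_distD.
Qed.

Let near_dom_open p : open (near_dom p).
Proof.
apply/enorm_openP => x [vp ux]; exists ((2 * M2 - enorm (scaled p x)) / m p).
  by rewrite divr_gt0// subr_gt0.
move=> y; rewrite ltr_pdivlMr// => h; split=> //.
by rewrite (le_lt_trans (enorm_scaled_lip p x y))//; rewrite mulrC; lra.
Qed.

Let m_ge0 p (x : V) : near_dom p x -> 0 <= m p.
Proof. by move=> _; exact: ltW. Qed.

Lemma cls_cone_height n :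
  cls near_dom (fun p _ => m p) n (fun _ _ => 1) cone_height.
Proof.
apply: cls_affine => //.
  exists (2 * M2 * H + T) => [|p x [vp ux]].
    by rewrite addr_ge0 ?mulr_ge0 ?ltW.
  rewrite -/(cone_height p x) cone_heightE mulr1 (le_trans (ler_normD _ _))//.
  rewrite (gtr0_norm T0) lerD2r (le_trans (cauchy_schwarz _ _))//.
  by rewrite ler_pM ?enorm_ge0 ?(ltW ux)// (tv_bound tv).
exists H => [|p x _]; first exact: ltW.
by rewrite enormZ gtr0_norm// mul1r mulrC ler_pM2r// (tv_bound tv).
Qed.

Lemma cls_cone_gap n :
  cls near_dom (fun p _ => m p) n (fun _ _ => 1) cone_gap.
Proof.
have M22 : 0 <= 2 * M2 by rewrite mulr_ge0// ltW.
have uE (p : nat * V) x j : dot x (m p *: delta_mx 0 j) + (- (m p * p.2 ord0 j)) = scaled p x ord0 j.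
  by rewrite dotZr dot_delta /scaled !mxE mulrBr.
have cu j : cls near_dom (fun p _ => m p) n (fun _ _ => 1)
    (fun p x => dot x (m p *: delta_mx 0 j) + (- (m p * p.2 ord0 j))).
  apply: cls_affine => //.
    exists (2 * M2) => // p x [vp ux].
    rewrite uE mulr1.
    by rewrite (le_trans (coord_le_enorm _ _))// ltW.
  exists 1 => // p x _; rewrite enormZ enorm_delta mulr1 gtr0_norm//.
  by rewrite !mul1r.
have cM f1 f2 : cls near_dom (fun p _ => m p) n (fun _ _ => 1) f1 ->
    cls near_dom (fun p _ => m p) n (fun _ _ => 1) f2 ->
    cls near_dom (fun p _ => m p) n (fun _ _ => 1) (fun p x => f1 p x * f2 p x).
  move=> c1 c2; apply: (cls_amp m_ge0) (cls_M near_dom_open m_ge0 c1 c2).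
  by exists 1 => // p x _; rewrite !mul1r.
pose be (p : nat * V) := dot (eta p.2) (eta p.2) - c ^+ 2 / 2.
have cb : cls near_dom (fun p _ => m p) n (fun _ _ => 1) (fun p _ => be p).
  apply: cls_cst => //; exists (H ^+ 2); first exact: sqr_ge0.
  move=> p x [vp _]; have ce := valid_low vp; have eH := tv_bound tv p.2.
  by rewrite mulr1 gtr0_norm ?(cone_beta_le c0 H0)// cone_beta_gt0.
have cs : cls near_dom (fun p _ => m p) n (fun _ _ => 1) (fun p x =>
   \sum_(j <- index_enum 'I_d) (dot x (m p *: delta_mx 0 j) + (- (m p * p.2 ord0 j))) *
     (dot x (m p *: delta_mx 0 j) + (- (m p * p.2 ord0 j)))).
  by apply: cls_bigsum => // j; exact: cM.
have := cls_B near_dom_open m_ge0 (cM _ _ (cls_cone_height n) (cls_cone_height n))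
  (cM _ _ cb cs).
apply: cls_ext => // p x _; rewrite /cone_gap expr2; congr (_ - _ * _).
by apply: eq_bigr => j _; rewrite uE.
Qed.

Lemma cls_cone_bump n :
  cls near_dom (fun p _ => m p) n (fun _ _ => 1) cone_bump.
Proof.
have ca := cls_comp near_dom_open m_ge0 (@is_derive_bumpf R) (cls_cone_height n) 0.
have cg := cls_comp near_dom_open m_ge0 (@is_derive_bumpf R) (cls_cone_gap n) 0.
apply: (cls_amp m_ge0) (cls_M near_dom_open m_ge0 ca cg).
by exists 1 => // p x _; rewrite !mul1r.
Qed.

(** The infinite cone may leave S again far from its vertex, so values beyond 2 M2 are discarded.
    Outside S this makes no jump, since the bump already vanishes between M2 and 2 M2. *)
Definition cut_bump (p : nat * V) x : R :=
  if `[< valid_center p /\ enorm (scaled p x) < 2 * M2 >] then cone_bump p x else 0.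

(** The gauge of [cut_bump]. It remembers the support, so that [cls_sum] counts only the centres
    near x. *)
Definition active (p : nat * V) x : R :=
  if `[< valid_center p /\ enorm (scaled p x) < 2 * M2 >] then 1 else 0.

Lemma cut_bump_near p x : ~ S x ->
  (near_dom p x /\ \forall y \near x, cone_bump p y = cut_bump p y) \/
  (~ near_dom p x /\ \forall y \near x, 0 = cut_bump p y).
Proof.
move=> Sx; have [px|px] := pselect (near_dom p x); [left|right]; split => //.
  have := open_nbhs_nbhs (conj (@near_dom_open p) px).
  by apply: filterS => y py; rewrite /cut_bump asboolT.
have [vp|vp] := pselect (valid_center p); last first.
  by apply: nearW_rV => y; rewrite /cut_bump asboolF// => -[].
have ux : 2 * M2 <= enorm (scaled p x).
  by rewrite leNgt; apply/negP => h; apply: px; split.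
have [e e0 he] := closed_outP Sc Sx.
apply/enorm_nbhsP; exists (Num.min e (M2 / m p)).
  by rewrite lt_min e0 divr_gt0.
move=> y; rewrite lt_min => /andP[ye1]; rewrite ltr_pdivlMr// mulrC => ye.
have Sy : ~ S y by move=> /he; rewrite leNgt ye1.
rewrite /cut_bump; case: asboolP => // -[_ uy].
apply/esym/eqP/negPn/negP => /(cone_bump_support vp Sy uy).
apply/negP; rewrite -ltNge; have := enorm_scaled_lip p y x.
rewrite enormB; move: ux ye; lra.
Qed.

Lemma cls_cut_bump n :
  cls (fun _ => ~` S) (fun p _ => m p) n active cut_bump.
Proof.
pose Z (p : nat * V) : set V := [set: V].
have cz : cls Z (fun p _ => m p) n (fun _ _ => 0) (fun _ _ => 0).
  apply: (@cls_cst R d _ Z (fun p _ => m p) _ _ n _ (fun=> 0)).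
  - by move=> p; exact: openT.
  - by move=> p x _; exact: ltW.
  - by exists 1 => // p x _; rewrite normr0 mulr0.
have p1 p (x : V) : near_dom p x -> 0 <= m p /\ (0 : R) <= 1.
  by move=> _; split => //; exact: ltW.
have p2 p (x : V) : Z p x -> 0 <= m p /\ (0 : R) <= 0.
  by move=> _; split => //; exact: ltW.
apply: cls_local (cls_join p1 p2 (cls_cone_bump n) cz) => p x Sx.
have [[px ex]|[px ex]] := cut_bump_near p Sx; [exists (inl p)|exists (inr p)]; split => //=.
  by rewrite /active asboolT.
by rewrite /active asboolF.
Qed.

Let be (p : nat * V) : R := dot (eta p.2) (eta p.2) - c ^+ 2 / 2.

Lemma cone_bump_derive p x v : near_dom p x ->
  'D_v (cone_bump p) x =
    bumpf 1 (cone_height p x) * (m p * dot v (eta p.2)) * bumpf 0 (cone_gap p x) +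
    bumpf 0 (cone_height p x) * (bumpf 1 (cone_gap p x) *
      (2 * m p * (cone_height p x * dot v (eta p.2) - be p * dot (scaled p x) v))).
Proof.
move=> px.
have da := cls_diff (cls_cone_height 1) px.
have dg := cls_diff (cls_cone_gap 1) px.
have hE h : cone_height p (h *: v + x) = cone_height p x + h * (m p * dot v (eta p.2)).
  by rewrite /cone_height dotDl dotZl dotZr; ring.
have uE h : scaled p (h *: v + x) = scaled p x + (m p * h) *: v.
  by rewrite /scaled -[_ + x - _]addrA [LHS]scalerDr scalerA [RHS]addrC.
have Da : 'D_v (cone_height p) x = m p * dot v (eta p.2).
  apply: (@derive_val _ _ _ _ _ _ _ (@is_derive_quad _ _ _ _ _ _ 0 _)) => h.
  by rewrite hE mulr0 addr0.
have Dg : 'D_v (cone_gap p) x =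
    2 * m p * (cone_height p x * dot v (eta p.2) - be p * dot (scaled p x) v).
  apply: (@derive_val _ _ _ _ _ _ _ (@is_derive_quad _ _ _ _ _ _
    ((m p * dot v (eta p.2)) ^+ 2 - be p * m p ^+ 2 * dot v v) _)) => h.
  rewrite /cone_gap -/(be p) hE uE; move: (scaled p x) (cone_height p x) => u a.
  by rewrite !dotE (dotC v u); ring.
have [d1 e1] := derive_comp_scalar v da (is_derive_bumpf 0 (cone_height p x)).
have [d2 e2] := derive_comp_scalar v dg (is_derive_bumpf 0 (cone_gap p x)).
rewrite -[LHS]/('D_v ((bumpf 0 \o cone_height p) * (bumpf 0 \o cone_gap p)) x).
rewrite deriveM; [|exact: diff_derivable|exact: diff_derivable].
rewrite e1 e2 Da Dg -![_ *: _]/(_ * _) /= addrC; congr (_ + _).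
by rewrite mulrC.
Qed.

Let lip_small p x : near_dom p x -> H * (L * enorm (x - p.2)) <= c ^+ 2 / 16.
Proof.
move=> [vp ux]; have mk := mk0 vp.
have wx := ltW (scaled_dist ux).
apply: (@le_trans _ _ (H * (L * (2 * M2 / m p)))).
  by rewrite !ler_pM2l.
rewrite !mulrA ler_pdivrMr//.
have h2 : c ^+ 2 * 2 ^+ k0 <= c ^+ 2 * m p by rewrite ler_pM2l.
move: k5 h2; move: (2 ^+ k0) (m p) M2 => A A' M'; lra.
Qed.

Let dot_eta p x : near_dom p x -> c ^+ 2 / 2 <= dot (eta x) (eta p.2).
Proof.
move=> px; have ls := lip_small px.
have -> : eta x = (eta x - eta p.2) + eta p.2 by rewrite subrK.
rewrite dotDl -enorm_sqr.
have h1 : - (H * (L * enorm (x - p.2))) <= dot (eta x - eta p.2) (eta p.2).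
  rewrite lerNl -dotNl (le_trans (dot_le_enorm _ _))// enormN mulrC.
  by rewrite ler_pM ?enorm_ge0// ?(tv_bound tv)// (tv_lip tv).
have h2 : c ^+ 2 <= enorm (eta p.2) ^+ 2.
  by rewrite lerXn2r ?nnegrE ?enorm_ge0 ?(ltW c0)// valid_low//; case: px.
have c2 : 0 < c ^+ 2 := c20; lra.
Qed.

(** The gain a c^2/4 along [eta p.2] from [cone_dot] pays for the two errors of passing to [eta x],
    each at most a c^2/16 by [lip_small]. *)
Let cone_angle p x : near_dom p x -> 0 < cone_height p x -> 0 < cone_gap p x ->
  0 <= cone_height p x * dot (eta x) (eta p.2) - be p * dot (scaled p x) (eta x).
Proof.
move=> px a0 q0; have ls := lip_small px; have [vp _] := px.
have c2 : 0 < c ^+ 2 := c20.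
set a := cone_height p x in a0 *; set u := scaled p x.
have q1 : be p * dot u u <= a ^+ 2 by move: q0; rewrite /cone_gap subr_gt0 => /ltW.
have lo := valid_low vp; have hi := tv_bound tv p.2.
have h1 := cone_dot c0 lo (ltW a0) q1.
have h2 := cone_norm c0 H0 lo hi (ltW a0) q1.
have b0 : 0 < be p := cone_beta_gt0 c0 lo.
have h3 : be p * dot u (eta x - eta p.2) <= a * (c ^+ 2 / 16).
  apply: (@le_trans _ _ (be p * enorm u * (L * enorm (x - p.2)))).
    rewrite -mulrA ler_pM2l// (le_trans (dot_le_enorm _ _))//.
    by rewrite ler_wpM2l ?enorm_ge0// (tv_lip tv).
  apply: (@le_trans _ _ (H * a * (L * enorm (x - p.2)))).
    by rewrite ler_wpM2r// mulr_ge0 ?enorm_ge0// ltW.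
  by rewrite mulrAC mulrC ler_pM2l.
have h4 : - (a * (c ^+ 2 / 16)) <= a * dot (eta x - eta p.2) (eta p.2).
  rewrite lerNl -mulrN ler_pM2l// -dotNl (le_trans _ ls)//.
  rewrite (le_trans (dot_le_enorm _ _))// enormN mulrC.
  by rewrite ler_pM ?enorm_ge0// (tv_lip tv).
have h5 : 0 < a * c ^+ 2 by rewrite mulr_gt0.
move: h1 h3 h4 h5; rewrite dotBl dotBr -/(be p).
move: (be p) (dot u (eta x)) (dot u (eta p.2)) (dot (eta p.2) _) => b' s1 s2 s3.
move: (dot (eta x) _) (c ^+ 2) (a) => s4 c' a'; lra.
Qed.

Lemma cone_bump_derive_ge0 p x : near_dom p x -> 0 <= 'D_(eta x) (cone_bump p) x.
Proof.
move=> px; rewrite cone_bump_derive//.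
have ev := dot_eta px; have ls := lip_small px; have [vp _] := px.
have c2 : 0 < c ^+ 2 := c20.
have [a0|a0] := leP (cone_height p x) 0.
  by rewrite !(bumpf_npos _ a0) !mul0r addr0.
have [q0|q0] := leP (cone_gap p x) 0.
  by rewrite !(bumpf_npos _ q0) !mul0r !mulr0 addr0.
have ve0 : 0 <= dot (eta x) (eta p.2) by lra.
apply: addr_ge0.
  by rewrite !mulr_ge0 ?bumpf0_ge0 ?bumpf1_ge0 ?(ltW (m0 p)).
apply: mulr_ge0; first exact: bumpf0_ge0.
apply: mulr_ge0; first exact: bumpf1_ge0.
apply: mulr_ge0; first by rewrite mulr_ge0 ?(ltW (m0 p)).
exact: cone_angle.
Qed.

Let low1 : R := expR (- 1).
Let kap : R := (M1 * H + T) ^- 2 * low1 * low1 * (c ^+ 2 / 2).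

(** By the choice of [T] the height is at least M1 H + 1 and the gap at least (M1 H + 1)^2 - (M1
    H)^2 >= 1, where the profile is at least exp(-1). In the derivative only the height term is
    kept; the gap term is nonnegative by [cone_angle]. *)
Lemma cone_bump_good p x : near_dom p x -> enorm (scaled p x) <= M1 ->
  low1 * low1 <= cone_bump p x /\ kap * m p <= 'D_(eta x) (cone_bump p) x.
Proof.
move=> px u1; have [vp _] := px.
have c2 : 0 < c ^+ 2 := c20.
set a := cone_height p x; set q := cone_gap p x.
have lo := valid_low vp; have hi := tv_bound tv p.2.
have M1p : 0 <= M1 by have := M10; lra.
have ue : `|dot (scaled p x) (eta p.2)| <= M1 * H.
  by rewrite (le_trans (cauchy_schwarz _ _))// ler_pM ?enorm_ge0.
have a1 : M1 * H + 1 <= a.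
  rewrite /a cone_heightE /T; have := lerNnormlW ue; lra.
have a2 : a <= M1 * H + T.
  by rewrite /a cone_heightE lerD2r (le_trans (ler_norm _)).
have MH : 0 <= M1 * H by rewrite mulr_ge0// ltW.
have a10 : 1 <= a by lra.
have a0 : 0 < a by lra.
have q1 : 1 <= q.
  rewrite /q /cone_gap -/a.
  have : (M1 * H + 1) ^+ 2 <= a ^+ 2 by rewrite lerXn2r ?nnegrE//; lra.
  have : be p * dot (scaled p x) (scaled p x) <= (M1 * H) ^+ 2.
    rewrite exprMn mulrC -enorm_sqr ler_pM ?sqr_ge0//.
    - by rewrite ltW// /be cone_beta_gt0.
    - by rewrite lerXn2r ?nnegrE ?enorm_ge0.
    - by rewrite /be cone_beta_le.
  rewrite sqrrD -/(be p); lra.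
have q0 : 0 < q by lra.
have one0 : bumpf 0 1 = low1 by rewrite bumpf0E// invr1.
have ba : low1 <= bumpf 0 a by rewrite -one0 bumpf0_le.
have bq : low1 <= bumpf 0 q by rewrite -one0 bumpf0_le.
have l0 : 0 <= low1 by exact: expR_ge0.
split; first by rewrite /cone_bump ler_pM.
rewrite cone_bump_derive// -/a -/q.
apply: (@le_trans _ _ (bumpf 1 a * (m p * dot (eta x) (eta p.2)) * bumpf 0 q)).
  have -> : kap * m p = ((M1 * H + T) ^- 2 * low1) * (m p * (c ^+ 2 / 2)) * low1.
    by rewrite /kap; ring.
  have c20' : 0 <= c ^+ 2 / 2 by lra.
  have MT : 0 < M1 * H + T by have : 0 < T := T0; lra.
  have MT2 : 0 <= (M1 * H + T) ^- 2 by rewrite invr_ge0 exprn_ge0 ?(ltW MT).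
  have i1 : (M1 * H + T) ^- 2 * low1 <= bumpf 1 a.
    rewrite bumpf1E// -bumpf0E//; apply: ler_pM => //.
    by rewrite lef_pV2 ?posrE ?exprn_gt0// lerXn2r ?nnegrE ?(ltW MT) ?(ltW a0).
  have i2 : m p * (c ^+ 2 / 2) <= m p * dot (eta x) (eta p.2).
    by rewrite ler_pM2l// dot_eta.
  apply: ler_pM bq => //; last by apply: ler_pM => //; rewrite mulr_ge0 ?(ltW (m0 p)).
  by apply: mulr_ge0; apply: mulr_ge0 => //; exact: ltW.
rewrite lerDl; apply: mulr_ge0; first exact: bumpf0_ge0.
apply: mulr_ge0; first exact: bumpf1_ge0.
apply: mulr_ge0; first by rewrite mulr_ge0 ?(ltW (m0 p)).
exact: cone_angle.
Qed.

Lemma cut_bump_ge0 p x : 0 <= cut_bump p x.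
Proof.
by rewrite /cut_bump; case: ifP => // _; rewrite mulr_ge0 ?bumpf0_ge0.
Qed.

Lemma cut_bump_derive_ge0 p x : ~ S x -> 0 <= 'D_(eta x) (cut_bump p) x.
Proof.
move=> Sx; have [[px ex]|[px ex]] := cut_bump_near p Sx.
  by rewrite -(near_eq_derive _ ex) cone_bump_derive_ge0.
by rewrite -(near_eq_derive _ ex) derive_cst.
Qed.

Local Notation delta := (dist_to S).

Let delta_gt0 x : ~ S x -> 0 < delta x.
Proof. exact: dist_to_gt0. Qed.

(** The centre lies in S, at distance at least delta x from x. Only scales with 2^k below a multiple
    of 1/delta are active, which makes the sum over scales geometric. *)
Lemma active_bound p x : ~ S x -> active p x != 0 -> m p < 2 * M2 * (delta x)^-1.
Proof.
rewrite /active => Sx; case: asboolP => [[[_ Sp _] ux] _|]; last by rewrite eqxx.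
rewrite ltr_pdivlMr ?delta_gt0//; apply: le_lt_trans ux.
by rewrite enorm_scaled ler_pM2l// dist_to_le.
Qed.

Lemma cut_bump_active p x : active p x = 0 -> cut_bump p x = 0.
Proof. by rewrite /active /cut_bump; case: ifP => // _ /eqP; rewrite oner_eq0. Qed.

Lemma active_ge0 p x : 0 <= active p x.
Proof. by rewrite /active; case: ifP. Qed.

Variable B : nat.
Hypothesis BB : B0 + r * H <= B%:R.

(** Points per axis of the grid of mesh 2^-k in the cube [-B, B]^d, both ends included. By [BB] the
    cube contains S and its points displaced by less than r along eta. *)
Let gridN k := (2 * B * 2 ^ k).+1.
Let grid_point k (j : {ffun 'I_d -> 'I_(gridN k)}) : V :=
  (2 ^+ k)^-1 *: \row_i ((j i)%:R - B%:R * 2 ^+ k).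
Let grid k : seq V := [seq grid_point j | j <- index_enum {ffun 'I_d -> 'I_(gridN k)}].
Let centers K : seq (nat * V) := [seq (k, z) | k <- iota 0 K, z <- grid k].

Let Qsum K x : R := \sum_(p <- centers K) m p * cut_bump p x.

Let sum_centers K (f : nat * V -> R) :
  \sum_(p <- centers K) f p = \sum_(k < K) \sum_(j : {ffun 'I_d -> 'I_(gridN k)}) f (k : nat, grid_point j).
Proof.
rewrite big_allpairs_dep /= -(big_mkord xpredT (fun k =>
  \sum_(j : {ffun 'I_d -> 'I_(gridN k)}) f (k, grid_point j))).
by rewrite /index_iota subn0; apply: eq_bigr => k _; rewrite big_map.
Qed.

Let active_grid k x : ~ S x ->
  \sum_(j : {ffun 'I_d -> 'I_(gridN k)}) (2 ^+ k * active (k, grid_point j) x) <=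
  (2 * (2 * M2) + 1) ^+ d *
    (if 2 ^+ k <= 2 * M2 * (delta x)^-1 then 2 ^+ k else 0).
Proof.
move=> Sx; case: (leP (2 ^+ k) (2 * M2 * (delta x)^-1)) => kx.
  rewrite -mulr_sumr mulrC ler_pM2r ?exprn_gt0//.
  have M22 : 0 <= 2 * M2 by rewrite mulr_ge0// ltW.
  pose t (i : 'I_d) : R := 2 ^+ k * x ord0 i + B%:R * 2 ^+ k.
  apply: le_trans (grid_count (gridN k) t M22); apply: ler_sum => j _.
  rewrite /active; case: asboolP => [[vp ux]|_]; last by rewrite ler0n.
  have -> : \big[andb/true]_i (`|t i - (j i)%:R| < 2 * M2) = true; last by [].
  elim/big_rec : _ => // i b _ ->; rewrite andbT; apply: le_lt_trans ux.
  have -> : t i - (j i)%:R = scaled (k, grid_point j) x ord0 i.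
    rewrite /scaled /t /grid_point !mxE /=; field.
    by rewrite expf_neq0.
  exact: coord_le_enorm.
rewrite mulr0 big1// => j _.
have [->|/(active_bound Sx)] := eqVneq (active (k, grid_point j) x) 0; first by rewrite mulr0.
by move=> /(lt_trans kx); rewrite ltxx.
Qed.

Lemma active_sum : exists2 C, 0 < C & forall K x, ~ S x ->
  \sum_(p <- centers K) (m p * active p x) <= C * (delta x)^-1.
Proof.
have M22 : 0 <= 2 * M2 by rewrite mulr_ge0// ltW.
exists ((2 * (2 * M2) + 1) ^+ d * (2 * (2 * M2))).
  by rewrite mulr_gt0 ?mulr_gt0 ?exprn_gt0// ltr_wpDl// mulr_ge0.
move=> K x Sx; rewrite sum_centers.
have h : 0 <= 2 * M2 * (delta x)^-1 by rewrite mulr_ge0// invr_ge0 ltW// delta_gt0.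
rewrite -!mulrA; apply: le_trans
  (_ : (2 * (2 * M2) + 1) ^+ d * (2 * (2 * M2 * (delta x)^-1)) <= _); last first.
  by rewrite !mulrA.
apply: le_trans (ler_wpM2l _ (geometric_cut K h)); last by rewrite exprn_ge0// addr_ge0// mulr_ge0.
rewrite mulr_sumr; apply: ler_sum => k _; exact: active_grid.
Qed.

(** The truncation K is the index of the family, so the constants do not depend on it and carry over
    to the full series, which coincides with some [Qsum K] near each point. *)
Lemma cls_Qsum n : cls (fun _ : nat => ~` S) (fun _ x => (delta x)^-1) n
  (fun _ x => (delta x)^-1) Qsum.
Proof.
have Uo (I : Type) : forall _ : I, open (~` S) by move=> _; rewrite openC.
have w0 (I : Type) : forall (_ : I) x, (~` S) x -> 0 <= (delta x)^-1.
  by move=> _ x Sx; rewrite invr_ge0 ltW// delta_gt0.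
have c2 : cls (fun _ : nat * V => ~` S) (fun _ x => (delta x)^-1) n active cut_bump.
  apply: cls_weight (cls_cut_bump n) => j _.
  exists ((2 * M2) ^+ j); first by rewrite exprn_ge0// mulr_ge0// ltW.
  move=> p x Sx; rewrite mulrCA -exprMn.
  have [->|ap] := eqVneq (active p x) 0; first by rewrite !mul0r.
  rewrite ler_wpM2l ?active_ge0// lerXn2r ?nnegrE ?(ltW (m0 p))//.
    by apply: mulr_ge0; [rewrite mulr_ge0// ltW|exact: (w0 _ p)].
  exact/ltW/active_bound.
have cm : cls (fun _ : nat * V => ~` S) (fun _ x => (delta x)^-1) n
    (fun p _ => m p) (fun p _ => m p).
  apply: (@cls_cst R d _ _ _ (Uo _) (w0 _) n _ (fun p => m p)).
  by exists 1 => // p x _; rewrite mul1r gtr0_norm.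
have [C C0 hC] := active_sum.
have c3 : cls (fun _ : nat * (nat * V) => ~` S) (fun _ x => (delta x)^-1) n
    (fun q x => m q.2 * active q.2 x) (fun q x => m q.2 * cut_bump q.2 x).
  apply: cls_local (cls_M (Uo _) (w0 _) cm c2) => -[K p] x Sx; exists p.
  by split => //; exact: nearW_rV.
apply: (cls_amp (w0 _)); last first.
  exact: (@cls_sum R d nat (nat * V) (fun _ => ~` S) (fun _ x => (delta x)^-1) centers
    n (fun _ p x => m p * active p x) (fun _ p x => m p * cut_bump p x) (Uo _) (w0 _) c3).
by exists C; [exact: ltW|move=> K x Sx; exact: hC].
Qed.

Let Qsum_stable K K' x : ~ S x -> 2 * M2 * (delta x)^-1 <= 2 ^+ K -> (K <= K')%N ->
  Qsum K' x = Qsum K x.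
Proof.
move=> Sx KM /subnK <-; elim: (K' - K)%N => // i IH.
rewrite -{}IH /Qsum !sum_centers addSn big_ord_recr/= [X in _ + X]big1 ?addr0// => j _.
apply/eqP; rewrite mulf_eq0; apply/orP; right; apply/eqP/cut_bump_active/eqP.
apply/negPn/negP => /(active_bound Sx)/= /lt_le_trans/(_ KM).
by apply/negP; rewrite -leNgt ler_weXn2l ?ler1n// leq_addl.
Qed.

Let index x := Num.bound (2 * M2 * (delta x)^-1).
(* The whole dyadic series, locally finite outside S: the terms with
   2 ^ k >> 1 / delta vanish.  Q is of size 1 / delta, and 1 / Q is the
   regularized distance. *)
Let Q x := Qsum (index x) x.

Let index_le x : ~ S x -> 2 * M2 * (delta x)^-1 <= 2 ^+ index x.
Proof.
move=> Sx; have h : 0 <= 2 * M2 * (delta x)^-1.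
  by rewrite !mulr_ge0 ?(ltW M20)// invr_ge0 ltW// delta_gt0.
rewrite ltW// (lt_le_trans (archi_boundP h))//.
by rewrite -natrX ler_nat ltnW// ltn_expl.
Qed.

Let Q_Qsum K x : ~ S x -> 2 * M2 * (delta x)^-1 <= 2 ^+ K -> Q x = Qsum K x.
Proof.
move=> Sx KM; rewrite /Q -(Qsum_stable Sx (index_le Sx) (leq_maxl _ K)).
by rewrite -(Qsum_stable Sx KM (leq_maxr (index x) _)).
Qed.

(** On the ball of radius delta x / 2 the distance exceeds delta x / 2, so one truncation serves all
    its points; hence 4 M2 instead of 2 M2. *)
Let Q_near x : ~ S x -> exists K0, forall K, (K0 <= K)%N -> \forall y \near x, Qsum K y = Q y.
Proof.
move=> Sx; have [K0 hK] := pow2_gt (4 * M2 * (delta x)^-1); exists K0 => K KK.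
have dx := delta_gt0 Sx.
apply/enorm_nbhsP; exists (delta x / 2); first by rewrite divr_gt0.
move=> y yx; have dy : delta x / 2 < delta y.
  by have := dist_to_lip S0 x y; rewrite enormB; lra.
have Sy : ~ S y.
  move=> Sy; have := dist_to_le S0 y Sy; rewrite subrr enorm0; lra.
apply/esym/Q_Qsum => //.
apply: (@le_trans _ _ (2 ^+ K0)); last by rewrite ler_weXn2l// ler1n.
rewrite (le_trans _ (ltW hK))//.
have -> : 4 * M2 * (delta x)^-1 = 2 * M2 * (delta x / 2)^-1 by field; rewrite gt_eqF.
have d2 : 0 < delta x / 2 by rewrite divr_gt0.
by rewrite ler_pM2l ?mulr_gt0// lef_pV2 ?posrE ?(ltW dy)// (lt_trans d2).
Qed.

Lemma cls_Q n : cls (fun _ : unit => ~` S) (fun _ x => (delta x)^-1) n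
  (fun _ x => (delta x)^-1) (fun _ => Q).
Proof.
apply: cls_local (cls_Qsum n) => -[] x Sx; have [K h] := Q_near Sx.
by exists K; split => //; exact: h.
Qed.

Let eps0 : R := (2 ^+ k0)^-1.

Let dyadic_scale x : ~ S x -> delta x < eps0 ->
  exists k, [/\ (k0 <= k)%N, 1 <= 2 ^+ k * delta x & 2 ^+ k * delta x < 2].
Proof.
move=> Sx dx; have d0 := delta_gt0 Sx.
have ex : exists k, 1 <= 2 ^+ k * delta x.
  have [k hk] := pow2_gt (delta x)^-1; exists k.
  by rewrite -ler_pdivrMr// div1r ltW.
case: (ex_minnP ex) => -[|k] hk hmin.
  have : delta x < 1.
    apply: lt_le_trans dx _; rewrite /eps0 invf_le1 ?exprn_gt0// exprn_ege1 ?ler1n//.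
  by move=> h; move: hk; rewrite expr0 mul1r leNgt h.
exists k.+1; split => //.
  rewrite leqNgt; apply/negP => kk; move: hk; apply/negP; rewrite -ltNge.
  rewrite -ltr_pdivlMl ?exprn_gt0// mulr1 (lt_le_trans dx)// /eps0.
  rewrite lef_pV2 ?posrE ?exprn_gt0//; apply: ler_weXn2l; first by rewrite ler1n.
  exact: ltnW.
rewrite exprS -mulrA; have : ~~ (1 <= 2 ^+ k * delta x).
  by apply/negP => /hmin; rewrite ltnn.
by rewrite -ltNge; lra.
Qed.

(** Take y in S with |x - y| < 2 delta x and push it along [eta y] by s = D / 2^k. The ball of
    radius c s = d / 2^k around the result lies in S by [tv_cone], and it contains the grid point
    obtained by rounding down every coordinate. *)
Let good_center x : ~ S x -> delta x < eps0 -> exists p, exists j : {ffun 'I_d -> 'I_(gridN p)},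
  [/\ near_dom (p, grid_point j) x, enorm (scaled (p, grid_point j) x) <= M1 &
      1 <= 2 ^+ p * delta x].
Proof.
move=> Sx dx; have [k [kk k1' k2']] := dyadic_scale Sx dx.
have A0 : 0 < (2 : R) ^+ k by rewrite exprn_gt0.
have A1 : 1 <= (2 : R) ^+ k by rewrite exprn_ege1 ?ler1n.
have Akk : (2 : R) ^+ k0 <= 2 ^+ k by apply: ler_weXn2l; rewrite ?ler1n.
have [y Sy xy] := dist_to_adh2 S0 Sc Sx.
set A := (2 : R) ^+ k in A0 A1 k1' k2' Akk *.
pose s := D / A; pose y1 := y + s *: eta y.
have s0 : 0 <= s by rewrite divr_ge0// ltW.
have DA : D < r * A by rewrite (lt_le_trans k4)// ler_pM2l.
have sr : s < r by rewrite ltr_pdivrMr.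
have xyA : A * enorm (x - y) < 4.
  have : A * enorm (x - y) < A * (2 * delta x) by rewrite ltr_pM2l.
  lra.
have MA : M1 < r * A by rewrite (lt_le_trans k3)// ler_pM2l.
have yx : enorm (y - x) < r.
  rewrite enormB -(ltr_pM2l A0) mulrC [X in _ < X]mulrC; have := M10; move: MA; rewrite (mulrC _ A); lra.
have B2 i : `|y1 ord0 i| <= B%:R.
  rewrite (le_trans (coord_le_enorm _ _))// (le_trans _ BB)//.
  rewrite (le_trans (enormD _ _))// lerD ?SB// enormZ ger0_norm//.
  by rewrite ler_pM ?enorm_ge0 ?(ltW sr)// (tv_bound tv).
pose t i : R := A * y1 ord0 i + B%:R * A.
have t0 i : 0 <= t i.
  have := B2 i; rewrite ler_norml => /andP[h _].
  by rewrite /t addrC (mulrC A) -mulrDl mulr_ge0 ?(ltW A0)//; lra.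
have tN i : (Num.truncn (t i) < gridN k)%N.
  rewrite ltnS -(ler_nat R) (le_trans (_ : _ <= t i))//.
    by have /andP[] := truncn_itv (t0 i).
  have := B2 i; rewrite ler_norml => /andP[_ h].
  rewrite /t !natrM natrX -/A.
  have : A * y1 ord0 i <= A * B%:R by rewrite ler_pM2l.
  lra.
pose j : {ffun 'I_d -> 'I_(gridN k)} := [ffun i => Ordinal (tN i)].
set z := grid_point j.
have zE i : A * (z ord0 i - y1 ord0 i) = (Num.truncn (t i))%:R - t i.
  have -> : z ord0 i = A^-1 * ((Num.truncn (t i))%:R - B%:R * A).
    by rewrite /z /grid_point !mxE ffunE.
  rewrite [X in _ = _ - X](_ : _ = A * y1 ord0 i + B%:R * A)//.
  move: (t i) (y1 ord0 i) => t' Y; field; exact: lt0r_neq0.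
have zy : A * enorm (z - y1) <= d%:R.
  have -> : A * enorm (z - y1) = enorm (A *: (z - y1)) by rewrite enormZ gtr0_norm.
  rewrite (le_trans (enorm_le_sum _))//.
  rewrite -[in leRHS](card_ord d) -sumr_const; apply: ler_sum => i _.
  have cE (u v : V) : (A *: (u - v)) ord0 i = A * (u ord0 i - v ord0 i) by rewrite !mxE.
  rewrite cE zE.
  have /andP[h1 h2] := truncn_itv (t0 i); rewrite ler_norml.
  by move: h2; rewrite -natr1 => h2; apply/andP; split; lra.
have Sz : S z.
  apply: (tv_cone tv Sy Sx yx s0 sr); rewrite -/y1.
  have -> : z - y - s *: eta y = z - y1 by rewrite /y1 opprD addrA.
  have -> : c * s = d%:R / A by rewrite /s /D; field; rewrite !gt_eqF.
  by rewrite ler_pdivlMr// mulrC.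
have uM : enorm (scaled (k, z) x) <= M1.
  rewrite enorm_scaled /= -/A.
  have -> : x - z = (x - y) - s *: eta y + (y1 - z).
    have E (u1 u2 u3 u4 : V) : u1 - u4 = u1 - u2 - u3 + (u2 + u3 - u4).
      by apply/rowP => i; rewrite !mxE; ring.
    exact: E.
  have h1 := enormD (x - y - s *: eta y) (y1 - z).
  have h2 := enorm_subD (x - y) (s *: eta y).
  have h3 : A * enorm (s *: eta y) <= D * H.
    rewrite enormZ ger0_norm// mulrA (_ : A * s = D).
      by rewrite ler_wpM2l// (tv_bound tv).
    by rewrite /s mulrC divfK// gt_eqF.
  have h4 : A * enorm (x - y - s *: eta y + (y1 - z)) <=
     A * (enorm (x - y) + enorm (s *: eta y) + enorm (y1 - z)).
    by rewrite ler_pM2l//; lra.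
  move: h4; rewrite !mulrDr (enormB y1) /M1; lra.
have vz : valid_center (k, z).
  split => //; exists x => //=.
  rewrite enormB -(ltr_pM2l A0) [X in _ < X]mulrC (le_lt_trans _ MA)//.
  by move: uM; rewrite enorm_scaled.
exists k, j; rewrite -/z; split => //; split => //.
rewrite (le_lt_trans uM)//.
have cH : c <= H := le_trans (valid_low vz) (tv_bound tv _).
have M1p : 0 < M1 by have : 4 <= M1 := M10; lra.
have T1 : M1 * c <= T.
  rewrite /T; have : M1 * c <= M1 * H by rewrite ler_pM2l.
  have : 0 <= M1 * H by rewrite mulr_ge0 ?(ltW H0) ?(ltW M1p).
  lra.
have T2 : M1 <= T / c by rewrite ler_pdivlMr.
have T3 : 0 <= 16 * H * T / c ^+ 2 by rewrite divr_ge0 ?mulr_ge0 ?ltW.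
have T4 : 4 * T / c = 4 * (T / c) by rewrite mulrA.
rewrite /M2 T4.
by move: T3 T2 M1p; move: (16 * H * T / c ^+ 2) (T / c) (M1) => a1 a2 a3; lra.
Qed.

Lemma distance_bump : exists (eps c1 c2 C : R) (rho : V -> R),
  let W := [set x | ~ S x /\ delta x < eps] in
  [/\ [/\ 0 < eps, 0 < c1, 0 < c2 & 0 < C],
    forall n, cls (fun _ : unit => W) (fun _ x => (delta x)^-1) n
      (fun _ x => delta x) (fun _ => rho),
    forall x, W x -> c1 * delta x <= rho x <= C * delta x &
    forall x, W x -> 'D_(eta x) rho x <= - c2].
Proof.
have [C C0 hC] := active_sum.
have e0 : 0 < eps0 by rewrite invr_gt0 exprn_gt0.
pose W := [set x | ~ S x /\ delta x < eps0].
have l0 : 0 < low1 by exact: expR_gt0.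
have kap0 : 0 < kap.
  have : 0 < M1 * H + T.
    have : 0 <= M1 * H by rewrite mulr_ge0 ?(ltW H0)//; have := M10; lra.
    have : 0 < T := T0; lra.
  move=> MT; rewrite /kap !mulr_gt0// ?invr_gt0 ?exprn_gt0//.
pose l2 := low1 * low1; have l20 : 0 < l2 by rewrite mulr_gt0.
have [Cq Cq0 hCq] := cls_bound (cls_Q 0).
have Qhi x : W x -> Q x <= (Cq + 1) * (delta x)^-1.
  move=> [Sx _]; rewrite (le_trans (ler_norm _))// (le_trans (hCq tt x Sx))//.
  by rewrite ler_wpM2r ?invr_ge0 ?(ltW (delta_gt0 Sx))// lerDl.
have Qlow x : W x -> l2 * (delta x)^-1 <= Q x /\
   kap * (delta x)^-2 <= 'D_(eta x) Q x.
  move=> [Sx dx]; have [k [j [nd uM kd]]] := good_center Sx dx.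
  have d0 := delta_gt0 Sx.
  have [K0 hK] := Q_near Sx.
  pose K := maxn K0 k.+1; have kK : (k < K)%N by rewrite leq_maxr.
  have QK := hK K (leq_maxl _ _).
  have dk : (delta x)^-1 <= 2 ^+ k by rewrite -div1r ler_pdivrMr.
  have A0 : 0 < (2 : R) ^+ k by rewrite exprn_gt0.
  have [cb db] := cone_bump_good nd uM.
  (* All summands of Q and of D_eta Q are nonnegative, so a single good centre bounds both from
     below. *)
  have one_term (f : nat * V -> R) : (forall p, 0 <= f p) ->
      f (k, grid_point j) <= \sum_(p <- centers K) f p.
    move=> f0; rewrite sum_centers (bigD1 (Ordinal kK))//= (bigD1 j)//= -addrA lerDl.
    by rewrite addr_ge0// sumr_ge0// => i _; rewrite sumr_ge0.
  have cbE : cut_bump (k, grid_point j) x = cone_bump (k, grid_point j) x.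
    by rewrite /cut_bump asboolT.
  split.
    rewrite -(nbhs_singleton QK); apply: le_trans (one_term (fun p => m p * cut_bump p x) _).
      by rewrite cbE /= mulrC ler_pM ?invr_ge0 ?(ltW d0) ?(ltW l20).
    by move=> p; rewrite mulr_ge0 ?cut_bump_ge0 ?(ltW (m0 p)).
  rewrite -(near_eq_derive _ QK).
  have dc p : differentiable (cut_bump p) x by have := cls_diff (cls_cut_bump 1) Sx; apply.
  have dcm p : differentiable (fun y => m p * cut_bump p y) x.
    by apply: differentiableM => //; exact: differentiable_cst.
  have [_ ->] := derive_bigsum (centers K) (eta x) dcm.
  have DE p : 'D_(eta x) (fun y => m p * cut_bump p y) x = m p * 'D_(eta x) (cut_bump p) x.
    by apply: deriveZ; exact: diff_derivable.
  under eq_bigr do rewrite DE.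
  apply: le_trans (one_term (fun p => m p * 'D_(eta x) (cut_bump p) x) _); last first.
    by move=> p; rewrite mulr_ge0 ?cut_bump_derive_ge0 ?(ltW (m0 p)).
  have -> : 'D_(eta x) (cut_bump (k, grid_point j)) x = 'D_(eta x) (cone_bump (k, grid_point j)) x.
    have [[_ ex]|[]//] := cut_bump_near (k, grid_point j) Sx.
    by rewrite (near_eq_derive _ ex).
  apply: (@le_trans _ _ (2 ^+ k * (kap * 2 ^+ k))); last by rewrite ler_pM2l.
  rewrite mulrCA ler_pM2l// expr2 invfM ler_pM ?invr_ge0 ?(ltW d0)//.
have Wo : open W by exact: collar_open.
have Q0 x : W x -> 0 < Q x.
  move=> Wx; apply: lt_le_trans (Qlow x Wx).1.
  by rewrite mulr_gt0 ?invr_gt0 ?delta_gt0//; case: Wx.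
have w0 : forall (_ : unit) x, W x -> 0 <= (delta x)^-1.
  by move=> _ x [Sx _]; rewrite invr_ge0 ltW// delta_gt0.
have cQ n : cls (fun _ : unit => W) (fun _ x => (delta x)^-1) n
  (fun _ x => (delta x)^-1) (fun _ => Q).
  apply: cls_local (cls_Q n) => -[] x [Sx _]; exists tt.
  by split => //; exact: nearW_rV.
have Cq1 : 0 < Cq + 1 by rewrite ltr_wpDl.
exists eps0, (Cq + 1)^-1, (kap / (Cq + 1) ^+ 2), l2^-1, (fun x => (Q x)^-1); split.
- by split => //; rewrite ?divr_gt0 ?invr_gt0 ?exprn_gt0.
- move=> n; apply: (cls_inv _ w0 _ _ _ (cQ n)).
  + by [].
  + by move=> _ x Wx; rewrite gt_eqF// Q0.
  + exists l2^-1; first by rewrite invr_ge0 ltW.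
    move=> _ x Wx; have [Sx _] := Wx; have d0 := delta_gt0 Sx.
    rewrite gtr0_norm ?invr_gt0 ?Q0//.
    rewrite -[leRHS]invrK invfM invrK lef_pV2 ?posrE ?Q0 ?mulr_gt0 ?invr_gt0//.
    exact: (Qlow x Wx).1.
  + exists 1 => // _ x [Sx _]; rewrite mulVf// gt_eqF// delta_gt0//.
- move=> x Wx; have [Sx _] := Wx; have d0 := delta_gt0 Sx; apply/andP; split.
    rewrite -[leLHS]invrK invfM invrK lef_pV2 ?posrE ?Q0 ?mulr_gt0 ?invr_gt0//.
    exact: Qhi.
  rewrite -[leRHS]invrK invfM invrK lef_pV2 ?posrE ?Q0 ?mulr_gt0 ?invr_gt0//.
  exact: (Qlow x Wx).1.
move=> x Wx; have [Sx _] := Wx; have d0 := delta_gt0 Sx.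
have dQ : differentiable Q x by exact: (@cls_diff _ _ _ _ _ _ _ _ tt x (cQ 1%N) Wx).
rewrite deriveV ?gt_eqF ?Q0//; last exact: diff_derivable.
rewrite -[_ *: _]/(_ * _) mulNr lerN2.
have Qx := Q0 x Wx; have Qh := Qhi x Wx; have [_ Ql] := Qlow x Wx.
apply: (@le_trans _ _ ((Q x) ^- 2 * (kap * (delta x)^-2))); last first.
  by rewrite ler_pM2l// invr_gt0 exprn_gt0.
rewrite mulrCA ler_pM2l// -invfM lef_pV2 ?posrE ?mulr_gt0 ?exprn_gt0//.
rewrite -exprMn lerXn2r ?nnegrE ?(ltW Cq1)//; first by rewrite mulr_ge0 ?ltW.
by rewrite -ler_pdivlMr.
Qed.


End RegularizedDistance.
End Transversal.

Section RegularizedDistanceExists.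
Context (R : realType) (d : nat).
Local Notation V := 'rV[R]_d.

Lemma regularized_distance (S : set V) (eta : V -> V) (c r H L B0 : R) :
  transversal_field S eta c r H L -> closed S -> S !=set0 ->
  (forall z, S z -> enorm z <= B0) ->
  exists (eps c1 c2 C : R) (rho : V -> R),
  let W := [set x | ~ S x /\ dist_to S x < eps] in
  [/\ [/\ 0 < eps, 0 < c1, 0 < c2 & 0 < C],
    forall n, cls (fun _ : unit => W) (fun _ x => (dist_to S x)^-1) n
      (fun _ x => dist_to S x) (fun _ => rho),
    forall x, W x -> c1 * dist_to S x <= rho x <= C * dist_to S x &
    forall x, W x -> 'D_(eta x) rho x <= - c2].
Proof.
move=> tv Sc S0 SB.
have [c0 r0 H0 L0] := And4 (tv_c tv) (tv_r tv) (tv_H tv) (tv_L tv).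
have scale X Y : 0 < Y -> exists k0, forall k, (k0 <= k)%N -> X < Y * 2 ^+ k :> R.
  move=> Y0; have [k0 h] := pow2_gt (X / Y); exists k0 => k kk.
  rewrite mulrC -ltr_pdivrMr// (lt_le_trans h)//.
  by apply: ler_weXn2l kk; rewrite ler1n.
pose D := d%:R / c; pose M1 := 4 + D * H + d%:R; pose T := 2 * M1 * H + 1.
pose M2 := 16 * H * T / c ^+ 2 + 4 * T / c.
have [k2 h2] := scale (8 * M2 * H) (r * c ^+ 2) ltac:(by rewrite mulr_gt0 ?exprn_gt0).
have [k3 h3] := scale M1 r r0; have [k4 h4] := scale D r r0.
have [k5 h5] := scale (32 * H * L * M2) (c ^+ 2) ltac:(by rewrite exprn_gt0).
pose k := (k2 + k3 + k4 + k5)%N.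
have BB : B0 + r * H <= (Num.bound `|B0 + r * H|)%:R.
  by rewrite (le_trans (ler_norm _))// ltW// archi_boundP.
apply: (@distance_bump R d S eta c r H L B0 tv Sc S0 SB k _ _ _ _ _ BB).
- by apply: h2; rewrite /k; lia.
- by apply: h3; rewrite /k; lia.
- by apply: h4; rewrite /k; lia.
- by apply: h5; rewrite /k; lia.
Qed.

End RegularizedDistanceExists.

(** * Transversal fields of Lipschitz domains *)

Section Segments.
Context (R : realType) (d : nat).
Local Notation V := 'rV[R]_d.

Lemma line_derive (f : V -> R) (x v : V) (t : R) : differentiable f (t *: v + x) ->
  is_derive t (1 : R) (fun u : R => f (u *: v + x)) ('D_v f (t *: v + x)).
Proof.
move=> /(@diff_derivable _ _ _ _ _ v) fd.
have E : (fun h : R => h^-1 *: (((fun u : R => f (u *: v + x)) \o shift t) (h *: (1 : R)) - f (t *: v + x))) =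
         (fun h => h^-1 *: ((f \o shift (t *: v + x)) (h *: v) - f (t *: v + x))).
  by apply/funext => h; rewrite /= -[h *: 1]/(h * 1) mulr1 scalerDl addrA.
by split; rewrite /derivable /derive E.
Qed.

Lemma mvt_line (f : V -> R) (x v : V) :
  (forall t, 0 <= t <= 1 -> differentiable f (t *: v + x)) ->
  exists2 t, 0 <= t <= 1 & f (v + x) - f x = 'D_v f (t *: v + x).
Proof.
move=> df; pose phi (u : R) := f (u *: v + x).
have dphi (t : R) : t \in `[0, 1] -> is_derive t (1 : R) phi ('D_v f (t *: v + x)).
  by rewrite in_itv/= => /df; exact: line_derive.
pose D (t : R) : R := 'D_v f (t *: v + x).
have d1 : forall t : R, t \in `]0, 1[ -> is_derive t (1 : R) phi (D t).
  by move=> t /subset_itv_oo_cc/dphi.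
have d2 : {within `[0, 1], continuous phi}.
  by apply: derivable_within_continuous => t /dphi[].
have lt01 : (0 : R) < 1 by exact: ltr01.
have [t t01 E] := MVT lt01 d1 d2.
exists t; first by move: t01; rewrite in_itv/= => /andP[h1 h2]; rewrite !ltW.
by move: E; rewrite /phi scale1r scale0r add0r subr0 mulr1.
Qed.

(** b is the last point in S of the segment from z to x: closedness puts it in S, and being last
    keeps it out of the interior. *)
Lemma boundary_between (S : set V) z x : closed S -> S z -> ~ S x ->
  exists b, [/\ S b, ~ interior S b & enorm (z - b) <= enorm (z - x)].
Proof.
move=> Sc Sz Sx; pose p (t : R) := z + t *: (x - z).
pose A := [set t | 0 <= t <= 1 /\ S (p t)].
have A0 : A 0 by split; rewrite ?lexx ?ler01// /p scale0r addr0.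
have supA : has_sup A.
  by split; [exists 0 | exists 1 => t [/andP[]]].
have plip t u : enorm (p t - p u) = `|t - u| * enorm (x - z).
  rewrite /p opprD addrACA subrr add0r -scalerBl enormZ//.
set X := enorm (x - z) in plip; have X0 : 0 <= X by exact: enorm_ge0.
pose T := sup A.
have T0 : 0 <= T by apply: ub_le_sup => //; exact: supA.2.
have T1 : T <= 1 by apply: ge_sup; [exact: supA.1|move=> t [/andP[]]].
have ST : S (p T).
  apply: contrapT => /(closed_outP Sc)[e e0 he].
  have X1 : 0 < X + 1 by lra.
  have [t At Tt] := sup_adherent (divr_gt0 e0 X1) supA.
  have tT : t <= T by apply: ub_le_sup => //; exact: supA.2.
  have := he _ At.2; rewrite plip ler0_norm ?subr_le0// opprB leNgt => /negP; apply.
  move: Tt; rewrite -/T ltrBlDr -ltrBlDl ltr_pdivlMr// mulrDr mulr1 => h.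
  apply: le_lt_trans h; lra.
exists (p T); split => //; last first.
  have -> : z - p T = - (T *: (x - z)) by rewrite /p opprD addrA subrr add0r.
  by rewrite enormN enormZ ger0_norm// (enormB z x) ler_piMl.
rewrite /interior => /enorm_nbhsP[e e0 he].
have TL : T < 1.
  rewrite lt_neqAle T1 andbT; apply/eqP => E; apply: Sx.
  by move: ST; rewrite /p E scale1r addrC subrK.
pose t := T + Num.min (1 - T) (e / (X + 1) / 2).
have X1 : 0 < X + 1 by lra.
have h0 : 0 < Num.min (1 - T) (e / (X + 1) / 2).
  by rewrite lt_min subr_gt0 TL !divr_gt0.
have : t <= T.
  apply: ub_le_sup; first exact: supA.2.
  split; first by rewrite /t addr_ge0// ?(ltW h0)//= -lerBrDl ge_min lexx.
  apply: he; rewrite plip /t addrC addKr gtr0_norm//.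
  apply: (@le_lt_trans _ _ (e / (X + 1) / 2 * X)).
    by rewrite ler_wpM2r// ge_min lexx orbT.
  rewrite -(ltr_pM2r X1); have -> : e / (X + 1) / 2 * X * (X + 1) = e * X / 2 by field; rewrite gt_eqF.
  have : 0 <= e * X by rewrite mulr_ge0// ltW.
  lra.
by rewrite /t gerDl leNgt h0.
Qed.

End Segments.

Section Charts.
Context (R : realType) (d : nat).
Local Notation V := 'rV[R]_d.

Definition cone_chart (S : set V) (x e : V) (rho kappa : R) : Prop :=
  [/\ 0 < rho, 0 < kappa, kappa <= 1, enorm e = 1 & forall y y' s,
    enorm (y - x) < rho -> enorm (y' - x) < rho -> S y -> 0 <= s ->
    enorm (y' - y - s *: e) <= kappa * s -> S y'].

(** A move by s e + w raises the coordinate along e by at least s - |w|, while the projection moves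
    by at most 2 |w| and the graph by at most 2 k' |w|. The point stays above the graph if (2 k' +
    1) |w| <= s. Here [k'] guards against a negative Lipschitz constant. *)
Lemma lipschitz_cone_chart (Om : set V) x : open Om -> lipschitz_boundary Om ->
  boundary Om x -> exists e rho kappa, cone_chart (closure Om) x e rho kappa.
Proof.
move=> Omo lip bx; have [e [g [k [e1 glip]]]] := lip x bx.
move=> /enorm_nbhsP[rho rho0 near_g].
pose k' := Num.max k 0; have k'0 : 0 <= k' by rewrite le_max lexx orbT.
have K0 : 0 < 2 * k' + 1 by lra.
exists e, rho, (2 * k' + 1)^-1; split => //.
- by rewrite invr_gt0.
- by rewrite invf_le1//; lra.
have intO : interior Om = Om by rewrite -interior_id.
have SE y : enorm (y - x) < rho -> closure Om y <-> g (hproj e y) <= dot y e.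
  move=> /near_g[hb ho]; split=> [cy|].
    have [Oy|nOy] := pselect (Om y); first by rewrite ltW//; exact/ho.
    have /hb -> : boundary Om y by split=> //; rewrite intO.
    by rewrite lexx.
  rewrite le_eqVlt => /orP[/eqP/esym/hb[]//|/ho]; exact: subset_closure.
have ee : dot e e = 1 by rewrite -enorm_sqr e1 expr1n.
move=> y y' s yx y'x /(SE _ yx) Sy s0 hs; apply/(SE _ y'x).
set w := y' - y - s *: e in hs.
have y'E : y' = y + s *: e + w by apply/rowP => i; rewrite /w !mxE; ring.
have hyp u : hyperplane e (hproj e u).
  by rewrite /hyperplane /hproj /= dotBl dotZl ee mulr1 subrr.
have dw : `|dot w e| <= enorm w by rewrite (le_trans (cauchy_schwarz _ _))// e1 mulr1.
have pE : hproj e y' - hproj e y = w - dot w e *: e.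
  rewrite /hproj y'E !dotDl dotZl ee mulr1.
  by apply/rowP => i; rewrite !mxE; ring.
have pw : `|hproj e y' - hproj e y| <= 2 * enorm w.
  rewrite (le_trans (norm_le_enorm _))// pE (le_trans (enorm_subD _ _))//.
  by rewrite enormZ e1 mulr1; lra.
have gl : g (hproj e y') - g (hproj e y) <= k' * (2 * enorm w).
  rewrite (le_trans (ler_norm _))//.
  rewrite (le_trans (glip (hproj e y', hproj e y) (conj (hyp _) (hyp _))))//=.
  rewrite (le_trans (_ : _ <= k' * `|hproj e y' - hproj e y|))//.
    by rewrite ler_wpM2r// le_max lexx.
  by rewrite ler_wpM2l.
have -> : dot y' e = dot y e + s + dot w e by rewrite {1}y'E !dotDl dotZl ee mulr1.
have ws : enorm w * (2 * k' + 1) <= s by rewrite -ler_pdivlMr// mulrC.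
have := lerNnormlW dw; lra.
Qed.

End Charts.

Section Field.
Context (R : realType) (d : nat).
Local Notation V := 'rV[R]_d.

Definition ball_bump (i : V) (rho : R) x : R := bumpf 0 (rho ^+ 2 / 4 - dot (x - i) (x - i)).

Lemma ball_bump_ge0 i rho x : 0 <= ball_bump i rho x.
Proof. exact: bumpf0_ge0. Qed.

Lemma ball_bump_le1 i rho x : ball_bump i rho x <= 1.
Proof.
rewrite /ball_bump; set u := rho ^+ 2 / 4 - _; have [u0|u0] := ltP 0 u; last by rewrite bumpf_npos.
by rewrite bumpf0E// -expR0 ler_expR oppr_le0 invr_ge0 ltW.
Qed.

Lemma ball_bump_supp i rho x : 0 < rho -> ball_bump i rho x != 0 -> enorm (x - i) < rho / 2.
Proof.
move=> r0; rewrite ltNge; apply: contra => h; rewrite /ball_bump bumpf_npos// subr_le0.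
rewrite -enorm_sqr; apply: le_trans (_ : (rho / 2) ^+ 2 <= _).
  by rewrite expr_div_n -natrX.
by rewrite lerXn2r ?nnegrE ?enorm_ge0// divr_ge0// ltW.
Qed.

Lemma ball_bump_low i rho x : 0 < rho -> enorm (x - i) < rho / 4 ->
  bumpf 0 (3 / 16 * rho ^+ 2) <= ball_bump i rho x.
Proof.
move=> r0 h; apply: bumpf0_le; rewrite -enorm_sqr.
have : enorm (x - i) ^+ 2 <= (rho / 4) ^+ 2.
  by rewrite lerXn2r ?nnegrE ?enorm_ge0 ?(ltW h)// divr_ge0// ltW.
rewrite expr_div_n (_ : 4 ^+ 2 = 16) -?natrX//; lra.
Qed.

(** On the ball of radius rho the argument of the profile is bounded and [cls_comp] applies;
    elsewhere the bump is locally 0 and is glued in. *)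
Lemma cls_ball_bump i rho n : 0 < rho ->
  cls (fun _ : unit => [set: V]) (fun _ _ => 1) n (fun _ _ => 1) (fun _ => ball_bump i rho).
Proof.
move=> r0; pose U (_ : unit) : set V := [set x | enorm (x - i) < rho].
have Uo j : open (U j).
  apply/enorm_openP => x ux; exists (rho - enorm (x - i)); first by rewrite subr_gt0.
  by move=> y yx; rewrite /U /=; have := enorm_distD x y i; lra.
have w0 : forall j x, U j x -> (0 : R) <= 1 by [].
have cu k : cls U (fun _ _ => 1) n (fun _ _ => 1) (fun _ x => dot x (delta_mx 0 k) + (- i ord0 k)).
  apply: (@cls_affine R d _ _ _ Uo w0 n _ (fun _ => delta_mx 0 k) (fun _ => - i ord0 k)).
    exists rho => [|j x ux]; first exact: ltW.
    rewrite dot_delta mulr1 (_ : _ + _ = (x - i) ord0 k); last by rewrite !mxE.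
    by rewrite (le_trans (coord_le_enorm _ _))// ltW.
  by exists 1 => // _ x _; rewrite enorm_delta !mulr1.
have cq : cls U (fun _ _ => 1) n (fun _ _ => 1)
    (fun _ x => rho ^+ 2 / 4 - \sum_(k <- index_enum 'I_d)
       (dot x (delta_mx 0 k) + (- i ord0 k)) * (dot x (delta_mx 0 k) + (- i ord0 k))).
  apply: (cls_B Uo w0).
    apply: (@cls_cst R d _ _ _ Uo w0 n _ (fun _ => rho ^+ 2 / 4)).
    exists (rho ^+ 2 / 4) => [|_ x _]; first by rewrite divr_ge0// exprn_ge0// ltW.
    by rewrite mulr1 ger0_norm// divr_ge0// exprn_ge0// ltW.
  apply: cls_bigsum => // k; apply: (cls_amp w0) (cls_M Uo w0 (cu k) (cu k)).
  by exists 1 => // _ x _; rewrite !mul1r.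
have cb := cls_comp Uo w0 (@is_derive_bumpf R) cq 0.
pose Z (_ : unit) : set V := [set: V].
have cz : cls Z (fun _ _ => 1) n (fun _ _ => 1) (fun _ _ => 0).
  apply: (@cls_cst R d _ Z (fun _ _ => 1) _ _ n _ (fun=> 0)) => //.
  - by move=> p; exact: openT.
  - by exists 1 => // p x _; rewrite normr0 mulr1.
have pp (W : unit -> set V) : forall j x, W j x -> (0 : R) <= 1 /\ (0 : R) <= 1 by [].
apply: cls_local (cls_join (pp U) (pp Z) cb cz) => -[] x _.
have [ux|ux] := ltP (enorm (x - i)) rho.
  exists (inl tt); split => //=; apply: nearW_rV => y.
  rewrite /ball_bump; congr (bumpf 0 (_ - _)); apply: eq_bigr => k _.
  by rewrite dot_delta !mxE.
exists (inr tt); split => //=; apply/enorm_nbhsP; exists (rho / 2); first by rewrite divr_gt0.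
move=> y yx; apply/esym/eqP/negPn/negP => /(ball_bump_supp r0) yi.
have := enorm_distD y x i; rewrite (enormB x y); lra.
Qed.

Lemma min_pos (I : eqType) (s : seq I) (f : I -> R) : (forall i, i \in s -> 0 < f i) ->
  exists2 mn, 0 < mn & forall i, i \in s -> mn <= f i.
Proof.
elim: s => [_|j s IH h]; first by exists 1.
have [mn mn0 hm] := IH (fun i is_ => h i (mem_behead (s := j :: s) is_)).
exists (Num.min mn (f j)); first by rewrite lt_min mn0 h// mem_head.
move=> i; rewrite inE => /orP[/eqP ->|/hm]; first by rewrite ge_min lexx orbT.
by rewrite ge_min => ->.
Qed.

Section Construction.
Context (Om : set V).
Hypothesis Omo : open Om.
Hypothesis Omb : bounded_set Om.
Hypothesis lip : lipschitz_boundary Om.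
Let S := closure Om.

Lemma bounded_closure_enorm : exists2 B0, 0 <= B0 & forall z, S z -> enorm z <= B0.
Proof.
have [M [_ hM]] := Omb; pose M' := `|M| + 1.
have MM : M < M' by rewrite /M' ltr_pwDr// ler_norm.
have h x : Om x -> `|x| <= M' by exact: hM.
exists (d%:R * M' + 1); first by rewrite addr_ge0// mulr_ge0// addr_ge0.
move=> z Sz; have [y [Oy zy]] : Om `&` [set y | enorm (y - z) < 1] !=set0.
  by apply: Sz; apply/enorm_nbhsP; exists 1.
rewrite -(subrK y z) (le_trans (enormD _ _))// addrC lerD//.
  by rewrite (le_trans (enorm_le_norm _))// ler_wpM2l// h.
by rewrite enormB ltW.
Qed.

Lemma boundary_compact : compact (boundary Om).
Proof.
apply: bounded_closed_compact.
  have [B0 B00 hB] := bounded_closure_enorm.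
  exists B0; split; first exact: num_real.
  by move=> M BM x [/hB h _] /=; rewrite (le_trans (norm_le_enorm _))// (le_trans h)// ltW.
rewrite /boundary setDE; apply: closedI; first exact: closed_closure.
by apply: open_closedC; exact: open_interior.
Qed.

Lemma boundary_closure_sub b : S b -> ~ interior S b -> boundary Om b.
Proof.
move=> Sb iSb; split => // iO; apply: iSb; move: iO; rewrite /interior.
by apply: filterS; exact: subset_closure.
Qed.

(** The weights of the chart axes come from a finite cover of the boundary and are not normalised; a
    positive lower bound [xm] of their sum near the boundary plays the role of 1. *)
Lemma transversal_field_exists : exists eta c r H L, transversal_field S eta c r H L.
Proof.
have Sc : closed S by exact: closed_closure.
have /choice[ch hch] : forall x, exists q : V * R * R,
    boundary Om x -> cone_chart S x q.1.1 q.1.2 q.2.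
  move=> x; have [bx|bx] := pselect (boundary Om x); last by exists (0, 0, 0).
  have [e [rho [kap h]]] := lipschitz_cone_chart Omo lip bx.
  by exists (e, rho, kap).
pose e x := (ch x).1.1; pose rho x := (ch x).1.2; pose kap x := (ch x).2.
have [s [sb scov]] : exists s : seq V, (forall i, i \in s -> boundary Om i) /\
    forall b, boundary Om b -> exists2 i, i \in s & enorm (b - i) < rho i / 8.
  have := boundary_compact; rewrite compact_cover.
  move=> /(_ V (boundary Om) (fun i => [set y | enorm (y - i) < rho i / 8])) [].
  - move=> i _; apply/enorm_openP => x ux; exists (rho i / 8 - enorm (x - i)).
      by rewrite subr_gt0.
    by move=> y yx; rewrite /=; have := enorm_distD x y i; lra.
  - move=> b bb; exists b => //=; rewrite subrr enorm0.
    by have [r0 _ _ _ _] := hch b bb; rewrite divr_gt0.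
  move=> D sD cD; exists (enum_fset D); split.
    by move=> i iD; have := sD i iD; rewrite inE.
  by move=> b /cD[i iD h]; exists i.
have rho0 i : i \in s -> 0 < rho i by move=> /sb/hch[].
have kap0 i : i \in s -> 0 < kap i by move=> /sb/hch[].
have [rm rm0 hrm] := min_pos rho0.
have [km km0 hkm] := min_pos kap0.
have xm1 i : i \in s -> 0 < bumpf 0 (3 / 16 * rho i ^+ 2).
  by move=> is_; rewrite bumpf0_gt0// mulr_gt0// exprn_gt0// rho0.
have [xm xm0 hxm] := min_pos xm1.
pose chi i x := ball_bump i (rho i) x.
pose eta x : V := \sum_(i <- s) chi i x *: e i.
pose sig x := \sum_(i <- s) chi i x.
pose N : R := (size s).+1%:R.
have N0 : 0 < N by rewrite ltr0n.
have chi_ge0 i x : 0 <= chi i x by exact: ball_bump_ge0.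
(* The move along the weighted sum of axes is made one chart at a time: every partial move obeys the
   cone condition of its own chart, as long as the path remains there. The common vector b spreads a
   perturbation of the endpoint over all moves. *)
have step z b (l : seq V) : {subset l <= s} -> enorm b <= km -> enorm b <= 1 ->
   forall s0 z', 0 <= s0 -> S z' ->
   enorm (z' - z) + \sum_(i <- l) 2 * s0 <= rm / 2 ->
   S (z' + \sum_(i <- l) (s0 * chi i z) *: (e i + b)).
  move=> + bkm b1; elim: l => [_ s0 z' _ Sz' _|i l IH ls s0 z' s00 Sz'].
    by rewrite big_nil addr0.
  rewrite !big_cons => hz; rewrite addrA.
  have is_ : i \in s by apply: ls; rewrite mem_head.
  have l0 : 0 <= \sum_(j <- l) 2 * s0 by rewrite sumr_ge0// => j _; rewrite mulr_ge0.
  have [_ _ _ ei cone] := hch i (sb i is_).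
  have mv : enorm ((s0 * chi i z) *: (e i + b)) <= 2 * s0.
    rewrite enormZ ger0_norm ?mulr_ge0// mulrC ler_pM ?enorm_ge0 ?mulr_ge0//.
      by rewrite (le_trans (enormD _ _))// ei; lra.
    by rewrite ler_piMr// ball_bump_le1.
  apply: IH => //.
  - by move=> j jl; apply: ls; rewrite inE jl orbT.
  - have [->|ci] := eqVneq (chi i z) 0; first by rewrite mulr0 scale0r addr0.
    have zi := ball_bump_supp (rho0 i is_) ci.
    have ri := hrm i is_.
    apply: (cone z' _ (s0 * chi i z)) => //.
    + have := enorm_distD z z' i; lra.
    + have := enormD (z' - i) ((s0 * chi i z) *: (e i + b)).
      rewrite addrAC; have := enorm_distD z z' i; lra.
    + by rewrite mulr_ge0.
    rewrite [z' + _]addrC addrK scalerDr addrAC subrr add0r enormZ ger0_norm ?mulr_ge0//.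
    by rewrite mulrC ler_wpM2r ?mulr_ge0// (le_trans bkm)// hkm.
  - have := enorm_distD z' (z' + (s0 * chi i z) *: (e i + b)) z.
    by rewrite [z' + _]addrC addrK; lra.
pose near0 z := exists2 b, boundary Om b & enorm (z - b) < rm / 8.
have sig_le z : sig z <= N.
  rewrite /sig /N -natr1; apply: (@le_trans _ _ (\sum_(i <- s) 1)).
    by apply: ler_sum => i _; exact: ball_bump_le1.
  by rewrite big_const_seq count_predT iter_addr_0 lerDl.
(* A boundary point within rm / 8 of z lies within rho i / 8 of some centre i, so z is in the ball
   of radius rho i / 4, where the bump is bounded below. *)
have sig_ge z : near0 z -> xm <= sig z.
  move=> [b bb zb]; have [i is_ bi] := scov b bb.
  rewrite /sig (perm_big _ (perm_to_rem is_))/= big_cons.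
  apply: (@le_trans _ _ (chi i z)); last by rewrite lerDl sumr_ge0.
  apply: le_trans (hxm i is_) _; apply: ball_bump_low (rho0 i is_) _.
  have := enorm_distD b z i; have := hrm i is_; lra.
pose km' := Num.min km 1.
have km'0 : 0 < km' by rewrite lt_min km0 ltr01.
pose c1 := km' * xm; have c10 : 0 < c1 by rewrite mulr_gt0.
(* At most N moves of length at most 2 s0 stay below rm / 2 in total, so a path starting in the
   support of a bump, of radius rho i / 2, remains in that chart. *)
pose r0 := rm / (4 * N); have r00 : 0 < r0 by rewrite divr_gt0// mulr_gt0.
have cone z s0 y : near0 z -> S z -> 0 <= s0 -> s0 < r0 ->
    enorm (y - z - s0 *: eta z) <= c1 * s0 -> S y.
  move=> nz Sz s00 s0r; rewrite le_eqVlt in s00.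
  case/orP: s00 => [/eqP <-|s00].
    rewrite mulr0 scale0r subr0 => h.
    suff -> : y = z by [].
    apply/eqP; rewrite -subr_eq0; apply/eqP/enorm_eq0/eqP.
    by rewrite eq_le h enorm_ge0.
  move=> hw; set w := y - z - s0 *: eta z in hw.
  have sz0 : 0 < sig z by rewrite (lt_le_trans xm0) ?sig_ge.
  (* Chosen so that the moves add up to s0 eta z + w; it is short enough because sig z >= xm. *)
  pose b := (s0 * sig z)^-1 *: w.
  have ssz : 0 < s0 * sig z by rewrite mulr_gt0.
  have bk : enorm b <= km'.
    rewrite enormZ ger0_norm ?invr_ge0 ?(ltW ssz)// mulrC ler_pdivrMr//.
    rewrite (le_trans hw)// /c1 -mulrA ler_pM2l// mulrC ler_pM2l//; exact: sig_ge.
  have := step z b s (fun i h => h) _ _ s0 z (ltW s00) Sz.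
  have E : z + \sum_(i <- s) (s0 * chi i z) *: (e i + b) = y.
    have -> : \sum_(i <- s) (s0 * chi i z) *: (e i + b) = s0 *: eta z + w.
      under eq_bigr do rewrite scalerDr.
      rewrite big_split/= /eta scaler_sumr; congr (_ + _).
        by apply: eq_bigr => i _; rewrite scalerA.
      rewrite -scaler_suml -mulr_sumr -/(sig z) /b scalerA mulfV ?scale1r//.
      by rewrite gt_eqF.
    have E' (u1 u2 u3 : V) : u1 + (u2 + (u3 - u1 - u2)) = u3.
      by apply/rowP => i; rewrite !mxE; ring.
    exact: E'.
  rewrite E; apply.
  - by rewrite (le_trans bk)// ge_min lexx.
  - by rewrite (le_trans bk)// ge_min lexx orbT.
  rewrite subrr enorm0 add0r big_const_seq count_predT iter_addr_0.
  rewrite -[leLHS]mulr_natr; apply: (@le_trans _ _ (2 * r0 * N)).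
    by apply: ler_pM; rewrite ?mulr_ge0 ?(ltW s00)// ?ler_pM2l ?(ltW s0r)// /N ler_nat.
  by rewrite /r0 le_eqVlt; apply/orP; left; apply/eqP; field; rewrite gt_eqF.
(* If eta b were shorter than c1, the ball of radius c1 s0 around b + s0 eta b, which lies in S,
   would be a neighbourhood of b, and b would be interior. This excludes cancellation between the
   axes of overlapping charts without comparing them. *)
have low b : boundary Om b -> S b -> ~ interior S b -> c1 <= enorm (eta b).
  move=> bb Sb iSb; rewrite leNgt; apply/negP => h.
  apply: iSb; rewrite /interior; apply/enorm_nbhsP.
  exists (r0 / 2 * (c1 - enorm (eta b))); first by rewrite mulr_gt0 ?subr_gt0// divr_gt0.
  move=> y yb; apply: (cone b (r0 / 2) y) => //.
  - by exists b => //; rewrite subrr enorm0 divr_gt0.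
  - by rewrite divr_ge0// ltW.
  - lra.
  rewrite (le_trans (enorm_subD _ _))// enormZ ger0_norm ?divr_ge0 ?(ltW r00)//; lra.
have smooth n : cls (fun _ : 'I_d => [set: V]) (fun _ _ => 1) n
    (fun _ _ => 1) (fun j x => eta x ord0 j).
  have Uo (I : Type) : forall _ : I, open [set: V] by move=> _; exact: openT.
  have w0 (I : Type) : forall (_ : I) (x : V), [set: V] x -> (0 : R) <= 1 by [].
  have : cls (fun _ : 'I_d => [set: V]) (fun _ _ => 1) n (fun _ _ => 1)
     (fun j x => \sum_(i <- s) (if i \in s then chi i x * e i ord0 j else 0)).
    apply: cls_bigsum; [exact: Uo|by []|by []|move=> i].
    case: (boolP (i \in s)) => is_; last first.
      apply: (@cls_cst R d _ _ _ (Uo _) (w0 _) n _ (fun=> 0)).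
      by exists 1 => // _ x _; rewrite normr0 mulr1.
    have c1' : cls (fun _ : 'I_d => [set: V]) (fun _ _ => 1) n (fun _ _ => 1) (fun j x => chi i x).
      apply: cls_local (cls_ball_bump i n (rho0 i is_)) => j x _; exists tt.
      by split => //; exact: nearW_rV.
    have c2' : cls (fun _ : 'I_d => [set: V]) (fun _ _ => 1) n (fun _ _ => 1) (fun j x => e i ord0 j).
      apply: (@cls_cst R d _ _ _ (Uo _) (w0 _) n _ (fun j => e i ord0 j)).
      by exists (enorm (e i)) => [|j x _]; rewrite ?enorm_ge0// mulr1 coord_le_enorm.
    apply: (cls_amp (w0 _)) (cls_M (Uo _) (w0 _) c1' c2').
    by exists 1 => // j x _; rewrite !mul1r.
  apply: cls_ext; first exact: Uo.
  move=> j x _; rewrite /eta summxE big_seq [RHS]big_seq.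
  by apply: eq_bigr => i ->; rewrite mxE.
have [C C0 hC] := cls_bound (smooth 0%N).
have [C' C'0 hC'] : exists2 C' : R, 0 <= C' & forall j k x,
    `|'D_(delta_mx 0 k) (fun y => eta y ord0 j) x| <= C'.
  have /choice[Ck hk] : forall k : 'I_d, exists C', 0 <= C' /\
      forall j x, `|'D_(delta_mx 0 k) (fun y => eta y ord0 j) x| <= C'.
    move=> k; have [C' C'0 h] := cls_bound (cls_derive k (smooth 1%N)).
    by exists C'; split=> // j x; have := h j x I; rewrite !mulr1.
  exists (\sum_k Ck k); first by apply: sumr_ge0 => k _; exact: (hk k).1.
  move=> j k x; apply: le_trans ((hk k).2 j x) _.
  by rewrite (bigD1 k)//= lerDl sumr_ge0// => i _; exact: (hk i).1.
pose H := d%:R * C + 1; pose L := d%:R * (d%:R * C') + 1.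
have H0 : 0 < H by rewrite ltr_wpDl// mulr_ge0.
have L0 : 0 < L by rewrite ltr_wpDl// !mulr_ge0.
have etaH x : enorm (eta x) <= H.
  rewrite (le_trans (enorm_le_sum _))// (le_trans (_ : _ <= d%:R * C))//; last by rewrite lerDl.
  rewrite -[in leRHS](card_ord d) mulr_natl -sumr_const; apply: ler_sum => j _.
  by have := hC j x I; rewrite mulr1.
have deta j x : differentiable (fun y => eta y ord0 j) x by exact: (cls_diff (smooth 1%N)).
have etaL x y : enorm (eta x - eta y) <= L * enorm (x - y).
  rewrite (le_trans (enorm_le_sum _))//.
  rewrite (le_trans (_ : _ <= d%:R * (d%:R * C') * enorm (x - y)))//; last first.
    by rewrite ler_wpM2r ?enorm_ge0// lerDl.
  rewrite -[in X in X * _ * _](card_ord d) -mulrA mulr_natl -sumr_const; apply: ler_sum => j _.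
  have [t _ E] := @mvt_line R d (fun y => eta y ord0 j) y (x - y) (fun t _ => deta j _).
  move: E; rewrite subrK => E; rewrite !mxE -[_ + _]/(_ - _) E derive_delta//.
  rewrite (le_trans (ler_norm_sum _ _ _))// -[in X in X * _](card_ord d) -mulrA mulr_natl -sumr_const.
  apply: ler_sum => k _; rewrite -[_ *: _]/(_ * _) normrM mulrC ler_pM//.
  exact: coord_le_enorm.
(* In order: the boundary point found near z makes [near0] hold, parameters below r are admissible
   in [cone], and eta changes by at most c1 / 2 between z and that boundary point. *)
pose r := Num.min (rm / 8) (Num.min r0 (c1 / (2 * L))).
have r_gt0 : 0 < r by rewrite !lt_min r00 !divr_gt0// mulr_gt0.
have nb z x : S z -> ~ S x -> enorm (z - x) < r ->
    exists b, [/\ boundary Om b, S b, ~ interior S b & enorm (z - b) < r].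
  move=> Sz Sx zx; have [b [Sb iSb zb]] := boundary_between Sc Sz Sx.
  exists b; split => //; first exact: boundary_closure_sub.
  exact: le_lt_trans zx.
exists eta, (c1 / 2), r, H, L; split => //.
- by rewrite divr_gt0.
- move=> z x Sz Sx zx; have [b [bb Sb iSb zb]] := nb z x Sz Sx zx.
  have h1 := low b bb Sb iSb; have h2 := etaL b z; have h3 := lerB_enorm (eta b) (eta z).
  have : L * enorm (b - z) <= c1 / 2.
    rewrite enormB mulrC -ler_pdivlMr//; move: zb; rewrite !lt_min => /and3P[_ _ zb].
    apply: le_trans (ltW zb) _; rewrite le_eqVlt; apply/orP; left; apply/eqP.
    by field; rewrite gt_eqF.
  lra.
move=> z x s0 y Sz Sx zx s00 s0r h; have [b [bb Sb iSb zb]] := nb z x Sz Sx zx.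
apply: (cone z s0) => //.
- by exists b => //; move: zb; rewrite !lt_min => /and3P[].
- by move: s0r; rewrite !lt_min => /and3P[].
by rewrite (le_trans h)// ler_wpM2r//; lra.
Qed.

End Construction.
End Field.

(** * Reflection across the boundary *)

HB.instance Definition _ (R : realType) (d : nat) := Complete.on 'rV[R]_d.

Section Reflection.
Context (R : realType) (d : nat).
Local Notation V := 'rV[R]_d.
Context (S : set V) (eta : V -> V) (c r H L : R).
Hypothesis tv : transversal_field S eta c r H L.
Hypothesis Sc : closed S.
Hypothesis S0 : S !=set0.
Local Notation delta := (dist_to S).

Let c0 : 0 < c := tv_c tv.
Let r0 : 0 < r := tv_r tv.
Let H0 : 0 < H := tv_H tv.
Let L0 : 0 < L := tv_L tv.

Context (eps c1 c2 C : R) (rho : V -> R).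
Let W0 := [set x | ~ S x /\ delta x < eps].
Hypothesis eps0 : 0 < eps.
Hypothesis c10 : 0 < c1.
Hypothesis c20 : 0 < c2.
Hypothesis C0 : 0 < C.
Hypothesis rho_cls : forall n, cls (fun _ : unit => W0) (fun _ x => (delta x)^-1) n
      (fun _ x => delta x) (fun _ => rho).
Hypothesis rho_bounds : forall x, W0 x -> c1 * delta x <= rho x <= C * delta x.
Hypothesis rho_derive : forall x, W0 x -> 'D_(eta x) rho x <= - c2.

Context (C3 : R).
Hypothesis C30 : 0 < C3.
Hypothesis rho_lip : forall x v, W0 x -> `|'D_v rho x| <= C3 * enorm v.

Let rho_diff x : W0 x -> differentiable rho x.
Proof. by move=> Wx; exact: (@cls_diff _ _ _ _ _ _ _ _ tt x (rho_cls 1%N) Wx). Qed.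

(** An upper bound for displacements along eta. [T1] makes x + t eta x a contractive perturbation of
    the identity; [T2] and [T4] make the variation of eta over distances O(t0) small against the
    cone opening and against the slope c2; [T3] and [T5] keep the points in the range of [tv_cone]
    and in the collar where rho is controlled. *)
Context (t0 : R).
Hypothesis t00 : 0 < t0.
Hypothesis T1 : t0 * (2 * L * d.+1%:R) <= 1.
Hypothesis T2 : t0 * (4 * H * L) <= c.
Hypothesis T3 : t0 * (2 * H + 2 * c + 1) < r.
Hypothesis T4 : t0 * (8 * C3 * H * L) <= c2.
Hypothesis T5 : t0 * (3 * H) < eps.

Let Lt0 : t0 * L <= 1 / 2.
Proof.
have : t0 * (2 * L * 1) <= t0 * (2 * L * d.+1%:R).
  by rewrite ler_pM2l// ler_pM2l ?mulr_gt0// ler1n.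
by move=> /le_trans/(_ T1); lra.
Qed.

(** As t' L <= 1/2, the term t' (eta x - eta x') is absorbed on the left. So the solution x of x + t
    eta x = y is unique and Lipschitz in t and y. *)
Lemma shift_stable x x' y y' t t' : 0 <= t <= t0 -> 0 <= t' <= t0 ->
  x + t *: eta x = y -> x' + t' *: eta x' = y' ->
  enorm (x - x') <= 2 * enorm (y - y') + 2 * H * `|t - t'|.
Proof.
move=> /andP[ta tb] /andP[ta' tb'] <- <-.
set e := x + _ - _.
have E : x - x' = e - (t - t') *: eta x - t' *: (eta x - eta x').
  by apply/rowP => i; rewrite /e !mxE; ring.
have h1 := enorm_subD (e - (t - t') *: eta x) (t' *: (eta x - eta x')).
have h2 := enorm_subD e ((t - t') *: eta x).
have h3 : enorm ((t - t') *: eta x) <= H * `|t - t'|.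
  by rewrite enormZ mulrC ler_wpM2r// (tv_bound tv).
have h4 : enorm (t' *: (eta x - eta x')) <= 1 / 2 * enorm (x - x').
  rewrite enormZ ger0_norm//.
  apply: (@le_trans _ _ (t' * (L * enorm (x - x')))).
    by rewrite ler_wpM2l// (tv_lip tv).
  rewrite mulrA ler_wpM2r ?enorm_ge0// (le_trans _ Lt0)// ler_pM2r//.
by rewrite -E in h1; lra.
Qed.

(** The fixed point is found in the sup norm of row vectors; comparing it with the Euclidean norm
    costs the dimension factor in [T1]. *)
Lemma shift_solvable t y : 0 <= t <= t0 -> exists x, x + t *: eta x = y.
Proof.
move=> /andP[ta tb].
have fT : forall x : V, [set: V] x -> [set: V] (y - t *: eta x) by [].
have ctr : is_contraction (mkfun fT).
  exists (1 / 2)%:nng; split=> /=; first by lra.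
  move=> [x x'] _ /=; rewrite opprD addrACA subrr add0r opprK addrC -scalerBr.
  rewrite normrZ ger0_norm//.
  apply: (@le_trans _ _ (t * (L * (d%:R * `|x - x'|)))).
    rewrite ler_wpM2l// (le_trans (norm_le_enorm _))// enormB.
    rewrite (le_trans (tv_lip tv _ _))// ler_wpM2l ?(ltW L0)//.
    exact: enorm_le_norm.
  rewrite !mulrA ler_wpM2r//.
  apply: (@le_trans _ _ (t0 * L * d.+1%:R)).
    by rewrite ler_pM ?mulr_ge0 ?(ltW L0)// ?ler_pM2r// ler_nat.
  by move: T1; move: (d.+1%:R) => N; lra.
have [x _ /= E] := banach_fixed_point ctr closedT (ex_intro _ (0 : V) I).
by exists x; rewrite {1}E subrK.
Qed.

Lemma field_low x : ~ S x -> 2 * delta x < r -> 2 * (L * delta x) <= c / 2 ->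
  c / 2 <= enorm (eta x).
Proof.
move=> Sx dr dL; have [y Sy xy] := dist_to_adh2 S0 Sc Sx.
have yr : enorm (y - x) < r by rewrite enormB (lt_trans xy).
have := tv_low tv Sy Sx yr; have := tv_lip tv y x; have := lerB_enorm (eta y) (eta x).
have : L * enorm (y - x) <= L * (2 * delta x) by rewrite ler_pM2l// enormB ltW.
lra.
Qed.

(** The segment from x1 to x2 runs nearly along - eta. None of its points lies in S, since x1 would
    belong to the cone at such a point. Hence it stays in the collar, and the mean value theorem
    with D_eta rho <= - c2 gives the growth, half of c2 being spent on the deviation of the
    direction from eta. *)
Lemma shift_monotone y t1 t2 x1 x2 : S y -> 0 <= t1 -> t1 < t2 -> t2 <= t0 ->
  x1 + t1 *: eta x1 = y -> x2 + t2 *: eta x2 = y -> ~ S x1 ->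
  ~ S x2 /\ c2 / 2 * (t2 - t1) <= rho x2 - rho x1.
Proof.
move=> Sy t10 t12 t2t0 E1 E2 Sx1.
have t20 : 0 <= t2 by lra.
set h := t2 - t1; have h0 : 0 < h by rewrite subr_gt0.
have ht0 : h <= t0 by rewrite /h; lra.
have D12 : enorm (x1 - x2) <= 2 * H * h.
  have := @shift_stable x1 x2 y y t1 t2 _ _ E1 E2.
  rewrite subrr enorm0 mulr0 add0r distrC gtr0_norm//; apply; apply/andP; split => //; lra.
pose p : V := h^-1 *: (x1 - x2).
have pE : h *: p = x1 - x2 by rewrite scalerA mulfV ?scale1r// gt_eqF.
have pe : enorm (p - eta x1) <= 2 * H * (L * t0).
  rewrite -(ler_pM2l h0) -[X in X * enorm _ <= _]gtr0_norm// -enormZ scalerBr pE.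
  have -> : x1 - x2 - h *: eta x1 = t2 *: (eta x2 - eta x1).
    have gen (u1 u2 u3 u4 : V) : u1 + u3 = u2 + u4 -> u1 - u2 = u4 - u3.
      by move=> h'; apply/eqP; rewrite subr_eq addrAC eq_sym subr_eq h' addrC.
    rewrite (gen _ _ (t1 *: eta x1) (t2 *: eta x2)); last by rewrite E1 E2.
    by apply/rowP => i; rewrite !mxE /h; ring.
  rewrite enormZ ger0_norm//.
  apply: (@le_trans _ _ (t0 * (L * (2 * H * h)))); last by lra.
  apply: ler_pM => //; first exact: enorm_ge0.
  by rewrite (le_trans (tv_lip tv _ _))// ler_pM2l// enormB.
pose z (s : R) : V := s *: (- p) + x1.
have zx s : 0 <= s -> enorm (z s - x1) <= 2 * H * s.
  move=> s0; rewrite /z addrK enormZ enormN ger0_norm// mulrC ler_wpM2r//.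
  by rewrite -(ler_pM2l h0) -[X in X * enorm _ <= _]gtr0_norm// -enormZ pE mulrC.
have zh : z h = x2 by rewrite /z scalerN pE opprB subrK.
have z_near s : 0 <= s -> s <= h -> 2 * H * s <= 2 * H * t0.
  by move=> s0 sh; rewrite ler_pM2l ?mulr_gt0//; lra.
have pez s : 0 <= s -> s <= h -> enorm (p - eta (z s)) <= 4 * H * L * t0.
  move=> s0 sh; rewrite (le_trans (enorm_distD (eta x1) _ _))//.
  have l1 := tv_lip tv x1 (z s).
  have l2 : L * enorm (x1 - z s) <= L * (2 * H * t0).
    by rewrite ler_pM2l// enormB (le_trans (zx s s0))// z_near.
  lra.
have Sz s : 0 <= s -> s <= h -> ~ S (z s).
  move=> s0 sh Sz; apply: (Sx1).
  have zr := zx s s0; have zn := z_near s s0 sh.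
  have Ht : 0 < t0 * (2 * c) by rewrite !mulr_gt0.
  apply: (tv_cone tv (z := z s) (x := x1) (s := s)) => //.
  - by move: zr zn Ht T3 t00; move: (enorm _) => e'; lra.
  - have tH : 0 < t0 * H by rewrite mulr_gt0.
    by move: (le_trans sh ht0) tH Ht T3; lra.
  have -> : x1 - z s - s *: eta (z s) = s *: (p - eta (z s)).
    by rewrite /z scalerN scalerBr opprD opprK addrCA subrr addr0.
  rewrite enormZ ger0_norm// mulrC ler_wpM2r//.
  by rewrite (le_trans (pez s s0 sh))//; move: T2; lra.
have dx1 : delta x1 <= H * t0.
  rewrite (le_trans (dist_to_le S0 x1 Sy))// -E1 opprD addrA subrr add0r enormN enormZ.
  by rewrite ger0_norm// mulrC ler_pM ?enorm_ge0// ?(tv_bound tv)//; lra.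
have Wz s : 0 <= s -> s <= h -> W0 (z s).
  move=> s0 sh; split; first exact: Sz.
  have := dist_to_lip S0 (z s) x1; have := zx s s0; have := z_near s s0 sh.
  move: T5 dx1; lra.
split; first by rewrite -zh; apply: Sz => //; exact: ltW.
have [t t01 E] := @mvt_line R d rho x1 (h *: (- p)) (fun t t01 => ltac:(
   rewrite scalerA; apply: rho_diff; case/andP: t01 => ta tb; apply: Wz;
   [by rewrite mulr_ge0// ltW | by rewrite ler_piMl// ltW])).
move: E; rewrite -/(z h) zh => ->; case/andP: t01 => ta tb.
rewrite scalerA -/(z _); set s := t * h.
have s0 : 0 <= s by rewrite mulr_ge0// ltW.
have sh : s <= h by rewrite ler_piMl// ltW.
have Ws := Wz s s0 sh; have dr := rho_diff Ws.
have lin a v1 v2 : 'D_(a *: (v1 - v2)) rho (z s) = a * ('D_v1 rho (z s) - 'D_v2 rho (z s)).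
  by rewrite !deriveE// linearZ linearB.
have -> : h *: (- p) = (- h) *: ((p - eta (z s)) - (- eta (z s))).
  by rewrite opprK subrK scalerN scaleNr.
rewrite lin.
have -> : 'D_(- eta (z s)) rho (z s) = - 'D_(eta (z s)) rho (z s).
  by rewrite !deriveE// linearN.
have := rho_derive Ws; have := rho_lip (p - eta (z s)) Ws; rewrite ler_norml => /andP[_ h1] h2.
have h3 : C3 * enorm (p - eta (z s)) <= C3 * (4 * H * L * t0).
  by rewrite ler_pM2l// pez.
rewrite mulrC mulNr -mulrN ler_pM2l//; move: T4; lra.
Qed.

(** For the displacement tau = s K rho, [K1] gives c tau >= 8 delta, enough to cross the boundary,
    and [K2] makes tau grow at rate at least 2 in the path parameter. The bounds on [eps1] keep tau
    below t0 and a nearly closest point of S within reach of the cone condition. *)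
Context (K eps1 : R).
Hypothesis K1 : 4 <= K * c1 * c.
Hypothesis K2 : 2 <= K * c2.
Hypothesis eps10 : 0 < eps1.
Hypothesis E1 : 3 * K * C * eps1 < t0.
Hypothesis E2 : 4 * L * eps1 <= c.
Hypothesis E3 : 2 * eps1 < r.
Hypothesis E4 : eps1 <= eps.

Let W := [set x | ~ S x /\ delta x < eps1].
Definition refl_field x : V := (K * rho x) *: eta x.
Definition refl (s : R) x : V := x + s *: refl_field x.
Let tau s x := s * (K * rho x).

Let K0 : 0 < K.
Proof. by rewrite -(pmulr_lgt0 _ c20); move: K2; lra. Qed.

Lemma reflE s x : refl s x = x + tau s x *: eta x.
Proof. by rewrite /refl /refl_field scalerA. Qed.

Let W_W0 x : W x -> W0 x.
Proof. by move=> [Sx dx]; split=> //; exact: lt_le_trans E4. Qed.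

Let delta_gt0 x : ~ S x -> 0 < delta x.
Proof. exact: dist_to_gt0. Qed.

Let rho_gt0 x : W0 x -> 0 < rho x.
Proof.
move=> Wx; have [Sx _] := Wx; have /andP[h _] := rho_bounds Wx.
by apply: lt_le_trans h; rewrite mulr_gt0// delta_gt0.
Qed.

Lemma tau_bounds s x : 2 <= s <= 3 -> W x ->
  [/\ 0 < tau s x, tau s x < t0 & 8 * delta x <= c * tau s x].
Proof.
move=> /andP[s2 s3] Wx; have [Sx dx] := Wx; have dx0 := delta_gt0 Sx.
have rx := rho_gt0 (W_W0 Wx); have /andP[r1 r2] := rho_bounds (W_W0 Wx).
have s0 : 0 < s by lra.
split; first by rewrite /tau !mulr_gt0.
  apply: le_lt_trans E1; rewrite /tau -!mulrA; apply: ler_pM => //; first exact: ltW.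
    by rewrite mulr_ge0 // ltW.
  by rewrite ler_pM2l// (le_trans r2)// ler_pM2l// ltW.
apply: (@le_trans _ _ (c * (2 * (K * (c1 * delta x))))).
  have : 4 * delta x <= K * c1 * c * delta x by rewrite ler_pM2r.
  lra.
rewrite ler_pM2l// /tau; apply: ler_pM => //.
  by rewrite !mulr_ge0 ?(ltW K0) ?(ltW c10) ?(ltW dx0).
by rewrite ler_pM2l.
Qed.

(** Take y in S with |x - y| < 2 delta x. Of the radius c tau of the cone at y, at most c tau / 4 is
    spent on |x - y| and c tau / 2 on the variation of eta; the last quarter is the radius of a ball
    around the image inside S. *)
Lemma refl_interior s x : 2 <= s <= 3 -> W x -> interior S (refl s x).
Proof.
move=> s23 Wx; have [tau0 tau1 tau2] := tau_bounds s23 Wx.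
have [Sx dx] := Wx; have dx0 := delta_gt0 Sx.
have [y Sy xy] := dist_to_adh2 S0 Sc Sx.
have yr : enorm (y - x) < r by rewrite enormB (lt_trans xy)//; move: E3; lra.
rewrite /interior reflE; set t := tau s x in tau0 tau1 tau2 *; apply/enorm_nbhsP.
exists (c * t / 4); first by rewrite divr_gt0// mulr_gt0.
move=> z hz; apply: (tv_cone tv Sy Sx yr (ltW tau0)).
  have : 0 < t0 * H by rewrite mulr_gt0.
  have : 0 < t0 * c by rewrite mulr_gt0.
  by move: T3 tau1; lra.
have -> : z - y - t *: eta y = (z - (x + t *: eta x)) + (x - y) + t *: (eta x - eta y).
  by apply/rowP => i; rewrite !mxE; ring.
have h1 := enormD (z - (x + t *: eta x) + (x - y)) (t *: (eta x - eta y)).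
have h2 := enormD (z - (x + t *: eta x)) (x - y).
have h3 : enorm (t *: (eta x - eta y)) <= t * (c / 2).
  rewrite enormZ gtr0_norm// ler_pM2l// (le_trans (tv_lip tv _ _))//.
  apply: (@le_trans _ _ (L * (2 * eps1))); last by move: E2; lra.
  by rewrite ler_pM2l// (le_trans (ltW xy))// ler_pM2l// ltW.
move: h1 h2 h3 hz xy tau2; lra.
Qed.

Let in_t0 s x : 2 <= s <= 3 -> W x -> 0 <= tau s x <= t0.
Proof. by move=> s23 Wx; have [/ltW -> /ltW ->] := tau_bounds s23 Wx. Qed.

(* The solutions x of [refl s x = y] correspond to the zeros of the excess
   s K rho (x t) - t along the path x t + t * eta (x t) = y, so monotonicity
   yields injectivity, and the intermediate value theorem surjectivity. *)
Let excess_increasing s y t1 t2 x1 x2 : 2 <= s <= 3 -> S y ->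
  0 <= t1 -> t1 < t2 -> t2 <= t0 ->
  x1 + t1 *: eta x1 = y -> x2 + t2 *: eta x2 = y -> ~ S x1 ->
  tau s x1 - t1 + (t2 - t1) <= tau s x2 - t2.
Proof.
move=> /andP[s2 s3] Sy t10 t12 t2t0 e1 e2 Sx1.
have [_ h] := shift_monotone Sy t10 t12 t2t0 e1 e2 Sx1.
have h12 : 0 < t2 - t1 by rewrite subr_gt0.
have h1 : s * (K * (c2 / 2 * (t2 - t1))) <= s * (K * (rho x2 - rho x1)).
  by rewrite !ler_pM2l//; lra.
have h2 : 2 * (t2 - t1) <= s * (K * (c2 / 2 * (t2 - t1))).
  rewrite !mulrA ler_pM2r//; apply: (@le_trans _ _ (2 * (K * c2) / 2)).
    by move: K2; lra.
  rewrite -[X in _ <= X / 2]mulrA ler_pM2r// ler_pM2r//.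
  by rewrite mulr_gt0.
rewrite /tau; lra.
Qed.

Lemma refl_inj s x x' : 2 <= s <= 3 -> W x -> W x' -> refl s x = refl s x' -> x = x'.
Proof.
move=> s23 Wx Wx'; rewrite !reflE => e.
have Sy : S (x + tau s x *: eta x).
  by apply: interior_subset; rewrite -reflE; exact: refl_interior.
have /andP[tx tx'] := in_t0 s23 Wx; have /andP[ux ux'] := in_t0 s23 Wx'.
have [lt_t|lt_t|eq_t] := ltgtP (tau s x) (tau s x').
- have [Sx _] := Wx.
  have h := @excess_increasing s _ _ _ x x' s23 Sy tx lt_t ux' erefl (esym e) Sx.
  by exfalso; lra.
- have [Sx' _] := Wx'.
  have h := @excess_increasing s _ _ _ x' x s23 Sy ux lt_t tx' (esym e) erefl Sx'.
  by exfalso; lra.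
have := @shift_stable x x' (x + tau s x *: eta x) (x + tau s x *: eta x) _ _
  (in_t0 s23 Wx) (in_t0 s23 Wx') erefl (esym e).
rewrite eq_t subrr enorm0 subrr normr0 !mulr0 addr0 => h.
apply/eqP; rewrite -subr_eq0; apply/eqP/enorm_eq0/eqP.
by rewrite eq_le h enorm_ge0.
Qed.

(** The value 0 is the continuous one, as rho <= C delta. While the path is in S the excess is then
    - t, which supplies the negative sign for the intermediate value theorem and forces positive
    roots to lie outside S. *)
Definition rho_ext x : R := if `[< S x >] then 0 else rho x.

Lemma rho_ext_continuous x : delta x < eps -> {for x, continuous rho_ext}.
Proof.
move=> dx; have [Sx|Sx] := pselect (S x).
  apply: (@enorm_continuous _ _ _ _ C (eps - delta x)); first by rewrite subr_gt0.
  move=> y yx; rewrite {2}/rho_ext asboolT// subr0 /rho_ext; case: asboolP => Sy.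
    by rewrite normr0 mulr_ge0 ?enorm_ge0 ?(ltW C0).
  have dy : delta y < eps by have := dist_to_lip S0 y x; lra.
  have Wy : W0 y by [].
  have /andP[_ h] := rho_bounds Wy.
  rewrite gtr0_norm ?rho_gt0// (le_trans h)// ler_pM2l//.
  exact: dist_to_le.
have Wx : W0 x by [].
have [e e0 he] := closed_outP Sc Sx.
have ne : \forall y \near x, rho y = rho_ext y.
  apply/enorm_nbhsP; exists e => // y ye; rewrite /rho_ext asboolF//.
  by move=> /he; rewrite leNgt ye.
exact: differentiable_continuous (near_eq_differentiable ne (rho_diff Wx)).
Qed.

(** Retraction onto the interval where the path is defined, so that the excess becomes continuous on
    the whole line. *)
Let clamp (u : R) := Num.max 0 (Num.min u t0).

Let clamp_in u : 0 <= clamp u <= t0.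
Proof. by rewrite /clamp le_max lexx/= ge_max ge_min lexx orbT (ltW t00). Qed.

Let clamp_id u : 0 <= u <= t0 -> clamp u = u.
Proof. by move=> /andP[h1 h2]; rewrite /clamp min_l// max_r. Qed.

Let clamp_lip (u v : R) : `|clamp u - clamp v| <= `|u - v|.
Proof.
wlog uv : u v / u <= v.
  by move=> hw; case/orP: (le_total u v) => [/hw//|/hw]; rewrite distrC (distrC v).
rewrite [leRHS]distrC [leLHS]distrC (ger0_norm (_ : 0 <= v - u)) ?subr_ge0//.
rewrite /clamp; rewrite /Num.max /Num.min; do !case: ifP; move=> *;
  rewrite ?subrr ?normr0; rewrite ?subr_ge0 ?ger0_norm; lra.
Qed.

Section Path.
Variable X : R -> V -> V.
Hypothesis XE : forall t y, 0 <= t <= t0 -> X t y + t *: eta (X t y) = y.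

Lemma path_dist t y : S y -> 0 <= t <= t0 -> delta (X t y) <= H * t.
Proof.
move=> Sy tt; have /andP[t1 t2] := tt.
rewrite (le_trans (dist_to_le S0 (X t y) Sy))// -{2}(XE y tt) opprD addrA subrr add0r.
by rewrite enormN enormZ ger0_norm// mulrC ler_wpM2r// (tv_bound tv).
Qed.

Lemma path_eps t y : S y -> 0 <= t <= t0 -> delta (X t y) < eps.
Proof.
move=> Sy tt; rewrite (le_lt_trans (path_dist Sy tt))//; have /andP[t1 t2] := tt.
have : H * t <= H * t0 by rewrite ler_pM2l.
have : 0 < t0 * H by rewrite mulr_gt0.
by move: T5; lra.
Qed.

Let excess s y t := s * (K * rho_ext (X t y)) - t.

Lemma excess_root s y ta tb : S y -> 0 <= ta -> ta <= tb -> tb <= t0 ->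
  excess s y ta <= 0 -> 0 <= excess s y tb ->
  exists t, [/\ ta <= t, t <= tb & excess s y t = 0].
Proof.
move=> Sy ta0 tab tbt0 fa fb.
pose f (u : R) := s * (K * rho_ext (X (clamp u) y)) - clamp u.
have f_excess u : ta <= u <= tb -> f u = excess s y u.
  by move=> /andP[h1 h2]; rewrite /f clamp_id//; apply/andP; split; lra.
have cc : continuous (clamp : R -> R).
  move=> u; apply/cvgrPdist_lt => e e0; apply/nbhs_ballP; exists e => // v h.
  exact: le_lt_trans (clamp_lip _ _) h.
have cX : continuous (fun u : R => X (clamp u) y).
  move=> u A /enorm_nbhsP[e e0 he].
  apply/nbhs_ballP; exists (e / (2 * H)) => /=; first by rewrite divr_gt0// mulr_gt0.
  move=> v uv; have {}uv : `|u - v| < e / (2 * H) by exact: uv.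
  move: uv; rewrite ltr_pdivlMr ?mulr_gt0// => uv; apply: he.
  rewrite (le_lt_trans _ uv)// mulrC.
  have := shift_stable (clamp_in v) (clamp_in u) (XE y (clamp_in v)) (XE y (clamp_in u)).
  rewrite subrr enorm0 mulr0 add0r => h; apply: le_trans h _.
  by rewrite ler_pM2l ?mulr_gt0// distrC (le_trans (clamp_lip _ _))// distrC.
have cf : continuous f.
  move=> u; apply: cvgB; last exact: cc.
  apply: cvgMr; apply: cvgMr.
  apply: (@continuous_comp _ _ _ (fun u => X (clamp u) y) rho_ext); first exact: cX.
  exact/rho_ext_continuous/path_eps.
have cfw : {within `[ta, tb], continuous f} by exact: continuous_subspaceT.
have v0 : Num.min (f ta) (f tb) <= 0 <= Num.max (f ta) (f tb).
  by rewrite ge_min le_max !f_excess ?lexx ?tab ?fa ?fb ?orbT.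
have [u uab fu] := IVT tab cfw v0.
move: uab; rewrite in_itv/= => uab; exists u; rewrite -f_excess//.
by case/andP: uab.
Qed.

Lemma root_refl s y t : 2 <= s <= 3 -> S y -> 0 < t -> t <= t0 -> excess s y t = 0 ->
  delta (X t y) < eps1 -> W (X t y) /\ refl s (X t y) = y.
Proof.
move=> s23 Sy tgt0 tt0; rewrite /excess /rho_ext; case: asboolP => Sx.
  by rewrite !mulr0 sub0r => h; move: tgt0; rewrite -oppr_lt0 h ltxx.
move=> /eqP; rewrite subr_eq0 => /eqP e dx; split => //.
by rewrite reflE /tau e XE// ltW.
Qed.

Let excess_cont s y0 t e : S y0 -> 0 <= t <= t0 -> 0 < e ->
  exists2 e', 0 < e' & forall y, enorm (y - y0) < e' ->
    `|excess s y0 t - excess s y t| < e.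
Proof.
move=> Sy0 tt e0; have := rho_ext_continuous (path_eps Sy0 tt).
pose M := `|s * K| + 1; have M0 : 0 < M by rewrite ltr_wpDl.
move=> /(@cvgrPdist_lt R R V (nbhs _) (nbhs_filter _)) /(_ (e / M) (divr_gt0 e0 M0)).
move=> /enorm_nbhsP[a a0 ha]; exists (a / 2); first by rewrite divr_gt0.
move=> y yy; have /ha : enorm (X t y - X t y0) < a.
  apply: le_lt_trans (shift_stable tt tt (XE y tt) (XE y0 tt)) _.
  rewrite subrr normr0 mulr0 addr0; lra.
rewrite ltr_pdivlMr// => h; apply: le_lt_trans h.
rewrite /excess (_ : _ - _ = (s * K) * (rho_ext (X t y0) - rho_ext (X t y))); last by ring.
by rewrite normrM mulrC ler_wpM2l// lerDl.
Qed.

(** In place of the inverse function theorem: at y0 the excess is negative at tt - h and positive at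
    tt + h, these signs persist for nearby y, and a root remains in between. The control of |x - x0|
    yields continuity of the inverse as well as openness. *)
Lemma refl_open s x0 e : 2 <= s <= 3 -> W x0 -> 0 < e ->
  exists2 e', 0 < e' & forall y, enorm (y - refl s x0) < e' ->
    exists x, [/\ W x, enorm (x - x0) < e & refl s x = y].
Proof.
move=> s23 Wx0 e_gt0; set y0 := refl s x0.
have iy0 : interior S y0 by exact: refl_interior.
have Sy0 : S y0 by exact: interior_subset.
have [Sx0 dx0] := Wx0.
have [tt0 ttt0 _] := tau_bounds s23 Wx0; set tt := tau s x0 in tt0 ttt0.
have ttI : 0 <= tt <= t0 by rewrite !ltW.
have x0E : x0 + tt *: eta x0 = y0 by rewrite /y0 reflE.
pose e1 := Num.min e (eps1 - delta x0).
have e10 : 0 < e1 by rewrite lt_min e_gt0 subr_gt0.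
pose h := Num.min (tt / 2) (Num.min (t0 - tt) (e1 / (8 * H))).
have h0 : 0 < h by rewrite !lt_min divr_gt0//= subr_gt0 ttt0/= divr_gt0// mulr_gt0.
have [h1 h2 h3] : [/\ h <= tt / 2, h <= t0 - tt & h <= e1 / (8 * H)].
  by split; rewrite /h !ge_min lexx ?orbT.
have ta0 : 0 < tt - h by lra.
have taI : 0 <= tt - h <= t0 by apply/andP; split; lra.
have tbI : 0 <= tt + h <= t0 by apply/andP; split; lra.
have fb : h <= excess s y0 (tt + h).
  have t12 : tt < tt + h by lra.
  have tb : tt + h <= t0 by lra.
  have [Sb _] := shift_monotone Sy0 (ltW tt0) t12 tb x0E (XE y0 tbI) Sx0.
  have := excess_increasing s23 Sy0 (ltW tt0) t12 tb x0E (XE y0 tbI) Sx0.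
  rewrite /excess /rho_ext asboolF// -/(tau s (X (tt + h) y0)) -/tt; lra.
have fa : excess s y0 (tt - h) < 0.
  rewrite /excess /rho_ext; case: asboolP => Sa; first by rewrite !mulr0; lra.
  have t12 : tt - h < tt by lra.
  have := excess_increasing s23 Sy0 (ltW ta0) t12 (ltW ttt0) (XE y0 taI) x0E Sa.
  rewrite -/tt -/(tau s (X (tt - h) y0)); lra.
have nfa : 0 < - excess s y0 (tt - h) by lra.
have [ea ea0 hea] := excess_cont s Sy0 taI nfa.
have [eb eb0 heb] := excess_cont s Sy0 tbI h0.
have [ec ec0 hec] : exists2 ec, 0 < ec & forall y, enorm (y - y0) < ec -> S y.
  by move: iy0; rewrite /interior => /enorm_nbhsP.
exists (Num.min (Num.min ea eb) (Num.min ec (e1 / 4))).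
  by rewrite !lt_min ea0 eb0 ec0 divr_gt0.
move=> y; rewrite !lt_min => /andP[/andP[/hea ya /heb yb] /andP[/hec Sy ye]].
have fay : excess s y (tt - h) <= 0.
  by have := lerNnormlW (ltW ya); lra.
have fby : 0 <= excess s y (tt + h).
  by have := le_trans (ler_norm _) (ltW yb); lra.
have tab : tt - h <= tt + h by lra.
have [t [t1 t2 ft]] := excess_root Sy (ltW ta0) tab ltac:(lra) fay fby.
have tI : 0 <= t <= t0 by apply/andP; split; lra.
have dX : enorm (X t y - x0) < e1.
  apply: le_lt_trans (shift_stable tI ttI (XE y tI) x0E) _.
  have : `|t - tt| <= h by rewrite ler_norml; apply/andP; split; lra.
  rewrite -(ler_pM2l H0); have : H * h <= e1 / 8.
    rewrite (le_trans (_ : _ <= H * (e1 / (8 * H))))//; first by rewrite ler_pM2l.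
    by rewrite le_eqVlt; apply/orP; left; apply/eqP; field; rewrite gt_eqF.
  lra.
have [dX1 dX2] : enorm (X t y - x0) < e /\ enorm (X t y - x0) < eps1 - delta x0.
  by move: dX; rewrite lt_min => /andP.
have tp : 0 < t by lra.
have tle : t <= t0 by lra.
have dxt : delta (X t y) < eps1 by have := dist_to_lip S0 (X t y) x0; lra.
have [WX rE] := root_refl s23 Sy tp tle ft dxt.
by exists (X t y).
Qed.

(** A point b outside S at distance D pulls the path out of S by the time t1 = 4 D / c, where the
    excess is nonnegative; for small t the path is still in S, as y is interior. A root lies in
    between. *)
Lemma refl_onto s : 2 <= s <= 3 -> exists2 r2, 0 < r2 & forall y b,
  interior S y -> ~ S b -> enorm (y - b) < r2 -> exists2 x, W x & refl s x = y.
Proof.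
move=> s23; have /andP[s2 s3] := s23.
exists (Num.min (c * t0 / 4) (c * eps1 / (4 * H))).
  by rewrite lt_min !divr_gt0 ?mulr_gt0.
move=> y b iy Sb; rewrite lt_min => /andP[D1 D2]; set D := enorm (y - b) in D1 D2.
have Sy : S y by exact: interior_subset.
have D0 : 0 < D.
  rewrite lt_neqAle enorm_ge0 andbT; apply/eqP => /esym/enorm_eq0/eqP.
  by rewrite subr_eq0 => /eqP E; apply: Sb; rewrite -E.
pose t1 := 4 * D / c.
have t10 : 0 < t1 by rewrite divr_gt0// mulr_gt0.
have ct1 : c * t1 = 4 * D by rewrite /t1; field; rewrite gt_eqF.
have t1t0 : t1 < t0 by rewrite -(ltr_pM2l c0) ct1; lra.
have Ht1 : H * t1 < eps1.
  move: D2; rewrite ltr_pdivlMr ?mulr_gt0// => D2.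
  rewrite -(ltr_pM2l c0) mulrCA ct1; lra.
have t1I : 0 <= t1 <= t0 by rewrite !ltW.
set x1 := X t1 y; have x1E : x1 + t1 *: eta x1 = y := XE y t1I.
have Hx1 : enorm (x1 - y) <= H * t1.
  rewrite -x1E opprD addrA subrr add0r enormN enormZ gtr0_norm// mulrC.
  by rewrite ler_wpM2r ?(ltW t10)// (tv_bound tv).
(* If z in S were closer, the distances c t1/4 from b to y, c t1/2 from x1 to z and c t1/4 for the
   change of eta would place b in the cone at z, hence in S. *)
have far z : S z -> c * t1 / 2 <= enorm (x1 - z).
  move=> Sz; rewrite leNgt; apply/negP => zx; apply: (Sb).
  have tH : 0 < t0 * H by rewrite mulr_gt0.
  have tc : 0 < t0 * c by rewrite mulr_gt0.
  have ctt : c * t1 < t0 * c by rewrite mulrC ltr_pM2r.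
  have zb : enorm (z - b) < r.
    have i1 := enorm_distD x1 z b; have i2 := enorm_distD y x1 b.
    have i3 : H * t1 < t0 * H by rewrite mulrC ltr_pM2r.
    rewrite -/D (enormB z x1) in i1 i2.
    by move: T3 ct1; lra.
  apply: (tv_cone tv Sz Sb zb (ltW t10)); first by move: T3; lra.
  have -> : b - z - t1 *: eta z = (b - y) + (x1 - z) + t1 *: (eta x1 - eta z).
    by rewrite -{1}x1E; apply/rowP => i; rewrite !mxE; ring.
  have i1 := enormD (b - y + (x1 - z)) (t1 *: (eta x1 - eta z)).
  have i2 := enormD (b - y) (x1 - z).
  have i3 : enorm (t1 *: (eta x1 - eta z)) <= c * t1 / 4.
    rewrite enormZ gtr0_norm//.
    apply: (@le_trans _ _ (t1 * (L * (c * t1 / 2)))).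
      by rewrite ler_pM2l// (le_trans (tv_lip tv _ _))// ler_pM2l// ltW.
    have : t1 * L <= 1 / 2 by rewrite (le_trans _ Lt0)// ler_pM2r// ltW.
    rewrite -(ler_pM2r (_ : 0 < c * t1 / 2)); last by rewrite divr_gt0// mulr_gt0.
    lra.
  rewrite (enormB b y) -/D in i1 i2; lra.
have Sx1 : ~ S x1.
  move=> /far; rewrite subrr enorm0; lra.
have dx1 : c * t1 / 2 <= delta x1 by apply: dist_to_ge.
have Wx1 : W0 x1 by split=> //; exact: path_eps.
have fb : 0 <= excess s y t1.
  rewrite /excess /rho_ext -/x1 asboolF// subr_ge0.
  have /andP[rl _] := rho_bounds Wx1.
  apply: (@le_trans _ _ (2 * (K * (c1 * (c * t1 / 2))))).
    have : 4 * t1 <= K * c1 * c * t1 by rewrite ler_pM2r.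
    lra.
  have ct0 : 0 < c * t1 / 2 by rewrite divr_gt0// mulr_gt0.
  have p0 : 0 < K * (c1 * (c * t1 / 2)) by apply: mulr_gt0 => //; apply: mulr_gt0.
  apply: ler_pM => //; first exact: ltW.
  by rewrite ler_pM2l// (le_trans _ rl)// ler_pM2l//.
have [ec ec0 hec] : exists2 ec, 0 < ec & forall z, enorm (z - y) < ec -> S z.
  by move: iy; rewrite /interior => /enorm_nbhsP.
pose ta := Num.min t1 (ec / (2 * H)).
have ta0 : 0 < ta by rewrite lt_min t10 divr_gt0// mulr_gt0.
have tat1 : ta <= t1 by rewrite ge_min lexx.
have taI : 0 <= ta <= t0 by apply/andP; split; lra.
have fa : excess s y ta <= 0.
  rewrite /excess /rho_ext asboolT; first by rewrite !mulr0; lra.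
  apply: hec; rewrite -{2}(XE y taI) opprD addrA subrr add0r enormN enormZ gtr0_norm//.
  apply: (@le_lt_trans _ _ (ec / (2 * H) * H)).
    by apply: ler_pM; rewrite ?enorm_ge0 ?(ltW ta0)// ?(tv_bound tv)// ge_min lexx orbT.
  rewrite [ltLHS](_ : _ = ec / 2); last by field; rewrite gt_eqF.
  lra.
have [t [tt1 tt2 ft]] := excess_root Sy (ltW ta0) tat1 (ltW t1t0) fa fb.
have tI : 0 <= t <= t0 by apply/andP; split; lra.
have tp : 0 < t by lra.
have tle : t <= t0 by lra.
have dxt : delta (X t y) < eps1.
  by rewrite (le_lt_trans (path_dist Sy tI))// (le_lt_trans _ Ht1)// ler_pM2l.
have [WX rE] := root_refl s23 Sy tp tle ft dxt.
by exists (X t y).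
Qed.

End Path.

End Reflection.

(** * Smooth inverses *)

Section SmoothFunctions.
Context (R : realType) (d : nat).
Local Notation V := 'rV[R]_d.
Implicit Types (U : set V) (f g : V -> R).

(** The qualitative counterpart of [cls] for a single function, without bounds. *)
Fixpoint ck n U f : Prop :=
  if n is n'.+1 then
    (forall x, U x -> differentiable f x) /\
    (forall j, ck n' U ('D_(delta_mx 0 j) f))
  else True.

Lemma cls_ck (I : Type) (U : I -> set V) w n (g f : I -> V -> R) i : cls U w n g f -> ck n (U i) (f i).
Proof.
elim: n g f => //= n IH g f [_ [df Df]]; split; first exact: df.
by move=> j; exact: IH (Df j).
Qed.

Lemma ck_pred n U f : ck n.+1 U f -> ck n U f.
Proof.
elim: n f => // n IH f [df Df]; split=> // j; exact/IH/Df.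
Qed.

Section Open.
Context (U : set V).
Hypothesis Uo : open U.

Lemma ck_ext n f g : (forall x, U x -> f x = g x) -> ck n U f -> ck n U g.
Proof.
elim: n f g => // n IH f g fg [df Df].
have nfg x : U x -> \forall y \near x, f y = g y.
  by move=> Ux; have := open_nbhs_nbhs (conj Uo Ux); apply: filterS => y /fg.
split=> [x Ux|j]; first exact: near_eq_differentiable (nfg x Ux) (df x Ux).
by apply: IH (Df j) => x Ux; exact: near_eq_derive (nfg x Ux).
Qed.

Lemma ck_cst n c : ck n U (fun=> c).
Proof.
elim: n c => // n IH c; split=> [x _|j]; first exact: differentiable_cst.
by apply: ck_ext (IH 0) => x _; rewrite [RHS]derive_cst.
Qed.

Lemma ck_D n f g : ck n U f -> ck n U g -> ck n U (fun x => f x + g x).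
Proof.
elim: n f g => // n IH f g [df Df] [dg Dg]; split=> [x Ux|j].
  by apply: differentiableD; [exact: df|exact: dg].
apply: ck_ext (IH _ _ (Df j) (Dg j)) => x Ux.
by rewrite [RHS]deriveD//; apply: diff_derivable; [exact: df|exact: dg].
Qed.

Lemma ck_M n f g : ck n U f -> ck n U g -> ck n U (fun x => f x * g x).
Proof.
elim: n f g => // n IH f g cf cg.
have [df Df] := cf; have [dg Dg] := cg; split=> [x Ux|j].
  by apply: differentiableM; [exact: df|exact: dg].
apply: ck_ext (ck_D (IH _ _ (ck_pred cf) (Dg j)) (IH _ _ (ck_pred cg) (Df j))) => x Ux.
by rewrite [RHS]deriveM//; apply: diff_derivable; [exact: df|exact: dg].
Qed.

Lemma ck_sum n (J : Type) (s : seq J) (f : J -> V -> R) : (forall j, ck n U (f j)) ->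
  ck n U (fun x => \sum_(j <- s) f j x).
Proof.
move=> cf; elim: s => [|j s IH].
  by apply: ck_ext (ck_cst n 0) => x _; rewrite big_nil.
by apply: ck_ext (ck_D (cf j) IH) => x _; rewrite big_cons.
Qed.

Lemma ck_prod n (J : Type) (s : seq J) (f : J -> V -> R) : (forall j, ck n U (f j)) ->
  ck n U (fun x => \prod_(j <- s) f j x).
Proof.
move=> cf; elim: s => [|j s IH].
  by apply: ck_ext (ck_cst n 1) => x _; rewrite big_nil.
by apply: ck_ext (ck_M (cf j) IH) => x _; rewrite big_cons.
Qed.

Lemma ck_inv n f : (forall x, U x -> f x != 0) -> ck n U f -> ck n U (fun x => (f x)^-1).
Proof.
move=> f0; elim: n => // n IH cf; have [df Df] := cf.
split=> [x Ux|j]; first by apply: differentiableV; [exact: df|exact: f0].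
have ci := IH (ck_pred cf).
apply: ck_ext (ck_M (ck_cst n (-1)) (ck_M (ck_M ci ci) (Df j))) => x Ux.
rewrite [RHS]deriveV ?f0//; last exact/diff_derivable/df.
by rewrite -[RHS]/(_ * _) expr2 invfM mulN1r -mulNr.
Qed.

Lemma ck_det n m (A : V -> 'M[R]_m) : (forall i j, ck n U (fun x => A x i j)) ->
  ck n U (fun x => \det (A x)).
Proof.
move=> cA; apply: ck_ext (@ck_sum n _ (index_enum _)
  (fun (s : 'S_m) x => (-1) ^+ s * \prod_(i <- index_enum _) A x i (s i)) _) => // s.
by apply: ck_M; [exact: ck_cst|apply: ck_prod => i; exact: cA].
Qed.

Lemma ck_invmx n m (A : V -> 'M[R]_m) : (forall x, U x -> A x \in unitmx) ->
  (forall i j, ck n U (fun x => A x i j)) ->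
  forall i j, ck n U (fun x => invmx (A x) i j).
Proof.
move=> Au cA i j.
have cc : ck n U (fun x => cofactor (A x) j i).
  apply: ck_M; first exact: ck_cst.
  apply: ck_det => k l; apply: ck_ext (cA (lift j k) (lift i l)) => x _.
  by rewrite !mxE.
apply: ck_ext (ck_M (ck_inv _ (ck_det cA)) cc) => x Ux.
  by rewrite /invmx Au// !mxE.
by have := Au x Ux; rewrite unitmxE unitfE.
Qed.

End Open.

Lemma ck_comp n U U' f (h : V -> V) : open U' -> (forall y, U' y -> U (h y)) ->
  ck n U f -> (forall j, ck n U' (fun y => h y ord0 j)) ->
  ck n U' (fun y => f (h y)).
Proof.
move=> U'o hU; elim: n f => // n IH f cf ch.
have [df Df] := cf.
have dh y : U' y -> differentiable h y.
  by move=> Uy; apply: differentiable_rV => j; exact: (ch j).1.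
split=> [y Uy|j].
  by have [] := derive_comp_row 0 (dh y Uy) (df _ (hU y Uy)).
have ch' k := ck_pred (ch k).
have c1 k : ck n U' (fun y => 'D_(delta_mx 0 j) (fun z => h z ord0 k) y *
    'D_(delta_mx 0 k) f (h y)).
  by apply: ck_M => //; [exact: (ch k).2|exact: (IH _ (Df k) ch')].
apply: (ck_ext U'o _ (ck_sum U'o (index_enum 'I_d) c1)) => y Uy.
have [_ ->] := derive_comp_row (delta_mx 0 j) (dh y Uy) (df _ (hU y Uy)).
by apply: eq_bigr => k _; rewrite derive_coordf//; exact: dh.
Qed.

Lemma ck_smooth_on U (f : V -> V) : open U ->
  (forall n j, ck n U (fun x => f x ord0 j)) -> smooth_on U f.
Proof.
move=> Uo cf; suff h vs n j : ck n U (fun x => Defs.iterD vs f x ord0 j).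
  by move=> vs x Ux; apply: differentiable_rV => j; exact: (h vs 1%N j).1.
elim: vs n j => [|v vs IH] n j; first exact: cf.
have c1 k : ck n U (fun x => v ord0 k *
    'D_(delta_mx 0 k) (fun x => Defs.iterD vs f x ord0 j) x).
  by apply: ck_M => //; [exact: ck_cst|exact: (IH n.+1 j).2].
apply: (ck_ext Uo _ (ck_sum Uo (index_enum 'I_d) c1)) => x Ux.
have dI : differentiable (Defs.iterD vs f) x.
  by apply: differentiable_rV => k; exact: (IH 1%N k).1.
by rewrite /= derive_coordf// derive_delta//; exact: differentiable_coordf.
Qed.

Lemma jacobianE (f : V -> V) x i j : differentiable f x ->
  jacobian f x i j = 'D_(delta_mx 0 i) (fun y => f y ord0 j) x.
Proof. by move=> df; rewrite /jacobian mxE -deriveE// derive_coordf. Qed.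

Section Inverse.
Context (U : set V) (f : V -> V).
Hypothesis Uo : open U.
Hypothesis fs : forall n j, ck n U (fun x => f x ord0 j).
Hypothesis finj : forall x x', U x -> U x' -> f x = f x' -> x = x'.
Hypothesis fopen : forall x e, U x -> 0 < e -> exists2 e', 0 < e' &
  forall y, enorm (y - f x) < e' -> exists z, [/\ U z, enorm (z - x) < e & f z = y].
Hypothesis fjac : forall x, U x -> jacobian f x \in unitmx.

Let f_diff x : U x -> differentiable f x.
Proof. by move=> Ux; apply: differentiable_rV => j; exact: (fs 1 j).1. Qed.

Lemma image_open : open (f @` U).
Proof.
apply/enorm_openP => _ [x Ux <-]; have [e' e'0 h] := fopen Ux ltr01.
by exists e' => // y /h[z [Uz _ <-]]; exists z.
Qed.

Let h (y : V) : V := xget 0 [set x | U x /\ f x = y].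

Let hK x : U x -> h (f x) = x.
Proof.
move=> Ux; rewrite /h; case: xgetP => [z -> [Uz fz]|/(_ x) []//].
exact: finj.
Qed.

(** [fopen] finds a preimage z near x for every value f x + k with k small. Invertibility of the
    Jacobian gives |z - x| = O(|k|), and the remainder of f at x turns into one for h. *)
Lemma differentiable_inverse x j : U x ->
  differentiable (fun y => h y ord0 j) (f x) /\
  forall i, 'D_(delta_mx 0 i) (fun y => h y ord0 j) (f x) = invmx (jacobian f x) i j.
Proof.
move=> Ux; set A := invmx (jacobian f x).
pose c (k : 'I_d) : V := \row_i A i k.
have cE v k : dot v (c k) = (v *m A) ord0 k.
  by rewrite mxE; apply: eq_bigr => i _; rewrite mxE.
have dfx := f_diff Ux.
have dfA v : ('d f x v) *m A = v.
  have -> : 'd f x v = v *m jacobian f x by rewrite -deriveE// deriveEjacobian.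
  by rewrite -mulmxA mulmxV ?mulmx1// fjac.
pose B := \sum_k enorm (c k) + 1.
have B0 : 0 < B by rewrite ltr_wpDl// sumr_ge0// => k _; exact: enorm_ge0.
have cB k : enorm (c k) <= B.
  by rewrite /B (bigD1 k)//= -addrA lerDl addr_ge0// sumr_ge0// => i _; exact: enorm_ge0.
have AB v : enorm (v *m A) <= B * enorm v.
  rewrite (le_trans (enorm_le_sum _))// mulrDl mul1r.
  apply: (@le_trans _ _ (\sum_k enorm (c k) * enorm v)); last first.
    by rewrite -mulr_suml lerDl enorm_ge0.
  by apply: ler_sum => k _; rewrite -cE (le_trans (cauchy_schwarz _ _))// mulrC.
pose g y := dot y (c j) + 0.
have dg y : differentiable g y.
  have : cls (fun _ : unit => [set: V]) (fun _ x => enorm x + 1) 1 (fun _ x => enorm x + 1)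
      (fun _ y => dot y (c j) + 0).
    apply: (@cls_affine R d unit _ _ _ _ 1 _ (fun=> c j) (fun=> 0)).
    - by move=> _; exact: openT.
    - by move=> _ y' _; rewrite addr_ge0 ?enorm_ge0.
    - exists (enorm (c j)); first exact: enorm_ge0.
      move=> _ y' _; rewrite addr0 (le_trans (cauchy_schwarz _ _))// mulrC.
      by rewrite ler_wpM2l ?enorm_ge0// lerDl.
    exists (enorm (c j)); first exact: enorm_ge0.
    move=> _ y' _; rewrite ler_peMr ?enorm_ge0//.
    by rewrite mulr_ege1// lerDr enorm_ge0.
  by move=> cg; apply: (cls_diff (i := tt) cg).
have gE v : 'd g (f x) v = dot v (c j).
  rewrite -deriveE// /derive; apply: cvg_lim => //; apply: cvg_near_cst; near=> t.
  have t0 : t != 0 by near: t; exact: nbhs_dnbhs_neq.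
  rewrite /g /= dotDl dotZl -[LHS]/(_ * _) !addr0 addrK mulKf//.
suff [dh dE] : differentiable (fun y => h y ord0 j) (f x) /\
    'd (fun y => h y ord0 j) (f x) = 'd g (f x) :> (V -> R).
  by split=> // i; rewrite deriveE// dE gE cE -rowE mxE.
apply: differentiable_eps; first exact: diff_continuous.
(* The first bound gives |v| <= 2 B |k| by absorption; the second makes the final remainder at most
   e |k|, with the factor comparing the two norms. *)
move=> e e0; pose e1 := Num.min (1 / (2 * B)) (e / (2 * B * B * d.+1%:R)).
have e10 : 0 < e1 by rewrite lt_min !divr_gt0// ?mulr_gt0.
have dn : (0 : R) < d.+1%:R by rewrite ltr0n.
have := differentiableP_eps dfx (_ : 0 < e1 / d.+1%:R).
rewrite divr_gt0// => /(_ isT)/enorm_nbhsP[a a0 ha].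
have [a' a'0 ha'] := fopen Ux a0.
apply/enorm_nbhsP; exists a' => // k; rewrite subr0 => ka.
have [|z [Uz zx fz]] := ha' (k + f x); first by rewrite addrK.
rewrite -fz hK// gE hK//.
set v := z - x; have zE : z = v + x by rewrite subrK.
have := ha v; rewrite subr0 -zE => /(_ zx) hR.
set Rm := f z - f x - 'd f x v in hR.
have kE : 'd f x v = k - Rm.
  by rewrite /Rm fz addrK opprB addrC subrK.
have Rv : enorm Rm <= e1 * enorm v.
  rewrite (le_trans (enorm_le_norm _))//.
  apply: (@le_trans _ _ (d.+1%:R * (e1 / d.+1%:R * `|v|))).
    by apply: ler_pM => //; rewrite ler_nat.
  rewrite mulrA mulrCA divff ?mulr1 ?gt_eqF// ler_wpM2l ?(ltW e10)//.
  exact: norm_le_enorm.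
have vE : v = (k - Rm) *m A by rewrite -kE dfA.
have e1B : e1 * (2 * B) <= 1.
  by rewrite -ler_pdivlMr ?mulr_gt0// /e1 ge_min lexx.
have e1e : e1 * (2 * B * B * d.+1%:R) <= e.
  by rewrite -ler_pdivlMr ?mulr_gt0// /e1 ge_min lexx orbT.
have vk : enorm v <= 2 * B * enorm k.
  have h1 : enorm v <= B * enorm (k - Rm) by rewrite {1}vE.
  have h2 : B * enorm (k - Rm) <= B * (enorm k + e1 * enorm v).
    by rewrite ler_pM2l// (le_trans (enorm_subD _ _))// lerD2l.
  have h3 : e1 * (2 * B) * enorm v <= 1 * enorm v by rewrite ler_wpM2r ?enorm_ge0.
  lra.
have -> : z ord0 j - x ord0 j - dot k (c j) = - dot Rm (c j).
  have -> : z ord0 j - x ord0 j = v ord0 j by rewrite !mxE.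
  by rewrite vE -cE dotBl; ring.
rewrite normrN (le_trans (cauchy_schwarz _ _))//.
apply: (@le_trans _ _ (e1 * (2 * B * (d.+1%:R * `|k|)) * B)).
  apply: ler_pM; rewrite ?enorm_ge0// (le_trans Rv)// ler_pM2l// (le_trans vk)//.
  rewrite ler_pM2l ?mulr_gt0// (le_trans (enorm_le_norm _))// ler_wpM2r// ler_nat//.
have -> : e1 * (2 * B * (d.+1%:R * `|k|)) * B = e1 * (2 * B * B * d.+1%:R) * `|k| by ring.
by rewrite ler_wpM2r.
Unshelve. all: by end_near. Qed.

(** Bootstrap: Dh is the inverse matrix of Df composed with h, so order n for h gives order n for Dh
    and order n + 1 for h. *)
Lemma smooth_inverse : exists h' : V -> V,
  (forall x, U x -> h' (f x) = x) /\ smooth_on (f @` U) h'.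
Proof.
exists h; split; first exact: hK.
have hU y : (f @` U) y -> U (h y) by case=> x Ux <-; rewrite hK.
have Vo := image_open.
apply: ck_smooth_on => //; elim=> // n IH j; split=> [_ [x Ux <-]|i].
  by have [] := differentiable_inverse j Ux.
have cJ k l : ck n U (fun x => jacobian f x k l).
  apply: (ck_ext Uo _ ((fs n.+1 l).2 k)) => x Ux.
  by rewrite jacobianE//; exact: f_diff.
have cI := ck_invmx Uo fjac cJ i j.
apply: (ck_ext Vo _ (ck_comp Vo hU cI IH)) => _ [x Ux <-].
by have [_ ->] := differentiable_inverse j Ux; rewrite hK.
Qed.

End Inverse.
End SmoothFunctions.

(** * Lower bound for the derivative of the reflection *)

Lemma lower_arith (R : realFieldType) (a K H C3 C4 c2 r N w T dw de dn : R) :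
  0 < a -> a <= 3 * K -> 4 <= a * c2 -> 0 < H -> 0 < C3 -> 0 < C4 -> 0 < K ->
  0 < r -> 0 <= N -> 0 <= w -> dn <= - c2 -> `|dw| <= C3 * w ->
  `|de| <= C3 * (C4 * N) -> T = dw - a * T * dn - a * r * de ->
  N <= w + a * `|T| * H + a * r * (C4 * N) ->
  r * (3 * K * C4 * (3 * K * H * C3 + 1)) <= 1 / 2 ->
  N <= 2 * (3 * K * H * C3 + 1) * w.
Proof.
move=> a0 aK ac H0 C30 C40 K0 r0 N0 w0 hdn hdw hde TE hN small.
(* 1 - q is the factor 1 + s K D_eta rho of the rank-one part. As q >= 4 it is at most -3, so [T],
   which stands for D_v rho, is bounded by [dw] and a term carrying the factor r = rho x. *)
pose q := - (a * dn).
have q4 : 4 <= q.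
  have : a * c2 <= a * - dn by rewrite ler_pM2l// lerNr.
  rewrite /q; lra.
have e1 : (1 - q) * T = dw - a * r * de by move: TE; rewrite /q; lra.
have e2 : `|T| <= `|(1 - q) * T|.
  by rewrite normrM ler_peMl// ler0_norm; lra.
have Tb : `|T| <= C3 * w + 3 * K * r * (C3 * (C4 * N)).
  rewrite (le_trans e2)// e1 (le_trans (ler_normB _ _))// lerD//.
  rewrite normrM gtr0_norm ?mulr_gt0//.
  by apply: ler_pM => //; rewrite ?mulr_ge0 ?(ltW r0)// ?(ltW a0)// ler_pM2r.
have n3 : a * `|T| * H <= 3 * K * H * (C3 * w + 3 * K * r * (C3 * (C4 * N))).
  apply: (@le_trans _ _ (3 * K * `|T| * H)); first by rewrite ler_pM2r// ler_wpM2r.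
  rewrite (_ : 3 * K * `|T| * H = 3 * K * H * `|T|); last by ring.
  by rewrite ler_pM2l// !mulr_gt0.
have n5 : a * r * (C4 * N) <= 3 * K * r * (C4 * N).
  by rewrite ler_wpM2r ?ler_pM2r// mulr_ge0// ltW.
have n4 : r * (3 * K * C4 * (3 * K * H * C3 + 1)) * N <= 1 / 2 * N by rewrite ler_wpM2r.
lra.
Qed.

Section Jacobian.
Context (R : realType) (d : nat).
Local Notation V := 'rV[R]_d.
Context (eta : V -> V) (rho : V -> R) (K s : R) (x : V).
Hypothesis drho : differentiable rho x.
Hypothesis deta : differentiable eta x.

Lemma refl_derive v : differentiable (refl eta rho K s) x /\
  'D_v (refl eta rho K s) x = v + (s * K) *: ('D_v rho x *: eta x + rho x *: 'D_v eta x).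
Proof.
pose G j y : R := dot y (delta_mx 0 j) + (s * K) * (rho y * eta y ord0 j).
have de j : differentiable (fun y => eta y ord0 j) x by exact: differentiable_coordf.
have coordE j : (fun y => dot y (delta_mx 0 j)) = (fun y : V => y ord0 j).
  by apply/funext => y; rewrite dot_delta.
have GE j : (fun y => refl eta rho K s y ord0 j) = G j.
  by apply/funext => y; rewrite /G dot_delta /refl /refl_field !mxE; ring.
have d1 j : differentiable (fun y : V => dot y (delta_mx 0 j)) x.
  by rewrite coordE; exact: differentiable_coord.
have d2 j : differentiable (fun y => rho y * eta y ord0 j) x by exact: differentiableM.
have d3 j : differentiable (fun y => (s * K) * (rho y * eta y ord0 j)) x.
  by apply: differentiableM => //; exact: differentiable_cst.
have dG j : differentiable (G j) x by exact: differentiableD.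
have dr : differentiable (refl eta rho K s) x.
  by apply: differentiable_rV => j; rewrite GE.
split=> //; apply/rowP => j; rewrite derive_coordf// GE.
have -> : 'D_v (G j) x = 'D_v (fun y => dot y (delta_mx 0 j)) x +
    'D_v (fun y => (s * K) * (rho y * eta y ord0 j)) x.
  by apply: deriveD; exact: diff_derivable.
have -> : 'D_v (fun y => (s * K) * (rho y * eta y ord0 j)) x =
    (s * K) * 'D_v (fun y => rho y * eta y ord0 j) x.
  by apply: deriveZ; exact: diff_derivable.
have -> : 'D_v (fun y => rho y * eta y ord0 j) x =
    rho x * 'D_v (fun y => eta y ord0 j) x + eta x ord0 j * 'D_v rho x.
  by apply: deriveM; exact: diff_derivable.
have -> : 'D_v (fun y => dot y (delta_mx 0 j)) x = v ord0 j.
  by rewrite coordE -(derive_coordf v j (f := id)) ?derive_id//.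
by rewrite !mxE -derive_coordf//; ring.
Qed.

Variables (H C3 C4 c2 : R).
Hypothesis s23 : 2 <= s <= 3.
Hypothesis H0 : 0 < H.
Hypothesis C30 : 0 < C3.
Hypothesis C40 : 0 < C4.
Hypothesis K0 : 0 < K.
Hypothesis Kc2 : 2 <= K * c2.
Hypothesis rho0 : 0 < rho x.
Hypothesis etaH : enorm (eta x) <= H.
Hypothesis rho_eta : 'D_(eta x) rho x <= - c2.
Hypothesis rho_lip : forall v, `|'D_v rho x| <= C3 * enorm v.
Hypothesis eta_lip : forall v, enorm ('D_v eta x) <= C4 * enorm v.
Hypothesis small : rho x * (3 * K * C4 * (3 * K * H * C3 + 1)) <= 1 / 2.

(** The derivative formula is solved for v, leaving the unknown number D_v rho in front of eta x.
    Applying D rho to the same identity bounds this number; the remaining terms carry the factor rho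
    x and are absorbed by [small]. *)
Lemma refl_derive_lower v :
  enorm v <= 2 * (3 * K * H * C3 + 1) * enorm ('D_v (refl eta rho K s) x).
Proof.
have ac : 4 <= s * K * c2.
  have /andP[s2 _] := s23; apply: (@le_trans _ _ (2 * (K * c2))).
    by move: Kc2; lra.
  rewrite -mulrA ler_wpM2r//; move: Kc2; lra.
have [_ E] := refl_derive v; set w := 'D_v (refl _ _ _ _) x in E *.
have /andP[s2 s3] := s23.
set a := s * K; have a0 : 0 < a by rewrite mulr_gt0//; lra.
have aK : a <= 3 * K by rewrite ler_pM2r.
set T := 'D_v rho x; set e := 'D_v eta x; rewrite -/a -/T -/e in E.
rewrite -/a in ac.
have e4 : enorm e <= C4 * enorm v by exact: eta_lip.
set N := enorm v in e4 *; have N0 : 0 <= N by exact: enorm_ge0.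
have linD (u1 u2 u3 : V) (b1 b2 : R) : 'D_(u1 - b1 *: u2 - b2 *: u3) rho x =
    'D_u1 rho x - b1 * 'D_u2 rho x - b2 * 'D_u3 rho x.
  by rewrite !deriveE// !linearB !linearZ.
have vE : v = w - (a * T) *: eta x - (a * rho x) *: e.
  by rewrite E; apply/rowP => i; rewrite !mxE; ring.
have TE : T = 'D_w rho x - a * T * 'D_(eta x) rho x - a * rho x * 'D_e rho x.
  by rewrite -linD -vE.
have De2 : `|'D_e rho x| <= C3 * (C4 * N) by rewrite (le_trans (rho_lip e))// ler_pM2l.
have nT : enorm ((a * T) *: eta x) <= a * `|T| * H.
  by rewrite enormZ normrM (gtr0_norm a0) ler_wpM2l// mulr_ge0// ltW.
have ar0 : 0 < a * rho x by exact: mulr_gt0.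
have nE : enorm ((a * rho x) *: e) <= a * rho x * (C4 * N).
  by rewrite enormZ (gtr0_norm ar0); apply: ler_wpM2l => //; exact: ltW.
have n1 := enorm_subD (w - (a * T) *: eta x) ((a * rho x) *: e).
have n2 := enorm_subD w ((a * T) *: eta x).
rewrite -vE -/N in n1; clear vE.
have n3 : N <= enorm w + a * `|T| * H + a * rho x * (C4 * N).
  by rewrite (le_trans n1)// lerD// (le_trans n2)// lerD2l.
exact: (lower_arith a0 aK ac H0 C30 C40 K0 rho0 N0 (enorm_ge0 w) rho_eta (rho_lip w) De2 TE n3 small).
Qed.

End Jacobian.

(** * Lagrange extrapolation from [2, 3] to 0 *)

Section Extrapolation.
Context (R : realType).

Definition lagrange_basis (I : seq R) (s : R) : {poly R} :=
  \prod_(t <- I | t != s) ((s - t)^-1 *: ('X - t%:P)).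

Lemma lagrange_basisE (I : seq R) s u : u \in I -> uniq I ->
  (lagrange_basis I s).[u] = (s == u)%:R.
Proof.
move=> uI Iu; rewrite /lagrange_basis horner_prod; case: eqVneq => [->|su].
  rewrite big1// => t tu; rewrite hornerZ hornerXsubC mulVf// subr_eq0 eq_sym//.
rewrite big_mkcond (bigD1_seq u)//= eq_sym su.
by rewrite hornerZ hornerXsubC subrr mulr0 mul0r.
Qed.

Lemma size_lagrange_basis (I : seq R) s : s \in I ->
  (size (lagrange_basis I s) <= size I)%N.
Proof.
move=> sI; have h (r : seq R) :
    (size (lagrange_basis r s) <= (count (predC1 s) r).+1)%N.
  rewrite /lagrange_basis; elim: r => [|t r IH]; first by rewrite big_nil size_polyC oner_eq0.
  rewrite big_cons /=; case: (t != s) => //=.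
  rewrite (leq_trans (size_polyMleq _ _))//.
  have := size_scale_leq (s - t)^-1 ('X - t%:P); rewrite size_XsubC => h2.
  by rewrite -subn1 leq_subLR (leq_trans (leq_add h2 IH)).
apply: leq_trans (h I) _; rewrite -(count_predC (pred1 s) I) -add1n leq_add2r.
by rewrite -has_count has_pred1.
Qed.

Lemma extrapolation n : exists (I : {fset R}) (psi : R -> R),
  (forall s, s \in I -> 2 <= s <= 3) /\
  forall f : {poly R}, (size f <= n.+1)%N -> \sum_(s <- I) psi s * f.[s] = f.[0].
Proof.
(* For i = 0, ..., n these are n + 1 distinct nodes, one more than the largest admissible degree. *)
pose node (i : nat) : R := 2 + i%:R / n.+1%:R.
have n0 : (0 : R) < n.+1%:R by rewrite ltr0n.
have node_inj : injective node.
  by move=> i j /addrI /(mulIf (invr_neq0 (lt0r_neq0 n0)))/eqP; rewrite eqr_nat => /eqP.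
pose s0 := [seq node i | i <- iota 0 n.+1].
have us0 : uniq s0 by rewrite map_inj_uniq// iota_uniq.
pose I := [fset x in s0]%fset.
have I0 : perm_eq I s0.
  by apply: uniq_perm => // x; rewrite in_fset.
have Iu : uniq I := fset_uniq I.
have sI : size I = n.+1 by rewrite (perm_size I0) size_map size_iota.
exists I, (fun s => (lagrange_basis I s).[0]); split.
  move=> s; rewrite (perm_mem I0) => /mapP[i]; rewrite mem_iota add0n => /andP[_ hi] ->.
  have h : i%:R / n.+1%:R <= 1 :> R by rewrite ler_pdivrMr// mul1r ler_nat ltnW.
  have h' : 0 <= i%:R / n.+1%:R :> R by rewrite divr_ge0.
  by rewrite /node lerDl h'/= (_ : 3 = 2 + 1) ?lerD2l//; ring.
move=> f sf; pose g := f - \sum_(s <- I) f.[s] *: lagrange_basis I s.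
have sL s : s \in I -> (size (lagrange_basis I s) <= n.+1)%N.
  by move=> /size_lagrange_basis; rewrite sI.
(* g vanishes at the n + 1 nodes and has degree at most n. *)
have g0 : g = 0.
  apply: (@roots_geq_poly_eq0 _ g I) => //.
  - apply/allP => u uI; rewrite /root /g hornerD hornerN horner_sum.
    rewrite (bigD1_seq u)//= big1_seq ?addr0.
      by rewrite hornerZ lagrange_basisE// eqxx mulr1 subrr.
    by move=> s /andP[su _]; rewrite hornerZ lagrange_basisE// (negPf su) mulr0.
  rewrite sI (leq_trans (size_polyD _ _))// geq_max sf size_polyN.
  rewrite (leq_trans (size_sum _ _ _))//; apply/bigmax_leqP_seq => s sIs _.
  by rewrite (leq_trans (size_scale_leq _ _))// sL.
have -> : f.[0] = (\sum_(s <- I) f.[s] *: lagrange_basis I s).[0].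
  by move/eqP: g0; rewrite subr_eq0 => /eqP {1}->.
by rewrite horner_sum; apply: eq_bigr => s _; rewrite hornerZ mulrC.
Qed.

End Extrapolation.

(** * The reflection on the collar and the choice of constants *)

Section Final.
Context (R : realType) (d : nat).
Local Notation V := 'rV[R]_d.

Lemma unitmx_inj (A : 'M[R]_d) : (forall v : V, v *m A = 0 -> v = 0) -> A \in unitmx.
Proof.
move=> h; rewrite -row_free_unit -kermx_eq0; apply/eqP/row_matrixP => i.
by rewrite row0; apply: h; apply/sub_kermxP; exact: row_sub.
Qed.

Lemma cls_derive_bound (I : Type) (U : I -> set V) w g f :
  (forall i x, U i x -> 0 <= g i x * w i x) -> cls U w 1 g f ->
  exists2 C, 0 < C & forall i x v, U i x -> `|'D_v (f i) x| <= C * (g i x * w i x) * enorm v.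
Proof.
move=> gw cf; have /choice[Ck hk] : forall k : 'I_d, exists C', 0 <= C' /\
    forall i x, U i x -> `|'D_(delta_mx 0 k) (f i) x| <= C' * (g i x * w i x).
  by move=> k; have [C' C'0 h] := cls_bound (cls_derive k cf); exists C'.
have C0 : 0 <= \sum_k Ck k by apply: sumr_ge0 => k _; exact: (hk k).1.
exists (\sum_k Ck k + 1) => [|i x v Ux]; first by rewrite ltr_wpDl.
apply: (@le_trans _ _ ((\sum_k Ck k) * (g i x * w i x) * enorm v)); last first.
  by rewrite ler_wpM2r ?enorm_ge0// ler_wpM2r ?gw// lerDl.
rewrite derive_delta; last exact: cls_diff cf Ux.
rewrite (le_trans (ler_norm_sum _ _ _))// !mulr_suml; apply: ler_sum => k _.
rewrite -[_ *: _]/(_ * _) normrM mulrC ler_pM//; first exact: (hk k).2.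
exact: coord_le_enorm.
Qed.

(** A pair (a, b) stands for the requirement t a < b with b > 0. All smallness conditions on [t0],
    and then on [eps1], are met at once in this way. *)
Lemma small_scale (s : seq (R * R)) : all (fun q => 0 < q.2) s ->
  exists2 t, 0 < t & all (fun q => t * q.1 < q.2) s.
Proof.
suff: all (fun q => 0 < q.2) s -> exists2 t, 0 < t & all (fun q => t * `|q.1| < q.2) s.
  move=> /[apply] -[t t0 /allP h]; exists t => //; apply/allP => q /h.
  by apply: le_lt_trans; rewrite ler_pM2l// ler_norm.
elim: s => [|q s IH] /=; first by exists 1.
move=> /andP[q0 /IH[t t0 /allP h]].
have a0 : 0 < `|q.1| + 1 by rewrite ltr_wpDl.
exists (Num.min t (q.2 / (`|q.1| + 1))); first by rewrite lt_min t0 divr_gt0.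
apply/andP; split; last first.
  by apply/allP => q' /h; apply: le_lt_trans; rewrite ler_wpM2r// ge_min lexx.
apply: (@le_lt_trans _ _ (q.2 / (`|q.1| + 1) * `|q.1|)).
  by rewrite ler_wpM2r// ge_min lexx orbT.
by rewrite mulrAC ltr_pdivrMr// ltr_pM2l// ltrDl.
Qed.

Lemma ck_coord (U : set V) n j : open U -> ck n U (fun x : V => x ord0 j).
Proof.
move=> Uo; case: n => // n; split=> [x _|i]; first exact: differentiable_coord.
apply: ck_ext (ck_cst Uo n ((delta_mx 0 i : V) ord0 j)) => // x _.
by rewrite -(derive_coordf _ j (f := id)) ?derive_id.
Qed.

Section Collar.
Context (S : set V) (eta : V -> V) (c r H L : R).
Hypothesis tv : transversal_field S eta c r H L.
Hypothesis Sc : closed S.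
Hypothesis S0 : S !=set0.
Local Notation delta := (dist_to S).

Context (eps c1 c2 C : R) (rho : V -> R).
Let W0 := [set x | ~ S x /\ delta x < eps].
Hypothesis c10 : 0 < c1.
Hypothesis c20 : 0 < c2.
Hypothesis C0 : 0 < C.
Hypothesis rho_cls : forall n, cls (fun _ : unit => W0) (fun _ x => (delta x)^-1) n
      (fun _ x => delta x) (fun _ => rho).
Hypothesis rho_bounds : forall x, W0 x -> c1 * delta x <= rho x <= C * delta x.
Hypothesis rho_derive : forall x, W0 x -> 'D_(eta x) rho x <= - c2.

Context (C3 C4 : R).
Hypothesis C30 : 0 < C3.
Hypothesis rho_lip : forall x v, W0 x -> `|'D_v rho x| <= C3 * enorm v.
Hypothesis C40 : 0 < C4.
Hypothesis eta_lip : forall x v, enorm ('D_v eta x) <= C4 * enorm v.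

Context (t0 : R).
Hypothesis t00 : 0 < t0.
Hypothesis T1 : t0 * (2 * L * d.+1%:R) <= 1.
Hypothesis T2 : t0 * (4 * H * L) <= c.
Hypothesis T3 : t0 * (2 * H + 2 * c + 1) < r.
Hypothesis T4 : t0 * (8 * C3 * H * L) <= c2.
Hypothesis T5 : t0 * (3 * H) < eps.

Context (K eps1 : R).
Hypothesis K1 : 4 <= K * c1 * c.
Hypothesis K2 : 2 <= K * c2.
Hypothesis eps10 : 0 < eps1.
Hypothesis E1 : 3 * K * C * eps1 < t0.
Hypothesis E2 : 4 * L * eps1 <= c.
Hypothesis E3 : 2 * eps1 < r.
Hypothesis E4 : eps1 <= eps.
Hypothesis E5 : C * eps1 * (3 * K * C4 * (3 * K * H * C3 + 1)) <= 1 / 2.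

Context (X : R -> V -> V).
Hypothesis XE : forall t y, 0 <= t <= t0 -> X t y + t *: eta (X t y) = y.

Let W := [set x | ~ S x /\ delta x < eps1].
Let phi := refl_field eta rho K.

Let W_W0 x : W x -> W0 x.
Proof. by move=> [Sx dx]; split=> //; exact: lt_le_trans E4. Qed.

Let delta_gt0 x : W x -> 0 < delta x.
Proof. by move=> [Sx _]; exact: dist_to_gt0. Qed.

Let deltaV_ge0 x : W x -> 0 <= (delta x)^-1.
Proof. by move=> /delta_gt0/ltW; rewrite invr_ge0. Qed.

Let K0 : 0 < K.
Proof. by rewrite -(pmulr_lgt0 _ c20); move: K2; lra. Qed.

Let Wo : open W. Proof. exact: collar_open. Qed.

Lemma refl_field_cls n : cls (fun _ : 'I_d => W) (fun _ x => (delta x)^-1) n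
  (fun _ => delta) (fun j x => phi x ord0 j).
Proof.
have w0 (j : 'I_d) x : W x -> 0 <= (delta x)^-1 by exact: deltaV_ge0.
have crho : cls (fun _ : 'I_d => W) (fun _ x => (delta x)^-1) n (fun _ => delta) (fun _ => rho).
  apply: cls_local (rho_cls n) => j x Wx; exists tt; split=> //; first exact: W_W0.
  exact: nearW_rV.
have ceta : cls (fun _ : 'I_d => W) (fun _ x => (delta x)^-1) n (fun _ _ => 1)
    (fun j x => eta x ord0 j).
  (* On the collar delta < eps1, so the bounded derivatives of eta also obey the weight 1/delta. *)
  apply: (@cls_weight _ _ _ _ (fun _ _ => 1) _ _ (fun _ _ => 1)) => [m _|]; last first.
    apply: cls_local (tv_smooth tv n) => j x Wx; exists j; split=> //.
    exact: nearW_rV.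
  exists (eps1 ^+ m) => [|j x Wx]; first by rewrite exprn_ge0 ?ltW.
  rewrite expr1n !mul1r exprVn; have [_ dx] := Wx; have dx0 := delta_gt0 Wx.
  by rewrite ler_pdivlMr ?exprn_gt0// mul1r; apply: lerXn2r; rewrite ?nnegrE ltW.
have := cls_Z (fun=> Wo) w0 K (cls_M (fun=> Wo) w0 crho ceta).
move/(cls_ext (fun=> Wo) (f' := fun j x => phi x ord0 j)) => h.
apply: cls_amp (h _) => //.
  by exists 1 => // j x Wx; rewrite mulr1 mul1r.
by move=> j x _; rewrite /phi /refl_field !mxE mulrA.
Qed.

Lemma refl_field_smooth : smooth_on W phi.
Proof.
exact: (@cls_smooth_on R d W (fun x => (delta x)^-1) phi delta Wo deltaV_ge0
  (fun x Wx => ltW (delta_gt0 Wx)) refl_field_cls).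
Qed.

Lemma refl_field_derivative_norm k : exists C', forall x, W x ->
  (derivative_norm (1 + k) phi x <= (C' * delta x ^- k)%:E)%E.
Proof.
have [C' h] := @cls_derivative_norm R d W (fun x => (delta x)^-1) phi delta Wo deltaV_ge0
  (fun x Wx => ltW (delta_gt0 Wx)) refl_field_cls (1 + k).
exists C' => x Wx; have /= := h x Wx.
by rewrite add1n exprS mulVKf ?gt_eqF ?delta_gt0// exprVn.
Qed.

Lemma refl_field_enorm : exists C', forall x, W x ->
  enorm (phi x) <= C' * delta x /\ delta x <= C' * enorm (phi x).
Proof.
have c0 := tv_c tv; have H0 := tv_H tv.
have q0 : 0 < K * c1 * (c / 2) by rewrite !mulr_gt0// divr_gt0.
have q1 : 0 < K * C * H by rewrite !mulr_gt0.
exists (K * C * H + (K * c1 * (c / 2))^-1) => x Wx.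
have [Sx dx] := Wx; have dx0 := delta_gt0 Wx.
have /andP[r1 r2] := rho_bounds (W_W0 Wx).
have rx : 0 < rho x by rewrite (lt_le_trans _ r1)// mulr_gt0.
have nE : enorm (phi x) = K * rho x * enorm (eta x).
  by rewrite /phi /refl_field enormZ gtr0_norm// mulr_gt0.
have Ldx : L * delta x <= L * eps1 by rewrite ler_pM2l ?(tv_L tv)// ltW.
have lo : c / 2 <= enorm (eta x).
  apply: (field_low tv Sc S0 Sx); first by move: E3 dx; lra.
  by move: E2 Ldx; lra.
split.
  apply: (@le_trans _ _ (K * C * H * delta x)); last by rewrite ler_pM2r// lerDl invr_ge0 ltW.
  rewrite nE (_ : K * C * H * delta x = K * (C * delta x) * H); last by ring.
  rewrite ler_pM ?enorm_ge0 ?mulr_ge0 ?(ltW K0) ?(ltW rx) ?ler_pM2l//.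
  exact: (tv_bound tv).
apply: (@le_trans _ _ ((K * c1 * (c / 2))^-1 * enorm (phi x))); last first.
  by rewrite ler_wpM2r ?enorm_ge0// lerDr ltW.
rewrite mulrC ler_pdivlMr// nE.
rewrite (_ : delta x * (K * c1 * (c / 2)) = K * (c1 * delta x) * (c / 2)); last by ring.
have c20' : 0 < c / 2 by rewrite divr_gt0.
by rewrite ler_pM ?ler_pM2l// ?mulr_ge0 ?(ltW K0) ?(ltW c10) ?(ltW dx0) ?ltW.
Qed.

Lemma refl_ck s n j : ck n W (fun x => refl eta rho K s x ord0 j).
Proof.
have h := ck_D Wo (ck_coord n j Wo) (ck_M Wo (ck_cst Wo n s) (cls_ck j (refl_field_cls n))).
by apply: ck_ext h => // x _; rewrite /refl !mxE.
Qed.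

Lemma refl_jacobian_lower s x v : 2 <= s <= 3 -> W x ->
  enorm v <= 2 * (3 * K * H * C3 + 1) * enorm (v *m jacobian (refl eta rho K s) x).
Proof.
move=> s23 Wx; have Wx0 := W_W0 Wx; have [_ dx] := Wx; have dx0 := delta_gt0 Wx.
have drho : differentiable rho x.
  exact: (@cls_diff _ _ _ _ _ _ _ _ tt x (rho_cls 1%N) Wx0).
have deta : differentiable eta x.
  by apply: differentiable_rV => j; exact: (@cls_diff _ _ _ _ _ _ _ _ j x (tv_smooth tv 1%N)).
have [dr _] := refl_derive K s drho deta 0.
have /andP[r1 r2] := rho_bounds Wx0.
have rx : 0 < rho x by rewrite (lt_le_trans _ r1)// mulr_gt0.
have Q0 : 0 < 3 * K * C4 * (3 * K * H * C3 + 1).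
  by rewrite !mulr_gt0// addr_gt0// !mulr_gt0// (tv_H tv).
rewrite -deriveEjacobian//.
apply: (refl_derive_lower drho deta s23 (tv_H tv) C30 C40 K0 K2 rx (tv_bound tv x)
  (rho_derive Wx0) (fun v => rho_lip v Wx0) (eta_lip x)).
by apply: le_trans E5; rewrite ler_pM2r// (le_trans r2)// ler_pM2l// ltW.
Qed.

Lemma refl_jacobian_unit s x : 2 <= s <= 3 -> W x ->
  jacobian (refl eta rho K s) x \in unitmx.
Proof.
move=> s23 Wx; apply: unitmx_inj => v v0; apply: enorm_eq0; apply/eqP.
by rewrite eq_le enorm_ge0 (le_trans (refl_jacobian_lower v s23 Wx))// v0 enorm0 mulr0.
Qed.

Lemma refl_jacobian_opnorm s x : 2 <= s <= 3 -> W x ->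
  (opnorm (invmx (jacobian (refl eta rho K s) x)) <= (2 * (3 * K * H * C3 + 1))%:E)%E.
Proof.
move=> s23 Wx; apply: ge_ereal_sup => _ [v /= v1 <-]; rewrite lee_fin.
rewrite (le_trans (refl_jacobian_lower _ s23 Wx))// mulmxKV ?refl_jacobian_unit//.
rewrite ler_piMr// mulr_ge0// addr_ge0// !mulr_ge0 ?(ltW K0) ?(ltW C30)//.
exact: ltW (tv_H tv).
Qed.

Lemma refl_diffeomorphism s : 2 <= s <= 3 ->
  exists2 Y, interior_nbd S Y & diffeomorphism W Y (refl eta rho K s).
Proof.
move=> s23; pose f := refl eta rho K s.
have fint x : W x -> interior S (f x).
  exact: (refl_interior tv Sc S0 c10 c20 C0 rho_bounds t00 T3 K1 K2 E1 E2 E3 E4 s23).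
have finj x x' : W x -> W x' -> f x = f x' -> x = x'.
  exact: (refl_inj tv Sc S0 c10 c20 C0 rho_cls rho_bounds rho_derive C30 rho_lip t00
    T1 T2 T3 T4 T5 K1 K2 E1 E2 E3 E4 s23).
have fopen x e := @refl_open _ _ _ _ _ _ _ _ tv Sc S0 _ _ _ _ _ c10 c20 C0 rho_cls
  rho_bounds rho_derive _ C30 rho_lip _ t00 T1 T2 T3 T4 T5 _ _ K1 K2 E1 E2 E3 E4 _ XE s x e s23.
have fjac x : W x -> jacobian f x \in unitmx by exact: refl_jacobian_unit.
have Vo : open (f @` W) := image_open fopen.
have [r2 r20 onto] := refl_onto tv Sc S0 c10 c20 C0 rho_cls rho_bounds t00 T1 T3 T5
  K1 K2 eps10 XE s23.
exists (f @` W).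
  (* To the image are added all points within r2 of the complement of S. This open set contains the
     boundary, and by [refl_onto] its part in the interior of S is the image alone. *)
  exists (f @` W `|` [set y | exists2 b, ~ S b & enorm (y - b) < r2]); split.
  - apply: openU => //; apply/enorm_openP => y [b Sb yb].
    exists (r2 - enorm (y - b)); first by rewrite subr_gt0.
    by move=> z zy; exists b => //; have := enorm_distD y z b; lra.
  - move=> y [cy iy]; right; apply: contrapT => h; apply: iy; apply/enorm_nbhsP.
    exists r2 => // z zy; apply: contrapT => Sz; apply: h; exists z => //.
    by rewrite enormB.
  apply/seteqP; split=> [_ [x Wx <-]|y [[//|[b Sb yb] iy]]].
    by split; [left; exists x|exact: fint].
  by have [x Wx <-] := onto y b iy Sb yb; exists x.
split; last exact: smooth_inverse (refl_ck s) finj fopen fjac.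
  by split=> [x Wx|x x' /set_mem Wx /set_mem Wx'|//]; [exists x|exact: finj].
exact: ck_smooth_on (refl_ck s).
Qed.

End Collar.
End Final.

Theorem proposition4p12 (R : realType) (d p : nat) (Om S : set 'rV[R]_d)
    (Om_domain : domain Om) (Om_bounded : bounded_set Om)
    (Om_lipschitz : lipschitz_boundary Om) (S_def : S = closure Om) :
  exists (eps : R) (I : {fset R}) (psi : R -> R)
         (phi : 'rV[R]_d -> 'rV[R]_d),
    let delta := dist_to S in
    let W := nbd eps S `\` S in
    let Phi := fun (s : R) (x : 'rV[R]_d) => x + s *: phi x in
    [/\ 0 < eps,
        (forall s, s \in I -> 2 <= s <= 3) &
        smooth_on W phi] /\
    (* 1 *)
    (forall f : {poly R}, (size f <= (p + d).+1)%N ->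
       \sum_(s <- I) psi s * f.[s] = f.[0]) /\
    (* 2 *)
    ((exists C : R, forall x, W x ->
        enorm (phi x) <= C * delta x /\ delta x <= C * enorm (phi x)) /\
     (forall r : nat, (r <= p)%N -> exists C : R, forall x, W x ->
        (derivative_norm (1 + r) phi x <= (C * delta x ^- r)%:E)%E)) /\
    (* 3 *)
    ((forall s, 2 <= s <= 3 -> Phi s @` W `<=` S) /\
     (exists C : R, forall s x, 2 <= s <= 3 -> W x ->
        jacobian (Phi s) x \in unitmx /\
        (opnorm (invmx (jacobian (Phi s) x)) <= C%:E)%E) /\
     (forall s, 2 <= s <= 3 ->
        exists2 V, interior_nbd S V & diffeomorphism W V (Phi s))).
Proof.
have [Omo _ [z0 Oz0]] := Om_domain.
have Sc : closed S by rewrite S_def; exact: closed_closure.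
have S0 : S !=set0 by exists z0; rewrite S_def; exact: subset_closure.
have [B0 B00 SB] := bounded_closure_enorm Om_bounded.
have [eta [c [r [H [L tv]]]]] := transversal_field_exists Omo Om_bounded Om_lipschitz.
rewrite -S_def in SB tv.
have [eps [c1 [c2 [C [rho /= [[eps0 c10 c20 C0] rho_cls rho_bounds rho_derive]]]]]] :=
  regularized_distance tv Sc S0 SB.
have c0 := tv_c tv; have r0 := tv_r tv; have H0 := tv_H tv; have L0 := tv_L tv.
have [C3 C30 rho_lip] : exists2 C3, 0 < C3 & forall x v,
    ~ S x /\ dist_to S x < eps -> `|'D_v rho x| <= C3 * enorm v.
  have [|C3 C30 h] := cls_derive_bound _ (rho_cls 1%N).
    by move=> _ x [Sx _]; rewrite mulfV ?gt_eqF ?dist_to_gt0.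
  exists C3 => // x v Wx; have /= := h tt x v Wx; have [Sx _] := Wx.
  by rewrite mulfV ?mulr1// gt_eqF// dist_to_gt0.
have [C4 C40 eta_lip] : exists2 C4, 0 < C4 & forall x v, enorm ('D_v eta x) <= C4 * enorm v.
  have [|C4 C40 h] := cls_derive_bound _ (tv_smooth tv 1%N).
    by move=> j x _; rewrite mulr1.
  exists (d.+1%:R * C4) => [|x v]; first by rewrite mulr_gt0 ?ltr0n.
  have deta : differentiable eta x.
    by apply: differentiable_rV => j; exact: (@cls_diff _ _ _ _ _ _ _ _ j x (tv_smooth tv 1%N)).
  rewrite (le_trans (enorm_le_sum _))// (@le_trans _ _ (\sum_(j < d) C4 * enorm v))//.
    apply: ler_sum => j _; rewrite derive_coordf//.
    by have := h j x v Logic.I; rewrite !mulr1.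
  rewrite sumr_const card_ord -[_ *+ d]mulr_natl -mulrA ler_wpM2r ?ler_nat//.
  by rewrite mulr_ge0 ?enorm_ge0 ?ltW.
(* The two summands serve [K1] and [K2]. The order of choice matters: K first, from c1, c and c2;
   then t0, from the field, C3 and eps; last eps1, which depends on K and t0. *)
pose K := 4 / (c1 * c) + 2 / c2.
have K1 : 4 <= K * c1 * c.
  rewrite -mulrA mulrDl divfK ?gt_eqF ?mulr_gt0// lerDl.
  by rewrite ltW// !mulr_gt0// invr_gt0.
have K2 : 2 <= K * c2.
  by rewrite mulrDl divfK ?gt_eqF// lerDr ltW// !mulr_gt0// invr_gt0 mulr_gt0.
have K0 : 0 < K by rewrite addr_gt0 ?divr_gt0 ?mulr_gt0.
have [t0 t00 /and5P[/= T1 T2 T3 T4 /andP[T5 _]]] := @small_scale R [:: (2 * L * d.+1%:R, 1);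
    (4 * H * L, c); (2 * H + 2 * c + 1, r); (8 * C3 * H * L, c2); (3 * H, eps)]
  ltac:(by rewrite /= ltr01 c0 r0 c20 eps0).
pose Q := 3 * K * C4 * (3 * K * H * C3 + 1).
have [eps1 eps10 /and5P[/= E1 E2 E3 E4 /andP[E5 _]]] := @small_scale R
    [:: (3 * K * C, t0); (4 * L, c); (2, r); (1, eps); (C * Q, 1 / 2)]
  ltac:(by rewrite /= t00 c0 r0 eps0 divr_gt0).
rewrite mulrC in E1; move/ltW: E2; rewrite mulrC => E2; rewrite mulrC in E3.
move/ltW: E4; rewrite mulr1 => E4; move/ltW: E5; rewrite mulrCA mulrA => E5.
(* One solution is fixed for every t and y; off [0, t0] its value is the arbitrary 0. *)
have /choice[X XE] : forall ty : R * 'rV[R]_d, exists x,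
    0 <= ty.1 <= t0 -> x + ty.1 *: eta x = ty.2.
  move=> [t y]; have [tI|tI] := boolP (0 <= t <= t0); last by exists 0.
  by have [x xE] := shift_solvable tv (ltW T1) y tI; exists x.
have XE' t y : 0 <= t <= t0 -> X (t, y) + t *: eta (X (t, y)) = y by exact: (XE (t, y)).
have [I [psi [I23 Ipsi]]] := extrapolation R (p + d).
have WE : nbd eps1 S `\` S = [set x | ~ S x /\ dist_to S x < eps1].
  by apply/seteqP; split=> x [h1 h2]; split=> //; apply/nbdE.
have WP x : nbd eps1 S x /\ ~ S x -> ~ S x /\ dist_to S x < eps1.
  by case/seteqP: WE => + _ => /(_ x).
exists eps1, I, psi, (refl_field eta rho K); rewrite WE; split.
  split=> //; exact: (refl_field_smooth tv Sc S0 rho_cls K eps10 E4).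
split=> //; split.
  split.
    have [C' h] := refl_field_enorm tv Sc S0 c10 c20 C0 rho_bounds K2 E2 E3 E4.
    by exists C' => x /WP; exact: h.
  move=> k _; have [C' h] := refl_field_derivative_norm tv Sc S0 rho_cls K eps10 E4 k.
  by exists C' => x /WP; exact: h.
split.
  move=> s s23 _ [x Wx <-]; apply: interior_subset.
  exact: (refl_interior tv Sc S0 c10 c20 C0 rho_bounds t00 T3 K1 K2 E1 E2 E3 E4 s23).
split.
  exists (2 * (3 * K * H * C3 + 1)) => s x s23 /WP Wx; split.
    exact: (refl_jacobian_unit tv Sc S0 c10 c20 C0 rho_cls rho_bounds rho_derive C30
      rho_lip C40 eta_lip K2 E4 E5 s23 Wx).
  exact: (refl_jacobian_opnorm tv Sc S0 c10 c20 C0 rho_cls rho_bounds rho_derive C30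
    rho_lip C40 eta_lip K2 E4 E5 s23 Wx).
move=> s s23.
exact: (refl_diffeomorphism tv Sc S0 c10 c20 C0 rho_cls rho_bounds rho_derive C30 rho_lip
  C40 eta_lip t00 (ltW T1) (ltW T2) T3 (ltW T4) T5 K1 K2 eps10 E1 E2 E3 E4 E5
  (X := fun t y => X (t, y)) XE' s23).
Qed.
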